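(* Let $n\ge 2$, $K>0$, $m\in\{1,\dots,n\}$ and $\alpha\in(0,1)$, and let $X:\mathcal M^n\times[0,T)\to\mathbb S_K^{n+1}$ be a solution to mean curvature flow with $\mathcal M^n$ compact, such that $$|A|^2\le \frac{1}{n-m+\alpha}H^2+2(m-\alpha)K \qquad ( * )$$ holds on $\mathcal M^n\times\{0\}$. If $m<\alpha+\min\{\frac n2,\frac{2(n-1)}{3}\}$, then $( * )$ holds on $\mathcal M^n\times\{t\}$ for all $t\in[0,T)$.
   Context: $\mathbb S_K^{n+1}$ is the round sphere in $\mathbb R^{n+2}$ of sectional curvature $K$, i.e. of radius $K^{-1/2}$. A solution to mean curvature flow is a smooth one-parameter family of immersions $X(\cdot,t):\mathcal M^n\to\mathbb S_K^{n+1}$ whose velocity $\partial_tX$ equals the mean curvature vector of $X(\cdot,t)$ in $\mathbb S_K^{n+1}$. $A$ is the second fundamental form of $X(\cdot,t)$ as a hypersurface of $\mathbb S_K^{n+1}$ and $H=\operatorname{tr}A$ is the mean curvature. *)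

(* Defs.v *)
From HB Require Import structures.
From mathcomp Require Import all_boot all_order all_algebra.
From mathcomp Require Import all_classical all_reals all_analysis.
Set Implicit Arguments.
Unset Strict Implicit.
Unset Printing Implicit Defensive.
Import Order.TTheory GRing.Theory Num.Theory.
Import numFieldNormedType.Exports.
Local Open Scope classical_set_scope.
Local Open Scope ring_scope.

(* [V] is meant to be finite-dimensional and [U] open: then continuity of all
   iterated directional derivatives up to order [k] is the usual C^k. *)
Fixpoint Ck (R : realType) (V W : normedModType R) (k : nat) (U : set V)
    (f : V -> W) : Prop :=
  (forall x, U x -> {for x, continuous f}) /\
  (if k is k'.+1 then
     forall v : V, (forall x, U x -> derivable f x v) /\ Ck k' U ('D_v f)
   else True).

(* Smoothness on an arbitrary subset [S], e.g. a product of an open set with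
   [0, T): near each point of [S], [f] has a smooth extension. *)
Definition smooth_on (R : realType) (V W : normedModType R) (S : set V)
    (f : V -> W) : Prop :=
  forall x, S x -> exists (U : set V) (g : V -> W),
    [/\ open U, U x, forall k, Ck k U g & forall y, S y -> U y -> g y = f y].

(* [param] is the inverse of [coord : dom -> coord @` dom]; both are total
   functions whose values elsewhere are irrelevant. *)
Record chart (R : realType) (n : nat) (M : topologicalType) := Chart {
  dom : set M;
  coord : M -> 'rV[R]_n;
  param : 'rV[R]_n -> M;
  dom_open : open dom;
  image_open : open (coord @` dom);
  coordK : forall p, dom p -> param (coord p) = p;
  coord_continuous : {within dom, continuous coord};
  param_continuous : {within coord @` dom, continuous param}
}.

Record smooth_manifold (R : realType) (n : nat) (M : topologicalType)
    (atlas : set (chart R n M)) : Prop := SmoothManifold {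
  manifold_hausdorff : hausdorff_space M;
  manifold_second_countable : @second_countable M;
  atlas_cover : forall p, exists2 c, atlas c & dom c p;
  atlas_smooth : forall c c', atlas c -> atlas c' ->
    smooth_on (coord c @` (dom c `&` dom c')) (coord c' \o param c)
}.

Definition dot (R : realType) (d : nat) (x y : 'rV[R]_d) : R :=
  (x *m y^T) 0 0.

Definition sphere (R : realType) (d : nat) (K : R) : set 'rV[R]_d :=
  [set x | dot x x = K^-1].

(* Orthogonal projection onto the tangent space at [x] of the sphere
   [dot x x = K^-1]. *)
Definition sphere_proj (R : realType) (d : nat) (K : R) (x v : 'rV[R]_d) :
    'rV[R]_d :=
  v - (K * dot v x) *: x.

(* Below, [F] is a local parametrization of a hypersurface of the sphere in
   R^(n+2) and [u] a point of the coordinate domain. Row [i] of the jacobian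
   ['J F u] is the i-th partial derivative of [F]. *)

Definition metric (R : realType) (n : nat) (F : 'rV[R]_n -> 'rV[R]_n.+2)
    (u : 'rV[R]_n) : 'M[R]_n :=
  'J F u *m ('J F u)^T.

Definition unit_normal (R : realType) (n : nat) (F : 'rV[R]_n -> 'rV[R]_n.+2)
    (u : 'rV[R]_n) (nu : 'rV[R]_n.+2) : Prop :=
  [/\ dot nu nu = 1, dot (F u) nu = 0
    & forall i : 'I_n, dot (row i ('J F u)) nu = 0].

(* The Levi-Civita connection of the sphere is the tangential projection of
   the derivative in R^(n+2): this is the covariant derivative, in the i-th
   coordinate direction, of the j-th coordinate field of [F]. *)
Definition sphere_hessian (R : realType) (n : nat) (K : R)
    (F : 'rV[R]_n -> 'rV[R]_n.+2) (u : 'rV[R]_n) (i j : 'I_n) : 'rV[R]_n.+2 :=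
  sphere_proj K (F u) ('D_(delta_mx 0 i) ('D_(delta_mx 0 j) F) u).

Definition second_form (R : realType) (n : nat) (K : R)
    (F : 'rV[R]_n -> 'rV[R]_n.+2) (u : 'rV[R]_n) (nu : 'rV[R]_n.+2) : 'M[R]_n :=
  \matrix_(i, j) dot (sphere_hessian K F u i j) nu.

(* g^{ij} h_{ij} *)
Definition mean_curvature (R : realType) (n : nat) (K : R)
    (F : 'rV[R]_n -> 'rV[R]_n.+2) (u : 'rV[R]_n) (nu : 'rV[R]_n.+2) : R :=
  \sum_(i < n) \sum_(j < n)
    invmx (metric F u) i j * second_form K F u nu i j.

(* g^{ij} g^{kl} h_{ik} h_{jl} *)
Definition normsq_second_form (R : realType) (n : nat) (K : R)
    (F : 'rV[R]_n -> 'rV[R]_n.+2) (u : 'rV[R]_n) (nu : 'rV[R]_n.+2) : R :=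
  \sum_(i < n) \sum_(j < n) \sum_(k < n) \sum_(l < n)
    invmx (metric F u) i j * invmx (metric F u) k l *
    second_form K F u nu i k * second_form K F u nu j l.

Definition in_chart (R : realType) (n : nat) (M : topologicalType)
    (X : M -> R -> 'rV[R]_n.+2) (c : chart R n M) (t : R) :
    'rV[R]_n -> 'rV[R]_n.+2 :=
  fun u => X (param c u) t.

(* [0, T), where T = +oo is allowed. *)
Definition times (R : realType) (T : \bar R) : set R :=
  [set t | 0 <= t /\ (t%:E < T)%E].

(* The mean curvature vector is [mean_curvature nu *: nu], whichever of the two
   unit normals [nu] is chosen, so quantifying over [nu] requires no
   orientation. At t = 0 the velocity is the one-sided derivative. *)
Record mean_curvature_flow (R : realType) (n : nat) (K : R)
    (M : topologicalType) (atlas : set (chart R n M)) (T : \bar R)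
    (X : M -> R -> 'rV[R]_n.+2) : Prop := MeanCurvatureFlow {
  mcf_sphere : forall p t, times T t -> sphere K (X p t);
  mcf_smooth : forall c, atlas c ->
    smooth_on ((coord c @` dom c) `*` times T)
      (fun z : 'rV[R]_n * R => in_chart X c z.2 z.1);
  mcf_immersion : forall c p t, atlas c -> dom c p -> times T t ->
    row_free ('J (in_chart X c t) (coord c p));
  mcf_velocity : forall c p t nu, atlas c -> dom c p -> times T t ->
    unit_normal (in_chart X c t) (coord c p) nu ->
    (fun s => (s - t)^-1 *: (X p s - X p t)) @ within (times T) t^' -->
      mean_curvature K (in_chart X c t) (coord c p) nu *: nu
}.

(* The inequality does not depend on the choice of the chart around [p] or of
   the unit normal. *)
Definition pinched (R : realType) (n m : nat) (K alpha : R)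
    (M : topologicalType) (atlas : set (chart R n M))
    (X : M -> R -> 'rV[R]_n.+2) (p : M) (t : R) : Prop :=
  forall c nu, atlas c -> dom c p ->
    unit_normal (in_chart X c t) (coord c p) nu ->
    normsq_second_form K (in_chart X c t) (coord c p) nu <=
      (n%:R - m%:R + alpha)^-1 *
        mean_curvature K (in_chart X c t) (coord c p) nu ^+ 2 +
      2 * (m%:R - alpha) * K.

(* Main.v *)
(* Let [f] be |A|^2, [a] = 1/(n-m+alpha), [b] = 2(m-alpha)K and Q = f - a H^2 - b.
   Simons' identity and the Codazzi equation (in the form of the inequality
   |grad A|^2 >= 3/(n+2) |grad H|^2) give
     (d/dt - Laplacian) Q <= (2(f+nK) - 4K(n-m+alpha)) Q
                             - 4K^2 (m-alpha) (n-2(m-alpha)),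
   where m-alpha <= 2(n-1)/3 is the condition a <= 3/(n+2) that makes the gradient
   terms nonpositive, and m-alpha < n/2 makes the last constant negative. Hence
   exp(-l t) Q with l large cannot attain a positive maximum over M x [0, t1] at a
   positive time.

   The evolution inequality is only needed at the maximum. There a quadratic change
   of coordinates makes the metric the identity and the Christoffel symbols zero,
   and both H and |A|^2 = |d nu|^2 are expressed by first derivatives of the
   immersion F and of the normal nu. Differentiating the orthogonality relations
   between F, nu and their derivatives gives all the identities; the remaining
   coordinate-dependent terms <F_ijk, F_l> cancel, so that no curvature tensor or
   covariant derivative has to be introduced. *)

Require Import Defs.
From HB Require Import structures.
From mathcomp Require Import all_boot all_order all_algebra.
From mathcomp Require Import all_classical all_reals all_analysis.
From mathcomp Require Import ring lra.
Import Defs.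
Import Order.TTheory GRing.Theory Num.Theory.
Import numFieldNormedType.Exports.
Local Open Scope classical_set_scope.
Local Open Scope ring_scope.
Set Implicit Arguments.
Unset Strict Implicit.
Unset Printing Implicit Defensive.

(** * Smooth functions and directional derivatives *)

(** No global unit normal is available, and smoothness at time 0 only means that chart expressions
    extend smoothly to earlier times; both facts shape the argument. |A|^2 and H^2 do not see the
    sign of the normal, so they are functions on M x [0, t1]. Near each point they coincide with
    smooth functions of the coordinates, built from an extension of the flow and from a local unit
    normal obtained by projecting a fixed vector and normalizing it. This gives continuity up to
    time 0, hence maxima by compactness. The maximum of |A|^2 fixes l = 2 (max |A|^2 + n K), which
    dominates the positive factor of Q in the evolution inequality; the maximum of exp(-l t) Q is
    the point of contradiction. Initial pinching forces it to a positive time, where the extension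
    is the flow itself and the time derivative is two-sided. That time may be t1, so only earlier
    times can be compared with it. *)

Section Ck.
Context {R : realType}.
Implicit Types V W : normedModType R.

Lemma open_near (V : topologicalType) (U : set V) x : open U -> U x ->
  \forall y \near x, U y.
Proof. by move=> oU Ux; apply: open_nbhs_nbhs. Qed.

Lemma near_eq_continuous V W (f g : V -> W) x :
  (\forall y \near x, f y = g y) ->
  {for x, continuous f} -> {for x, continuous g}.
Proof.
move=> fg cf; have /= E := nbhs_singleton fg.
have : f @ x --> g x by rewrite -E; exact: cf.
exact: cvg_trans (near_eq_cvg fg).
Qed.

Lemma eq_on_near V W (U : set V) (f g : V -> W) x : open U ->
  (forall y, U y -> f y = g y) -> U x -> \forall y \near x, f y = g y.
Proof. by move=> oU fg Ux; apply: filterS fg (open_near oU Ux). Qed.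

Lemma eq_derive_on V W (U : set V) (f g : V -> W) v x : open U ->
  (forall y, U y -> f y = g y) -> U x -> 'D_v f x = 'D_v g x.
Proof. by move=> oU fg Ux; apply: near_eq_derive; exact: eq_on_near Ux. Qed.

Lemma eq_Ck V W k (U : set V) (f g : V -> W) : open U ->
  (forall y, U y -> f y = g y) -> Ck k U f -> Ck k U g.
Proof.
move=> oU; elim: k f g => [|k IH] f g fg [cf Df]; split => //.
- by move=> x Ux; apply: near_eq_continuous (cf x Ux); exact: eq_on_near Ux.
- by move=> x Ux; apply: near_eq_continuous (cf x Ux); exact: eq_on_near Ux.
move=> v; have [df Cf] := Df v; split.
  move=> x Ux; apply: near_eq_derivable (df x Ux); exact: eq_on_near Ux.
by apply: IH Cf => y Uy; apply: eq_derive_on Uy.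
Qed.

Lemma Ck_subset V W k (U U' : set V) (f : V -> W) :
  U' `<=` U -> Ck k U f -> Ck k U' f.
Proof.
move=> sU; elim: k f => [|k IH] f [cf Df]; split => //.
- by move=> x /sU; exact: cf.
- by move=> x /sU; exact: cf.
by move=> v; have [df Cf] := Df v; split; [move=> x /sU; exact: df | exact: IH].
Qed.

Lemma Ck_succ V W k (U : set V) (f : V -> W) : Ck k.+1 U f -> Ck k U f.
Proof.
elim: k f => [|k IH] f [cf Df]; split => //.
by move=> v; have [df Cf] := Df v; split => //; exact: IH.
Qed.

Lemma Ck_cst V W k (U : set V) (c : W) : Ck k U (cst c).
Proof.
elim: k c => [|k IH] c; split => //; try by move=> x _; exact: cst_continuous.
move=> v; split; first by move=> x _; exact: derivable_cst.
have -> : 'D_v (cst c : V -> W) = cst 0 by apply/funext => x; rewrite derive_cst.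
exact: IH.
Qed.

Lemma CkD V W k (U : set V) (f g : V -> W) : open U ->
  Ck k U f -> Ck k U g -> Ck k U (fun x => f x + g x).
Proof.
move=> oU; elim: k f g => [|k IH] f g [cf Df] [cg Dg]; split => //.
- by move=> x Ux; apply: continuousD; [exact: cf|exact: cg].
- by move=> x Ux; apply: continuousD; [exact: cf|exact: cg].
move=> v; have [df Cf] := Df v; have [dg Cg] := Dg v; split.
  by move=> x Ux; apply: derivableD; [exact: df|exact: dg].
apply: eq_Ck (IH _ _ Cf Cg) => // y Uy.
by rewrite deriveD //; [exact: df|exact: dg].
Qed.

Lemma CkM V k (U : set V) (f g : V -> R) : open U ->
  Ck k U f -> Ck k U g -> Ck k U (fun x => f x * g x).
Proof.
move=> oU; elim: k f g => [|k IH] f g Kf Kg; have [cf Df] := Kf; have [cg Dg] := Kg.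
  by split => // x Ux; apply: continuousM; [exact: cf|exact: cg].
split; first by move=> x Ux; apply: continuousM; [exact: cf|exact: cg].
move=> v; have [df Cf] := Df v; have [dg Cg] := Dg v; split.
  by move=> x Ux; apply: derivableM; [exact: df|exact: dg].
have := CkD oU (IH _ _ (Ck_succ Kf) Cg) (IH _ _ (Ck_succ Kg) Cf).
apply: eq_Ck => // y Uy.
by rewrite deriveM //; [exact: df|exact: dg].
Qed.

Lemma CkV V k (U : set V) (f : V -> R) : open U ->
  (forall x, U x -> f x != 0) -> Ck k U f -> Ck k U (fun x => (f x)^-1).
Proof.
move=> oU f0; elim: k => [|k IH] Kf; have [cf Df] := Kf.
  by split => // x Ux; apply: cvgV; [exact: f0|exact: cf].
split; first by move=> x Ux; apply: cvgV; [exact: f0|exact: cf].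
move=> v; have [df Cf] := Df v; split.
  by move=> x Ux; apply: derivableV; [exact: f0|exact: df].
have iKf := IH (Ck_succ Kf).
apply: eq_Ck (CkM oU (Ck_cst k U (-1 : R)) (CkM oU (CkM oU iKf iKf) Cf)) => // y Uy.
rewrite /cst deriveV //; [|exact: f0|exact: df].
by rewrite -exprVn expr2 /GRing.scale/= mulN1r mulNr.
Qed.

End Ck.

(** * Restriction to lines and the mean value theorem *)

Section Lines.
Context {R : realType}.
Implicit Types V W : normedModType R.

Lemma is_derive_line V W (f : V -> W) y v (s : R) :
  derivable f (y + s *: v) v ->
  is_derive s 1 (fun t : R => f (y + t *: v)) ('D_v f (y + s *: v)).
Proof.
move=> df.
have E : (fun h : R => h^-1 *: (((fun t : R => f (y + t *: v)) \o shift s) (h *: 1)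
            - f (y + s *: v))) =
         (fun h : R => h^-1 *: ((f \o shift (y + s *: v)) (h *: v) - f (y + s *: v))).
  apply/funext => h /=; congr (_ *: (f _ - _)).
  by rewrite [h *: 1]mulr1 scalerDl addrCA.
by split; rewrite /derivable /derive E.
Qed.

(** The range [|s| <= |c|], symmetric about 0, lets the sign of [c] be arbitrary, as is needed when
    [c] is a coordinate of a small vector. *)
Lemma MVT_line V (f : V -> R) y v (c : R) :
  (forall s : R, `|s| <= `|c| -> derivable f (y + s *: v) v) ->
  exists2 s, `|s| <= `|c| & f (y + c *: v) - f y = c * 'D_v f (y + s *: v).
Proof.
move=> df; set g := fun t : R => f (y + t *: v).
have dg (s : R) : `|s| <= `|c| -> is_derive s 1 g ('D_v f (y + s *: v)).
  by move=> sc; apply: is_derive_line; exact: df.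
have g0 : g 0 = f y by rewrite /g scale0r addr0.
have [c0|c0|->] := ltgtP c 0.
- have [| |s sI E] := @MVT R g (fun s => 'D_v f (y + s *: v)) c 0 c0.
  + move=> s /[!in_itv]/= /andP[cs s0]; apply: dg.
    by rewrite !ltr0_norm// lerN2 ltW.
  + apply: derivable_within_continuous => s /[!in_itv]/= /andP[cs s0].
    by apply: (@ex_derive _ _ _ _ _ _ _ (dg s _)); rewrite ler0_norm// ler0_norm
      ?lerN2// ltW.
  exists s; last by move: E; rewrite g0 -/(g c) => E; lra.
  by move: sI; rewrite in_itv/= => /andP[cs s0]; rewrite !ltr0_norm// lerN2 ltW.
- have [| |s sI E] := @MVT R g (fun s => 'D_v f (y + s *: v)) 0 c c0.
  + move=> s /[!in_itv]/= /andP[cs s0]; apply: dg.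
    by rewrite !gtr0_norm// ltW.
  + apply: derivable_within_continuous => s /[!in_itv]/= /andP[cs s0].
    by apply: (@ex_derive _ _ _ _ _ _ _ (dg s _)); rewrite ger0_norm// ger0_norm// ltW.
  exists s; last by move: E; rewrite g0 -/(g c) => E; lra.
  by move: sI; rewrite in_itv/= => /andP[cs s0]; rewrite !gtr0_norm// ltW.
- by exists 0; rewrite ?normr0// scale0r addr0 subrr mul0r.
Qed.

End Lines.

(** * Symmetry of second derivatives *)

Section Schwarz.
Context {R : realType} {V : normedModType R}.

(** The mean value theorem is applied to [z |-> f (z + s w) - f z] along [v], then to ['D_v f] along
    [w]. The left side is symmetric in [v] and [w], which yields Schwarz; with [v = w] it is the
    centred second difference used at a maximum. *)
Lemma second_difference (f : V -> R) x v w (s : R) :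
  (forall a b : R, `|a| <= `|s| -> `|b| <= `|s| -> derivable f (x + a *: v +
    b *: w) v) ->
  (forall a b : R, `|a| <= `|s| -> `|b| <= `|s| ->
     derivable ('D_v f) (x + a *: v + b *: w) w) ->
  exists a b, [/\ `|a| <= `|s|, `|b| <= `|s| &
    f (x + s *: v + s *: w) - f (x + s *: v) - f (x + s *: w) + f x =
    s ^+ 2 * 'D_w ('D_v f) (x + a *: v + b *: w)].
Proof.
move=> d1 d2; pose g z := f (z + s *: w) - f z.
have dsh z u : derivable f (z + s *: w) u -> is_derive z u (fun z => f (z +
  s *: w)) ('D_u f (z + s *: w)).
  move=> df.
  have E : (fun h : R => h^-1 *: (((fun z => f (z +
    s *: w)) \o shift z) (h *: u) - f (z + s *: w))) =
    (fun h : R => h^-1 *: ((f \o shift (z + s *: w)) (h *: u) - f (z + s *: w))).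
    by apply/funext => h /=; rewrite addrA.
  by split; rewrite /derivable /derive E.
have s0 : `|0 : R| <= `|s| by rewrite normr0.
have D1 (a : R) : `|a| <= `|s| -> is_derive (x + a *: v) v (fun z => f (z +
  s *: w)) ('D_v f (x + a *: v + s *: w)).
  by move=> sa; apply: dsh; apply: d1.
have D2 (a : R) : `|a| <= `|s| -> is_derive (x + a *: v) v f ('D_v f (x + a *: v)).
  by move=> sa; apply: derivableP; have := d1 a 0 sa s0; rewrite scale0r addr0.
have [|a sa Ea] := @MVT_line R V g x v s.
  by move=> a sa; apply: derivableB; [apply: (@ex_derive _ _ _ _ _ _ _ (D1 a
    sa))|apply: (@ex_derive _ _ _ _ _ _ _ (D2 a sa))].
have [|b sb Eb] := @MVT_line R V ('D_v f) (x + a *: v) w s.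
  by move=> b sb; exact: d2.
exists a, b; split => //.
have := Ea; rewrite {3}/g deriveB; [|exact: (@ex_derive _ _ _ _ _ _ _ (D1 a
  sa))|exact: (@ex_derive _ _ _ _ _ _ _ (D2 a sa))].
rewrite (@derive_val _ _ _ _ _ _ _ (D1 a sa)) /= Eb /g => E.
rewrite expr2 -mulrA -E; ring.
Qed.

Lemma near_square (x v w : V) (P : V -> Prop) : (\forall z \near x, P z) ->
  exists2 d : R, 0 < d & forall a b : R, `|a| <= d -> `|b| <= d -> P (x + a *: v +
    b *: w).
Proof.
move=> /nbhs_ballP[r /= r0 rP].
pose C := 1 + `|v| + `|w|; have C0 : 0 < C by rewrite /C; have := normr_ge0 v;
  have := normr_ge0 w; lra.
exists (r / 2 / C); first by rewrite !divr_gt0.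
move=> a b ad bd; apply: rP; rewrite -ball_normE /ball_/= -addrA opprD addNKr normrN.
apply: le_lt_trans (ler_normD _ _) _; rewrite !normrZ.
have h1 : `|a| * `|v| <= r / 2 / C * `|v| by apply: ler_wpM2r.
have h2 : `|b| * `|w| <= r / 2 / C * `|w| by apply: ler_wpM2r.
apply: le_lt_trans (lerD h1 h2) _; rewrite -mulrDr -mulrA.
have : C^-1 * (`|v| + `|w|) <= 1.
  by rewrite mulrC ler_pdivrMr// mul1r /C -addrA lerDr.
move=> h3; have := @ler_wpM2l _ (r / 2) _ _ _ h3; rewrite mulr1 => h4.
by apply: le_lt_trans (h4 _) _; lra.
Qed.

(** The same second difference equals [d ^+ 2] times each mixed derivative, taken at two points of a
    small square. By continuity these two equal values lie within a third of the supposed gap from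
    the two derivatives at [x], which is absurd. *)
Lemma schwarz_real (U : set V) (f : V -> R) x v w : open U -> U x ->
  Ck 2 U f -> 'D_v ('D_w f) x = 'D_w ('D_v f) x.
Proof.
move=> oU Ux [cf Df].
have [dv [_ Dv]] := Df v; have [dw [_ Dw]] := Df w.
have [dvw [cvw _]] := Dv w; have [dwv [cwv _]] := Dw v.
apply/eqP; rewrite -subr_eq0 -normr_le0 leNgt; apply/negP => e0.
set A := 'D_v ('D_w f) x in e0 *; set B := 'D_w ('D_v f) x in e0 *.
pose e := `|A - B| / 3; have e1 : 0 < e by rewrite divr_gt0.
have hB : \forall z \near x, `|B - 'D_w ('D_v f) z| < e.
  by have /cvgrPdist_lt := cvw x Ux; apply.
have hA : \forall z \near x, `|A - 'D_v ('D_w f) z| < e.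
  by have /cvgrPdist_lt := cwv x Ux; apply.
have N1 : \forall z \near x, U z /\ (`|B - 'D_w ('D_v f) z| < e /\ `|A - 'D_v ('D_w
  f) z| < e).
  by apply: filter_app hA; apply: filter_app hB; near=> z => hB hA; split => //;
    near: z; exact: open_near.
have [d d0 Pd] := near_square v w N1.
have nd : `|d| = d by rewrite gtr0_norm.
have [||a [b [sa sb E1]]] := @second_difference f x v w d.
- by move=> a b; rewrite nd => ad bd; apply: dv; have [] := Pd a b ad bd.
- by move=> a b; rewrite nd => ad bd; apply: dvw; have [] := Pd a b ad bd.
have C z1 z2 : x + z1 *: w + z2 *: v = x + z2 *: v + z1 *: w by rewrite addrAC.
have [||b' [a' [sb' sa' E2]]] := @second_difference f x w v d.
- by move=> b' a'; rewrite nd C => bd ad; apply: dw; have [] := Pd a' b' ad bd.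
- by move=> b' a'; rewrite nd C => bd ad; apply: dwv; have [] := Pd a' b' ad bd.
rewrite nd in sa sb sa' sb'.
have [_ [h1 _]] := Pd a b sa sb; have [_ [_ h2]] := Pd a' b' sa' sb'.
rewrite (C d d) (C b' a') in E2.
have E : 'D_w ('D_v f) (x + a *: v + b *: w) = 'D_v ('D_w f) (x + a' *: v + b' *: w).
  apply: (@mulfI _ (d ^+ 2)); first by rewrite expf_neq0// gt_eqF.
  by apply: etrans (esym E1) (etrans _ E2); congr (_ + _); rewrite addrAC.
move: h1 h2; rewrite E; move: ('D_v ('D_w f) (x + a' *: v + b' *: w)) => q.
rewrite {hA hB N1 Pd e1}/e; move: (e0); clearbody A B; clear => e0 h1 h2.
have : `|A - B| <= `|A - q| + `|B - q|.
  by rewrite [X in _ <= _ + X]distrC; apply: le_trans (ler_normD _ _);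
    rewrite addrA addrNK.
by move=> h3; move: h1 h2 h3 e0; move: `|A - B| `|A - q| `|B - q| => a b c; lra.
Unshelve. all: by end_near. Qed.

End Schwarz.

(** * Matrix-valued maps, determinants, inverses and square roots *)

Section Matrices.
Context {R : realType}.
Implicit Types V W : normedModType R.

Lemma continuous_mxP V m n (M : V -> 'M[R]_(m, n)) x :
  {for x, continuous M} <-> forall i j, {for x, continuous (fun y => M y i j)}.
Proof.
split=> [cM i j|cM].
  exact: (@continuous_comp _ _ _ M (fun N : 'M[R]_(m, n) =>
    N i j) x cM (@matrix_normedtype.coord_continuous R m n i j (M x))).
apply/cvgrPdist_le => e e0; near=> y.
rewrite [leLHS]/Num.Def.normr/= mx_normrE (bigmax_le _ (ltW e0))//= => i _.
rewrite !mxE; move: i; near: y; apply: filter_forall => /= i.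
by have /cvgrPdist_le := cM i.1 i.2; apply.
Unshelve. all: by end_near. Qed.

Lemma derive_mxE V m n (M : V -> 'M[R]_(m, n)) x v i j :
  derivable M x v -> ('D_v M x) i j = 'D_v (fun y => M y i j) x.
Proof. by move=> dM; rewrite derive_mx// mxE. Qed.

Lemma Ck_mxP V m n k (U : set V) (M : V -> 'M[R]_(m, n)) : open U ->
  Ck k U M <-> forall i j, Ck k U (fun y => M y i j).
Proof.
move=> oU; elim: k M => [|k IH] M.
  split=> [[cM _] i j|cM]; split => // x Ux.
    by have /continuous_mxP := cM x Ux; apply.
  by apply/continuous_mxP => i j; have [] := cM i j; move=> /(_ x Ux).
split=> [[cM DM] i j|CM]; split.
- by move=> x Ux; have /continuous_mxP := cM x Ux; apply.
- move=> v; have [dM CM] := DM v; split.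
    by move=> x Ux; have /derivable_mxP := dM x Ux; apply.
  have /IH/(_ i j) := CM; apply: eq_Ck => // y Uy.
  by rewrite derive_mxE//; exact: dM.
- by move=> x Ux; apply/continuous_mxP => i j; have [] := CM i j; move=> /(_ x Ux).
- move=> v.
  have dM x : U x -> derivable M x v.
    move=> Ux; apply/derivable_mxP => i j.
    by have [_ /(_ v)[/(_ x Ux)]] := CM i j.
  split => //; apply/IH => i j.
  have [_ /(_ v)[_]] := CM i j; apply: eq_Ck => // y Uy.
  by rewrite derive_mxE//; exact: dM.
Qed.

Lemma Ck_derivable V W k (U : set V) (f : V -> W) x v :
  Ck k.+1 U f -> U x -> derivable f x v.
Proof. by move=> [_ /(_ v)[+ _]] Ux; apply. Qed.

Lemma schwarz V m n (U : set V) (M : V -> 'M[R]_(m, n)) x v w : open U -> U x ->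
  Ck 2 U M -> 'D_v ('D_w M) x = 'D_w ('D_v M) x.
Proof.
move=> oU Ux CM; have [_ DM] := CM.
have E u u' i j : ('D_u ('D_u' M) x) i j = 'D_u ('D_u' (fun y => M y i j)) x.
  have [dM CM'] := DM u'.
  have dM' : derivable ('D_u' M) x u by exact: (@Ck_derivable _ _ 0 U _ _ u CM').
  apply: etrans (derive_mxE i j dM') _.
  by apply: eq_derive_on Ux => // y Uy; apply: derive_mxE; exact: dM.
apply/matrixP => i j; apply: etrans (E v w i j) (etrans _ (esym (E w v i j))).
by apply: (@schwarz_real _ _ U) => //; have /Ck_mxP := CM; apply.
Qed.

Lemma Ck_sum V k (U : set V) I (s : seq I) (P : pred I) (f : I -> V -> R) :
  open U -> (forall i, P i -> Ck k U (f i)) -> Ck k U (fun x =>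
    \sum_(i <- s | P i) f i x).
Proof.
move=> oU Cf; elim: s => [|i s IH].
  by apply: eq_Ck (Ck_cst k U (0 : R)) => // y _; rewrite big_nil.
have [Pi|nPi] := boolP (P i).
  by apply: eq_Ck (CkD oU (Cf i Pi) IH) => // y _; rewrite big_cons Pi.
by apply: eq_Ck IH => // y _; rewrite big_cons (negbTE nPi).
Qed.

Lemma Ck_prod V k (U : set V) I (s : seq I) (f : I -> V -> R) :
  open U -> (forall i, Ck k U (f i)) -> Ck k U (fun x => \prod_(i <- s) f i x).
Proof.
move=> oU Cf; elim: s => [|i s IH].
  by apply: eq_Ck (Ck_cst k U (1 : R)) => // y _; rewrite big_nil.
by apply: eq_Ck (CkM oU (Cf i) IH) => // y _; rewrite big_cons.
Qed.

Lemma Ck_det V n k (U : set V) (M : V -> 'M[R]_n) : open U ->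
  Ck k U M -> Ck k U (fun x => \det (M x)).
Proof.
move=> oU /(Ck_mxP _ _ oU) CM; rewrite /determinant.
apply: Ck_sum => // s _; apply: CkM => //; first exact: Ck_cst.
exact: Ck_prod.
Qed.

(** Cramer's formula: the entries are cofactors divided by the determinant. *)
Lemma Ck_invmx V n k (U : set V) (M : V -> 'M[R]_n) : open U ->
  (forall x, U x -> M x \in unitmx) -> Ck k U M -> Ck k U (fun x => invmx (M x)).
Proof.
move=> oU uM CM; have /(Ck_mxP _ _ oU) CMij := CM.
apply/Ck_mxP => // i j.
have C1 : Ck k U (fun x => (\det (M x))^-1).
  by apply: CkV => //; [move=> x /uM; rewrite unitmxE unitfE | exact: Ck_det].
have C2 : Ck k U (fun x => \det (row' j (col' i (M x)))).
  by apply: Ck_det => //; apply/Ck_mxP => // a b; apply: eq_Ck (CMij (lift j a) (lift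
    i b)) => // y _; rewrite !mxE.
apply: eq_Ck (CkM oU C1 (CkM oU (Ck_cst k U ((-1) ^+ (j + i) : R)) C2)) => // x /uM uMx.
by rewrite /invmx uMx !mxE.
Qed.

(** The derivative [(2 sqrt f)^-1 f'] involves only [sqrt f] and [f'], so the induction hypothesis
    at one order less applies to it. *)
Lemma Ck_sqrt V k (U : set V) (f : V -> R) : open U ->
  (forall x, U x -> 0 < f x) -> Ck k U f -> Ck k U (fun x => Num.sqrt (f x)).
Proof.
move=> oU f0; elim: k => [|k IH] Kf; have [cf Df] := Kf.
  by split => // x Ux; apply: (continuous_comp (cf x Ux)); exact: sqrt_continuous.
split; first by move=> x Ux; apply: (continuous_comp (cf x Ux)); exact: sqrt_continuous.
move=> v; have [df Cf] := Df v.
have D x : U x -> is_derive x v (fun x => Num.sqrt (f x)) ((2 * Num.sqrt (f x))^-1 *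
  'D_v f x).
  move=> Ux; have df0 := df x Ux.
  have dl : is_derive (0:R) 1 (fun t : R => f (x + t *: v)) ('D_v f x).
    by have := @is_derive_line R V R^o f x v 0; rewrite scale0r addr0; apply.
  have dl' : is_derive (f (x + 0 *: v)) 1 (@Num.sqrt R) (2 * Num.sqrt (f x))^-1.
    by rewrite scale0r addr0; apply: is_derive1_sqrt; exact: f0.
  have [h1 h2] := is_derive1_comp dl' dl.
  have E : (fun h : R => h^-1 *: (((fun x => Num.sqrt (f x)) \o shift x) (h *: v) -
    Num.sqrt (f x)))
     = (fun h : R => h^-1 *: (((Num.sqrt \o (fun t : R => f (x +
       t *: v))) \o shift 0) (h *: 1) - (Num.sqrt \o (fun t : R => f (x + t *: v))) 0)).
    apply/funext => h /=; rewrite scale0r !addr0; congr (_ *: (Num.sqrt (f _) - _)).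
    by rewrite [h *: 1]mulr1 addrC.
  split; first by rewrite /derivable E.
  by rewrite /derive E; rewrite -h2.
split; first by move=> x Ux; exact: (@ex_derive _ _ _ _ _ _ _ (D x Ux)).
have IK := IH (Ck_succ Kf).
apply: eq_Ck (CkM oU (CkV oU _ (CkM oU (Ck_cst k U (2 : R)) IK)) Cf) => // x Ux.
  by rewrite (@derive_val _ _ _ _ _ _ _ (D x Ux)).
by rewrite /cst mulf_neq0// gt_eqF// sqrtr_gt0; exact: f0.
Qed.

End Matrices.

Arguments Ck_derivable {R V W k U f x} v _ _.

(** A basis with its coordinate functionals, bounded by the norm. This covers at once the row
    vectors R^n and the space-time product R^n x R, on which the flow lives. *)
Record coordinates (R : realType) (V : normedModType R) (I : finType)
    (e : I -> V) (c : I -> V -> R) : Prop := Coordinates {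
  coordinates_linear : forall i, linear_for *%R (c i);
  coordinates_sum : forall z, z = \sum_i c i z *: e i;
  coordinates_le : forall i z, `|c i z| <= `|z|
}.

Lemma near_dist (R : realType) (V : normedModType R) (y : V) (r : R) : 0 < r ->
  \forall z \near y, `|y - z| < r.
Proof. by move=> r0; have := nbhsx_ballx y r r0; rewrite -ball_normE. Qed.

(** * Differentiability from continuous partial derivatives *)

Section Frechet.
Context {R : realType} {V : normedModType R} {I : finType}.
Context {e : I -> V} {c : I -> V -> R} (ec : coordinates e c).
Variables (f : V -> R) (x : V).

(** The candidate differential. It is indexed by the proof [ec] because its linearity comes from
    that proof, and a linear structure is attached to [gradient_map ec]. *)
Definition gradient_map & coordinates e c := fun h : V => \sum_i c i h * 'D_(e i) f x.

Lemma gradient_map_linear : linear_for *%R (gradient_map ec).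
Proof.
move=> a u v; rewrite /gradient_map mulr_sumr -big_split/=; apply: eq_bigr => i _.
by rewrite (coordinates_linear ec) mulrDl mulrA.
Qed.

HB.instance Definition _ := GRing.isLinear.Build R V R *%R (gradient_map ec)
  gradient_map_linear.

Lemma gradient_map_continuous : continuous (gradient_map ec).
Proof.
move=> y; apply/cvgrPdist_lt => eps eps0.
pose C := \sum_i `|'D_(e i) f x|.
have C0 : 0 <= C by apply: sumr_ge0.
have C1 : 0 < C + 1 by lra.
near=> z.
have -> : gradient_map ec y - gradient_map ec z = \sum_i c i (y - z) * 'D_(e i) f x.
  rewrite /gradient_map -sumrB; apply: eq_bigr => i _.
  have := coordinates_linear ec i (-1) z y; rewrite scaleN1r [- z + y]addrC => ->.
  by rewrite mulN1r mulrDl mulNr addrC.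
apply: le_lt_trans (ler_norm_sum _ _ _) _.
apply: (@le_lt_trans _ _ (`|y - z| * C)).
  rewrite mulr_sumr; apply: ler_sum => i _; rewrite normrM ler_wpM2r//.
  exact: (coordinates_le ec).
apply: (@le_lt_trans _ _ (`|y - z| * (C + 1))); first by rewrite ler_wpM2l// lerDl.
rewrite -ltr_pdivlMr//; near: z.
by apply: near_dist; rewrite divr_gt0.
Unshelve. all: by end_near. Qed.

(** The coordinates of the increment are switched on one at a time: each step is a mean value along
    a basis vector, and continuity of that partial derivative at [x] bounds the error. The induction
    over the list of coordinates halves [eps] at each step. *)
Lemma first_order_seq (U : set V) : open U -> U x ->
  (forall i y, U y -> derivable f y (e i)) ->
  (forall i, {for x, continuous ('D_(e i) f)}) ->
  forall (s : seq I) (eps : R), 0 < eps ->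
  \forall h \near (0 : V), `|f (x + \sum_(i <- s) c i h *: e i) - f x
     - \sum_(i <- s) c i h * 'D_(e i) f x| <= eps * `|h|.
Proof.
move=> oU Ux df cDf s; elim: s => [|i s IH] eps eps0.
  near=> h; rewrite !big_nil addr0 subrr subr0 normr0 mulr_ge0//; exact: ltW.
have eps2 : 0 < eps / 2 by lra.
have N : \forall y \near x, U y /\ `|'D_(e i) f x - 'D_(e i) f y| <= eps / 2.
  have /cvgrPdist_le/(_ _ eps2) h := cDf i.
  by apply: filter_app h; near=> y => h; split=> //; near: y; exact: open_near.
move/nbhs_ballP : N => [r /= r0 rP].
pose C := 1 + \sum_(j <- i :: s) `|e j|.
have C0 : 0 < C by rewrite /C ltr_pwDl// sumr_ge0.
have Nh : \forall h \near (0 : V), `|h| < r / C.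
  have rC : 0 < r / C by rewrite divr_gt0.
  apply: filter_app (near_dist 0 rC); near=> h; by rewrite sub0r normrN.
apply: filter_app (IH _ eps2); apply: filter_app Nh; near=> h => hr hs.
rewrite !big_cons.
set S := \sum_(j <- s) _ in hs *; set T := \sum_(j <- s) _ in hs *.
have SC : `|S| <= `|h| * \sum_(j <- s) `|e j|.
  rewrite mulr_sumr; apply: le_trans (ler_norm_sum _ _ _) _.
  by apply: ler_sum => j _; rewrite normrZ ler_wpM2r// (coordinates_le ec).
have close t : `|t| <= `|c i h| -> ball x r (x + S + t *: e i).
  move=> tc; rewrite -ball_normE /ball_/= -addrA opprD addNKr normrN.
  apply: le_lt_trans (ler_normD _ _) _; rewrite normrZ.
  have tc' : `|t| * `|e i| <= `|h| * `|e i|.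
    by rewrite ler_wpM2r// (le_trans tc)// (coordinates_le ec).
  apply: le_lt_trans (lerD SC tc') _; rewrite -mulrDr addrC.
  apply: (@le_lt_trans _ _ (`|h| * C)).
    by rewrite ler_wpM2l// /C big_cons addrC lerDr.
  by rewrite -ltr_pdivlMr.
have [t tc Et] := @MVT_line R V f (x + S) (e i) (c i h) (fun t tc =>
  df i _ (rP _ (close t tc)).1).
have [_ hD] := rP _ (close t tc).
rewrite [c i h *: e i + S]addrC addrA.
move: Et hs hD; move: ('D_(e i) f (x + S + t *: e i)) ('D_(e i) f x) => D1 D2 Et hs hD.
have -> : f (x + S + c i h *: e i) - f x - (c i h * D2 + T) =
   (f (x + S) - f x - T) - c i h * (D2 - D1).
  by rewrite mulrBr -Et; ring.
apply: le_trans (ler_normB _ _) _; rewrite normrM.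
have : `|c i h| * `|D2 - D1| <= `|h| * (eps / 2).
  by rewrite ler_pM// (coordinates_le ec).
move: hs; move: (`|f _ - _ - T|) (`|c i h| * _) `|h| => a b d; nra.
Unshelve. all: by end_near. Qed.

Lemma Ck_differentiable (U : set V) : open U -> U x -> Ck 1 U f -> differentiable f x.
Proof.
move=> oU Ux [cf Df].
have H := first_order_seq oU Ux (fun i y Uy => (Df (e i)).1 y Uy) (fun i =>
  (Df (e i)).2.1 x Ux) (index_enum I).
have E : f \o shift x = cst (f x) + gradient_map ec +o_ 0 id.
  apply/eqaddoP => eps eps0; apply: filter_app (H eps eps0); near=> h => hH.
  rewrite [leLHS](_ : _ = `|f (x + \sum_i c i h *: e i) - f x - \sum_i c i h *
    'D_(e i) f x|) //.
  by rewrite -(coordinates_sum ec) /= [x + h]addrC !fctE opprD addrA.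
have D := diff_unique gradient_map_continuous E.
by apply/diff_locallyP; rewrite D; split => //; exact: gradient_map_continuous.
Unshelve. all: by end_near. Qed.

End Frechet.

(** * The chain rule *)

Section Composition.
Context {R : realType}.
Implicit Types V W : normedModType R.

Lemma derive_lineE V W (f : V -> W) x v :
  'D_v f x = 'D_1 (fun h : R => f (h *: v + x)) 0.
Proof.
rewrite /derive; set g1 := fun h => h^-1 *: _; set g2 := fun h => h^-1 *: _.
suff -> : g1 = g2 by [].
by apply/funext => h; rewrite /g1 /g2 /= addr0 scale0r add0r [h *: 1]mulr1.
Qed.

Lemma is_derive_scalel V (g : R -> R) (w : V) (t dg : R) :
  is_derive t 1 g dg -> is_derive t 1 (fun s => g s *: w) (dg *: w).
Proof.
move=> [dg1 dg2]; have dif : differentiable g t by apply/derivable1_diffP.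
have difw : differentiable (fun s => g s *: w) t by exact: differentiableZl.
split; first exact/derivable1_diffP.
by rewrite deriveE// diffZl//= -deriveE// dg2.
Qed.

Lemma is_derive_sum_seq V (I : Type) (s : seq I) (g : I -> R -> V) (t : R) (dg : I ->
  V) :
  (forall i, is_derive t 1 (g i) (dg i)) ->
  is_derive t 1 (fun x => \sum_(i <- s) g i x) (\sum_(i <- s) dg i).
Proof.
move=> D; elim: s => [|i s IH].
  have -> : (fun x : R => \sum_(i <- [::]) g i x) = cst 0 by apply/funext => x;
    rewrite big_nil.
  by rewrite big_nil; exact: is_derive_cst.
have -> : (fun x => \sum_(j <- i :: s) g j x) = g i + (fun x => \sum_(j <- s) g j x).
  by apply/funext => x; rewrite big_cons.
by rewrite big_cons; exact: is_deriveD.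
Qed.

Section Chain.
Context {V V' : normedModType R} {I : finType} {e : I -> V} {c : I -> V -> R}.
Context (ec : coordinates e c) {U : set V} {U' : set V'}.
Context (oU : open U) (oU' : open U').

Lemma is_derive_comp (f : V -> R) (phi : V' -> V) y w :
  U' y -> (forall z, U' z -> U (phi z)) ->
  (forall i, Ck 1 U' (fun z => c i (phi z))) -> Ck 1 U f ->
  is_derive y w (fun z => f (phi z))
    (\sum_i 'D_w (fun z => c i (phi z)) y * 'D_(e i) f (phi y)).
Proof.
move=> Uy phiU Cphi Cf.
have dff : differentiable f (phi y) by apply: (Ck_differentiable ec oU (phiU _ Uy)).
have D i : is_derive (0:R) 1 (fun h : R => c i (phi (h *: w + y)) *: e i)
    ('D_w (fun z => c i (phi z)) y *: e i).
  have dci := Ck_derivable w (Cphi i) Uy.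
  apply: is_derive_scalel; split; first exact: (iffLR (derivable1P (fun z =>
    c i (phi z)) y w) dci).
  by rewrite -(derive_lineE (fun z => c i (phi z))).
have [D1 D2] := is_derive_sum_seq (index_enum I) D.
set g := (fun h : R => _) in D1 D2.
have gE h : g h = phi (h *: w + y) by rewrite /g -(coordinates_sum ec).
have g0 : g 0 = phi y by rewrite gE scale0r add0r.
have dg : differentiable g 0 by apply/derivable1_diffP.
have dfg : differentiable f (g 0) by rewrite g0.
have dfg' : differentiable (f \o g) 0 by exact: differentiable_comp.
have E : (fun h : R => f (phi (h *: w + y))) = f \o g by apply/funext => h /=;
  rewrite gE.
split; first by apply/(iffRL (derivable1P (fun z => f (phi z)) y w)); rewrite E;
  apply/derivable1_diffP.
rewrite (derive_lineE (fun z => f (phi z))) E deriveE// diff_comp//= -[X in 'd f _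
  X]deriveE// D2 g0.
rewrite linear_sum; apply: eq_bigr => i _.
by rewrite linearZ/= -(deriveE (e i) dff).
Qed.

Lemma continuous_coordinates (phi : V' -> V) y :
  (forall i, {for y, continuous (fun z => c i (phi z))}) -> {for y, continuous phi}.
Proof.
move=> cphi.
have -> : phi = (fun z => \sum_i c i (phi z) *: e i) by apply/funext => z;
  rewrite -(coordinates_sum ec).
elim: (index_enum I) => [|i s IH].
  have -> : (fun z => \sum_(i <- [::]) c i (phi z) *: e i) = cst 0 by apply/funext =>
    z; rewrite big_nil.
  exact: cst_continuous.
have -> : (fun z => \sum_(j <- i :: s) c j (phi z) *: e j) =
   (fun z => c i (phi z) *: e i) + (fun z => \sum_(j <- s) c j (phi z) *: e j).
  by apply/funext => z; rewrite big_cons.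
apply: continuousD => //.
by apply: cvgZr_tmp; exact: cphi.
Qed.

Lemma Ck_comp k (f : V -> R) (phi : V' -> V) :
  (forall z, U' z -> U (phi z)) ->
  (forall i, Ck k U' (fun z => c i (phi z))) -> Ck k U f ->
  Ck k U' (fun z => f (phi z)).
Proof.
move=> phiU; elim: k f => [|k IH] f Cphi Cf.
  have C0 : forall x, U' x -> {for x, continuous (fun z => f (phi z))}.
    move=> x Ux; have cp := continuous_coordinates (fun i => (Cphi i).1 x Ux).
    exact: (continuous_comp cp (Cf.1 _ (phiU _ Ux))).
  by [].
have C0 : forall x, U' x -> {for x, continuous (fun z => f (phi z))}.
  move=> x Ux; have cp := continuous_coordinates (fun i => (Cphi i).1 x Ux).
  exact: (continuous_comp cp (Cf.1 _ (phiU _ Ux))).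
split=> // w.
have C1 W0 W1 (U0 : set W0) (g : W0 -> W1) : Ck k.+1 U0 g -> Ck 1 U0 g.
  by elim: k {IH Cphi Cf} => // k IH' /Ck_succ.
have D y : U' y -> _ := fun Uy => @is_derive_comp f phi y w Uy phiU (fun i =>
  C1 _ _ _ _ (Cphi i)) (C1 _ _ _ _ Cf).
split; first by move=> y Uy; exact: (@ex_derive _ _ _ _ _ _ _ (D y Uy)).
have := @Ck_sum R V' k U' I (index_enum I) xpredT (fun i y => 'D_w (fun z =>
  c i (phi z)) y * 'D_(e i) f (phi y)) oU'.
move=> /(_ _)/(eq_Ck oU'); apply.
  by move=> y Uy; rewrite (@derive_val _ _ _ _ _ _ _ (D y Uy)).
move=> i _; apply: CkM => //; first by have [_ /(_ w)[]] := Cphi i.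
by apply: (IH ('D_(e i) f)); [move=> j; exact: Ck_succ (Cphi j) | exact: (Cf.2 (e
  i)).2].
Qed.

End Chain.

Lemma row_coordinates n :
  coordinates (fun i => delta_mx 0 i : 'rV[R]_n) (fun i z => z 0 i).
Proof.
split.
- by move=> i a x y; rewrite !mxE.
- exact: row_sum_delta.
- move=> i z; rewrite [leRHS]/Num.Def.normr/= mx_normrE.
  exact: (le_bigmax _ (fun ij => `|z ij.1 ij.2|) (0, i)).
Qed.

(** [None] indexes the time direction, [Some j] the j-th space direction. *)
Lemma row_real_coordinates n :
  coordinates (fun i : option 'I_n => if i is Some j then (delta_mx 0 j, 0) else (0,
    1) : 'rV[R]_n * R)
    (fun i z => if i is Some j then z.1 0 j else z.2).
Proof.
split.
- by move=> [i|] a x y //=; rewrite !mxE.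
- move=> [u t]; rewrite (bigD1 None)//= (reindex_omap Some id) /=; last by case.
  under eq_bigl do rewrite eqxx.
  have S (s : seq 'I_n) : \sum_(i <- s) u 0 i *: (delta_mx 0 i, 0 : R) =
      (\sum_(i <- s) u 0 i *: delta_mx 0 i, 0) :> 'rV[R]_n * R.
    elim: s => [|i s IH]; first by rewrite !big_nil.
    rewrite !big_cons IH; apply: injective_projections => //=.
    by rewrite scaler0 addr0.
  rewrite S -row_sum_delta; apply: injective_projections => /=.
    by rewrite scaler0 add0r.
  by rewrite addr0 [RHS]mulr1.
- move=> [i|] z; rewrite prod_normE/= le_max; last by rewrite lexx orbT.
  by rewrite (coordinates_le (row_coordinates n)).
Qed.

Lemma Ck1_differentiable n d (U : set 'rV[R]_n) (F : 'rV[R]_n -> 'rV[R]_d) u :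
  open U -> U u -> Ck 1 U F -> differentiable F u.
Proof.
move=> oU Uu /(Ck_mxP _ _ oU) CF.
have -> : F = \sum_(j < d) (fun v => F v 0 j *: delta_mx 0 j).
  by apply/funext => v; rewrite fct_sumE [LHS]row_sum_delta.
apply: differentiable_sum => j; apply: differentiableZl.
exact: (Ck_differentiable (row_coordinates n) oU Uu (CF 0 j)).
Qed.

Lemma row_jacobian n d (U : set 'rV[R]_n) (F : 'rV[R]_n -> 'rV[R]_d) u i :
  open U -> U u -> Ck 1 U F -> row i ('J F u) = 'D_(delta_mx 0 i) F u.
Proof.
move=> oU Uu CF; rewrite deriveEjacobian ?rowE//.
exact: Ck1_differentiable CF.
Qed.

End Composition.

(** * Index contractions in the evolution of |A|^2 *)

Section Contractions.
Context {R : realFieldType} {n : nat}.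
Implicit Types (i j k l m p : 'I_n).

Definition sum3 (f : 'I_n -> 'I_n -> 'I_n -> R) := \sum_i \sum_j \sum_k f i j k.

Lemma eq_sum3 f g : (forall i j k, f i j k = g i j k) -> sum3 f = sum3 g.
Proof. by move=> fg; do 3!apply: eq_bigr => ? _. Qed.

Lemma sum3D f g : sum3 (fun i j k => f i j k + g i j k) = sum3 f + sum3 g.
Proof.
rewrite /sum3 -big_split; apply: eq_bigr => i _; rewrite -big_split.
by apply: eq_bigr => j _; rewrite -big_split.
Qed.

Lemma sum3Z c f : sum3 (fun i j k => c * f i j k) = c * sum3 f.
Proof. by rewrite /sum3; do 3!(rewrite mulr_sumr; apply: eq_bigr => ? _). Qed.

Lemma sum3N f : sum3 (fun i j k => - f i j k) = - sum3 f.
Proof. by rewrite -mulN1r -sum3Z; apply: eq_sum3 => i j k; rewrite mulN1r. Qed.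

Lemma sum3_swap12 f : sum3 f = sum3 (fun i j k => f j i k).
Proof. exact: exchange_big. Qed.

Lemma sum3_swap23 f : sum3 f = sum3 (fun i j k => f i k j).
Proof. by apply: eq_bigr => i _; exact: exchange_big. Qed.

Lemma sum_delta (f : 'I_n -> R) k : \sum_i (i == k)%:R * f i = f k.
Proof.
rewrite (bigD1 k)//= eqxx mul1r big1 ?addr0// => i /negbTE ->.
by rewrite mul0r.
Qed.

Lemma sum_delta' (f : 'I_n -> R) k : \sum_i (k == i)%:R * f i = f k.
Proof. by rewrite -[RHS]sum_delta; apply: eq_bigr => i _; rewrite eq_sym. Qed.

(* In the application [h] is the second fundamental form in an orthonormal frame,
   [X i j k l] is <F_ijk, F_l>, [Y i j k l] is <nu_ijk, F_l> and [T i j k] is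
   <nu_ij, F_k>. The terms in [X] depend on the coordinates and cancel in
   [simons_contraction]. *)
Variables (K : R) (h : 'I_n -> 'I_n -> R) (X Y : 'I_n -> 'I_n -> 'I_n -> 'I_n -> R).
Hypothesis h_sym : forall i j, h i j = h j i.
Hypothesis X_sym12 : forall i j k l, X i j k l = X j i k l.
Hypothesis X_sym23 : forall i j k l, X i j k l = X i k j l.
Hypothesis Y_sym12 : forall i j k l, Y i j k l = Y j i k l.
Hypothesis Y_sym23 : forall i j k l, Y i j k l = Y i k j l.

Let a i j := \sum_m h i m * h j m.
Let H := \sum_i h i i.
Let f := \sum_i a i i.
Let c3 := \sum_i \sum_j h i j * a i j.
Let q4 := \sum_i \sum_j a i j * a i j.
Let d i j : R := (i == j)%:R.
Let A1 := sum3 (fun i m k => h i m * Y k i k m).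
Let A2 := \sum_p sum3 (fun i m k => h i m * h k p * X k i m p).
Let A3 := sum3 (fun i p k => a i p * X k i k p).
Let B1 := sum3 (fun i m k => h i m * Y k i m k).

Let a_sym i j : a i j = a j i.
Proof. by apply: eq_bigr => m _; rewrite mulrC. Qed.

Let c_a4 : sum3 (fun i m k => h i m * (a i k * h k m)) = q4.
Proof.
rewrite sum3_swap23; apply: eq_bigr => i _; apply: eq_bigr => k _.
by rewrite /a mulr_sumr; apply: eq_bigr => m _; ring.
Qed.

Let c_a4' : sum3 (fun i m k => h i m * (a k m * h i k)) = q4.
Proof.
rewrite -c_a4 sum3_swap12; apply: eq_sum3 => i m k.
by rewrite (h_sym m i) (h_sym m k) (a_sym k i).
Qed.

Let c_hh : \sum_i \sum_m h i m * h i m = f.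
Proof. by []. Qed.

Let c_d1 : sum3 (fun i m k => h i m * (h i k * d k m)) = f.
Proof.
rewrite -c_hh; apply: eq_bigr => i _; apply: eq_bigr => m _.
rewrite -(sum_delta (fun k => h i m * h i k)); apply: eq_bigr => k _.
by rewrite /d; ring.
Qed.

Let c_d2 : sum3 (fun i m k => h i m * (h k m * d i k)) = f.
Proof.
rewrite -c_hh; apply: eq_bigr => i _; apply: eq_bigr => m _.
rewrite -(sum_delta' (fun k => h i m * h k m)); apply: eq_bigr => k _.
by rewrite /d; ring.
Qed.

Let c_f2 : sum3 (fun i m k => h i m * (a k k * h i m)) = f * f.
Proof.
rewrite -{1}c_hh mulr_suml; apply: eq_bigr => i _; rewrite mulr_suml.
apply: eq_bigr => m _; rewrite mulr_sumr; apply: eq_bigr => k _; ring.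
Qed.

Let c_H2 : sum3 (fun i m k => h i m * (h k k * d i m)) = H * H.
Proof.
rewrite {1}/H mulr_suml; apply: eq_bigr => i _.
rewrite exchange_big mulr_sumr; apply: eq_bigr => k _.
rewrite -(sum_delta' (fun m => h i m * h k k)); apply: eq_bigr => m _.
by rewrite /d; ring.
Qed.

Let c_Hc3 : sum3 (fun i m k => h i m * (a i m * h k k)) = H * c3.
Proof.
rewrite mulrC /c3 mulr_suml; apply: eq_bigr => i _; rewrite mulr_suml.
apply: eq_bigr => m _; rewrite mulr_sumr; apply: eq_bigr => k _; ring.
Qed.

Let c_nf : sum3 (fun i m k => h i m * h i m) = n%:R * f.
Proof.
rewrite mulrC -{1}c_hh mulr_suml; apply: eq_bigr => i _; rewrite mulr_suml.
by apply: eq_bigr => m _; rewrite sumr_const card_ord mulr_natr.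
Qed.

Let c_A2 : sum3 (fun i m k => h i m * \sum_p h k p * X k i m p) = A2.
Proof.
rewrite /A2 /sum3 [RHS]exchange_big /=; apply: eq_bigr => i _.
rewrite [RHS]exchange_big; apply: eq_bigr => m _.
rewrite [RHS]exchange_big; apply: eq_bigr => k _.
by rewrite mulr_sumr; apply: eq_bigr => p _; ring.
Qed.

Let c_A3 : sum3 (fun i m k => h i m * \sum_p h m p * X k i k p) = A3.
Proof.
rewrite /A3 /sum3; apply: eq_bigr => i _.
transitivity (\sum_k \sum_m h i m * \sum_p h m p * X k i k p).
  by rewrite exchange_big.
rewrite [RHS]exchange_big; apply: eq_bigr => k _.
transitivity (\sum_m \sum_p h i m * h m p * X k i k p).
  by apply: eq_bigr => m _; rewrite mulr_sumr; apply: eq_bigr => p _; ring.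
rewrite exchange_big; apply: eq_bigr => p _; rewrite mulr_suml.
by apply: eq_bigr => m _; rewrite (h_sym m p).
Qed.

(* The symmetry of <nu_k, F_m> in k and m, differentiated twice. *)
Hypothesis codazzi2 : forall i m k,
  Y k i k m - a i k * h k m - K * (h i k * d k m) - a k k * h i m - K * (h k k * d i m)
    - \sum_p h k p * X k i m p =
  Y k i m k - a i m * h k k - K * h i m - a k m * h i k - K * (h k m * d i k)
    - \sum_p h m p * X k i k p.

(** This is [codazzi2] multiplied by [h i m] and summed. Up to sign and coordinate-dependent terms,
    [A1] pairs h with its Laplacian and [B1] pairs h with the Hessian of H, so the identity is the
    contracted Simons identity. The quartic sums [q4] and two of the terms in [K * f] occur on both
    sides and cancel. *)
Lemma contracted_codazzi :
  A1 = B1 + A2 - A3 + f * f + K * (H * H) - H * c3 - n%:R * K * f.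
Proof.
have E : sum3 (fun i m k => h i m * Y k i k m + - (h i m * (a i k * h k m))
     + - (K * (h i m * (h i k * d k m))) + - (h i m * (a k k * h i m))
     + - (K * (h i m * (h k k * d i m))) + - (h i m * \sum_p h k p * X k i m p)) =
   sum3 (fun i m k => h i m * Y k i m k + - (h i m * (a i m * h k k))
     + - (K * (h i m * h i m)) + - (h i m * (a k m * h i k))
     + - (K * (h i m * (h k m * d i k))) + - (h i m * \sum_p h m p * X k i k p)).
  apply: eq_sum3 => i m k; have := congr1 (fun x => h i m * x) (codazzi2 i m k).
  move: (\sum_p h k p * _) (\sum_p h m p * _) => s1 s2 E.
  by apply: etrans (etrans E _); ring.
move: E; rewrite !sum3D !sum3N !sum3Z c_a4 c_a4' c_d1 c_d2 c_f2 c_H2 c_Hc3 c_nf.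
by rewrite c_A2 c_A3 -/A1 -/B1 => E; lra.
Qed.

Variable H2 : 'I_n -> 'I_n -> R.
Hypothesis hessian_H : forall m i, H2 m i =
  - (\sum_k \sum_l h k l * (X m i k l + X m i l k + (h i k * h m l + K * (d i k *
    d m l))
        + (h m k * h i l + K * (d m k * d i l))))
  - (\sum_k (Y m i k k + (- a i k * h m k - K * (h i k * d m k))
        + (- a m k * h i k - K * (h m k * d i k)) - \sum_p h k p * X m i k p)).

(** The second derivatives of the inverse metric contribute [-2 A2], those of [<nu_k, F_k>]
    contribute [A2 - B1]. The terms linear in K cancel already for fixed m and i; those cubic in h
    cancel only after pairing with the symmetric h, where each gives [q4]. *)
Lemma contracted_hessian : \sum_i \sum_m h i m * H2 i m = - A2 - B1.
Proof.
have XA : \sum_i \sum_m h i m * (\sum_k \sum_l h k l * X i m k l) = A2.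
  rewrite -c_A2; apply: eq_bigr => i _; apply: eq_bigr => m _.
  rewrite mulr_sumr; apply: eq_bigr => k _; congr (_ * _); apply: eq_bigr => l _.
  by congr (_ * _); rewrite X_sym23 X_sym12.
have S1 m i : \sum_k \sum_l h k l * (X m i k l + X m i l k + (h i k * h m l + K *
  (d i k * d m l))
        + (h m k * h i l + K * (d m k * d i l))) =
   2 * (\sum_k \sum_l h k l * X m i k l) + 2 * (\sum_k a m k * h i k) + 2 * K * h m i.
  transitivity (\sum_k \sum_l h k l * X m i k l + \sum_k \sum_l h k l * X m i l k
     + \sum_k \sum_l h k l * (h i k * h m l) + K * (\sum_k \sum_l h k l * (d i k *
       d m l))
     + \sum_k \sum_l h k l * (h m k * h i l) + K * (\sum_k \sum_l h k l * (d m k *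
       d i l))).
    rewrite !mulr_sumr -!big_split; apply: eq_bigr => k _ /=.
    rewrite !mulr_sumr -!big_split; apply: eq_bigr => l _ /=; ring.
  have -> : \sum_k \sum_l h k l * X m i l k = \sum_k \sum_l h k l * X m i k l.
    rewrite exchange_big; apply: eq_bigr => k _; apply: eq_bigr => l _.
    by rewrite h_sym.
  have D x y : \sum_k \sum_l h k l * (d x k * d y l) = h x y.
    rewrite -(sum_delta' (fun k => h k y) x); apply: eq_bigr => k _.
    rewrite -(sum_delta' (fun l => h k l) y) mulr_sumr; apply: eq_bigr => l _.
    by rewrite /d; ring.
  have E x y : \sum_k \sum_l h k l * (h x k * h y l) = \sum_k a y k * h x k.
    apply: eq_bigr => k _; rewrite mulr_suml; apply: eq_bigr => l _; ring.
  rewrite !D (h_sym i m) E.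
  have -> : \sum_k \sum_l h k l * (h m k * h i l) = \sum_k \sum_l h k l * (h i k *
    h m l).
    rewrite exchange_big; apply: eq_bigr => k _; apply: eq_bigr => l _.
    by rewrite h_sym; ring.
  by rewrite E; ring.
have S2 m i : \sum_k (Y m i k k + (- a i k * h m k - K * (h i k * d m k))
        + (- a m k * h i k - K * (h m k * d i k)) - \sum_p h k p * X m i k p) =
   \sum_k Y m i k k - (\sum_k a i k * h m k) - (\sum_k a m k * h i k) - 2 * K * h m i
   - \sum_k \sum_l h k l * X m i k l.
  transitivity (\sum_k Y m i k k - (\sum_k a i k * h m k) - K * (\sum_k d m k * h i k)
    - (\sum_k a m k * h i k) - K * (\sum_k d i k * h m k)
   - \sum_k \sum_l h k l * X m i k l).
    by rewrite !mulr_sumr -!sumrB; apply: eq_bigr => k _; ring.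
  by rewrite !sum_delta' (h_sym i m); ring.
transitivity (\sum_i \sum_m (- (h i m * (\sum_k \sum_l h k l * X i m k l))
   + - (h i m * \sum_k Y i m k k) + (h i m * (\sum_k a m k * h i k)) - h i m *
     (\sum_k a i k * h m k))).
  apply: eq_bigr => i _; apply: eq_bigr => m _; rewrite hessian_H S1 S2; ring.
under eq_bigr do rewrite !big_split !sumrN /=.
rewrite !big_split !sumrN /= XA.
have -> : \sum_i \sum_m h i m * \sum_k Y i m k k = B1.
  apply: eq_bigr => i _; apply: eq_bigr => m _; rewrite mulr_sumr.
  by apply: eq_bigr => k _; rewrite Y_sym23 Y_sym12.
have -> : \sum_i \sum_m h i m * (\sum_k a m k * h i k) = q4.
  rewrite -c_a4'; apply: eq_bigr => i _; apply: eq_bigr => m _; rewrite mulr_sumr.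
  by apply: eq_bigr => k _; rewrite (a_sym m k).
have -> : \sum_i \sum_m h i m * (\sum_k a i k * h m k) = q4.
  rewrite -c_a4; apply: eq_bigr => i _; apply: eq_bigr => m _; rewrite mulr_sumr.
  by apply: eq_bigr => k _; rewrite (h_sym m k).
ring.
Qed.

Variable T : 'I_n -> 'I_n -> 'I_n -> R.

(** The left side is the trace of the second derivatives of [G^ij <nu_i, nu_j>] at the centre of
    normal coordinates, that is, the Laplacian of |A|^2. In it [A1] and [A3] occur as
    [-2 A1 - 2 A3]; replacing [A1] by [contracted_codazzi] leaves [-2 (A2 + B1)], which by
    [contracted_hessian] is the pairing of h with the Hessian of H. *)
Lemma simons_contraction :
  \sum_k (- (\sum_i \sum_j a i j * (X k k i j + X k k j i
       + 2 * (h k i * h k j + K * (d k i * d k j))))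
     + \sum_i (2 * (- \sum_m h i m * Y k k i m)
        + 2 * (\sum_m T k i m ^+ 2 + a k i ^+ 2 + K * h k i ^+ 2))) =
  2 * sum3 (fun k i m => T k i m ^+ 2) + 2 * (\sum_i \sum_m h i m * H2 i m)
  - 2 * f ^+ 2 - 2 * K * H ^+ 2 + 2 * H * c3 + 2 * n%:R * K * f.
Proof.
transitivity (- 2 * A3 - 2 * q4 - 2 * K * f - 2 * A1 + 2 * sum3 (fun k i m =>
  T k i m ^+ 2)
   + 2 * q4 + 2 * K * f); last first.
  by rewrite contracted_hessian contracted_codazzi; ring.
rewrite big_split sumrN /=.
have -> : \sum_k \sum_i \sum_j a i j * (X k k i j + X k k j i
       + 2 * (h k i * h k j + K * (d k i * d k j))) = 2 * A3 + 2 * q4 + 2 * K * f.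
  transitivity (sum3 (fun k i j => a i j * X k k i j + a i j * X k k j i +
      2 * (a i j * (h k i * h k j)) + 2 * K * (a i j * (d k i * d k j)))).
    by apply: eq_sum3 => k i j; ring.
  rewrite !sum3D !sum3Z.
  have E1 : sum3 (fun k i j => a i j * X k k i j) = A3.
    rewrite /A3 sum3_swap12 sum3_swap23; apply: eq_sum3 => i j k.
    by rewrite X_sym23.
  have -> : sum3 (fun k i j => a i j * X k k j i) = A3.
    by rewrite -E1 sum3_swap23; apply: eq_sum3 => k i j; rewrite a_sym.
  have -> : sum3 (fun k i j => a i j * (h k i * h k j)) = q4.
    rewrite sum3_swap12 sum3_swap23; apply: eq_bigr => i _; apply: eq_bigr => j _.
    rewrite -mulr_sumr; congr (_ * _); apply: eq_bigr => k _.
    by rewrite (h_sym k i) (h_sym k j).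
  have -> : sum3 (fun k i j => a i j * (d k i * d k j)) = f.
    rewrite /f; apply: eq_bigr => k _.
    rewrite -(sum_delta' (fun i => a i k)); apply: eq_bigr => i _.
    rewrite -(sum_delta' (fun j => a i j)) mulr_sumr; apply: eq_bigr => j _.
    by rewrite /d; ring.
  by rewrite E1; ring.
have -> : \sum_k \sum_i (2 * (- \sum_m h i m * Y k k i m)
        + 2 * (\sum_m T k i m ^+ 2 + a k i ^+ 2 + K * h k i ^+ 2)) =
   - 2 * A1 + 2 * sum3 (fun k i m => T k i m ^+ 2) + 2 * q4 + 2 * K * f.
  have -> : A1 = \sum_k \sum_i \sum_m h i m * Y k k i m.
    rewrite /A1 sum3_swap23 sum3_swap12; apply: eq_sum3 => k i m.
    by rewrite Y_sym23.
  rewrite /sum3 /q4 -c_hh !mulr_sumr -!big_split; apply: eq_bigr => k _ /=.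
  rewrite !mulr_sumr -!big_split; apply: eq_bigr => i _ /=.
  ring.
ring.
Qed.

End Contractions.

(* [n.+2 * T] minus the symmetrization of [trace (x) id] has nonnegative norm. *)
Lemma symmetric_trace_le (R : realFieldType) (n : nat) (T : 'I_n -> 'I_n -> 'I_n -> R) :
  (forall i j k, T i j k = T j i k) -> (forall i j k, T i j k = T i k j) ->
  3 * \sum_j (\sum_k T k k j) ^+ 2 <= n.+2%:R * sum3 (fun i j k => T i j k ^+ 2).
Proof.
move=> T12 T23; pose t j := \sum_k T k k j; pose d (i j : 'I_n) : R := (i == j)%:R.
pose N : R := n.+2%:R; pose t2 := \sum_j t j ^+ 2.
have NE : N = n%:R + 2 by rewrite /N -addn2 natrD.
have N0 : 0 < N by rewrite ltr0n.
have dT (x : 'I_n -> 'I_n -> 'I_n -> R) : sum3 (fun i j k => d i j * x i j k) =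
  \sum_i \sum_k x i i k.
  apply: eq_bigr => i _; rewrite exchange_big; apply: eq_bigr => k _.
  by rewrite -(sum_delta' (fun j => x i j k)).
have dd i : d i i = 1 by rewrite /d eqxx.
have dsym i j : d i j = d j i by rewrite /d eq_sym.
have T1 : sum3 (fun i j k => d i j * (T i j k * t k)) = t2.
  rewrite dT exchange_big; apply: eq_bigr => k _.
  by rewrite -mulr_suml expr2.
have T2 : sum3 (fun i j k => d i k * (T i j k * t j)) = t2.
  by rewrite -T1 sum3_swap23; apply: eq_sum3 => i j k; rewrite T23.
have T3 : sum3 (fun i j k => d j k * (T i j k * t i)) = t2.
  rewrite -T2 sum3_swap12; apply: eq_sum3 => i j k; by rewrite T12.
have nt : \sum_(i < n) t2 = n%:R * t2 by rewrite sumr_const card_ord mulr_natl.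
have Q1 : sum3 (fun i j k => d i j * (d i j * (t k * t k))) = n%:R * t2.
  rewrite dT -nt; apply: eq_bigr => i _; apply: eq_bigr => k _.
  by rewrite dd mul1r expr2.
have Q2 : sum3 (fun i j k => d i k * (d i k * (t j * t j))) = n%:R * t2.
  by rewrite -Q1 sum3_swap23.
have Q3 : sum3 (fun i j k => d j k * (d j k * (t i * t i))) = n%:R * t2.
  by rewrite -Q2 sum3_swap12.
have P1 : sum3 (fun i j k => d i j * (d i k * (t k * t j))) = t2.
  rewrite dT; apply: eq_bigr => i _; rewrite expr2.
  by rewrite -(sum_delta' (fun k => t i * t k)); apply: eq_bigr => k _;
    rewrite [t k * _]mulrC.
have P2 : sum3 (fun i j k => d i j * (d j k * (t k * t i))) = t2.
  rewrite -P1 sum3_swap12; apply: eq_sum3 => i j k; by rewrite dsym.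
have P3 : sum3 (fun i j k => d i k * (d j k * (t j * t i))) = t2.
  rewrite -P2 sum3_swap23; apply: eq_sum3 => i j k; by rewrite (dsym k j).
have : 0 <= sum3 (fun i j k => (N * T i j k - (d i j * t k + d i k * t j + d j k *
  t i)) ^+ 2).
  by do 3!(apply: sumr_ge0 => ? _); exact: sqr_ge0.
have -> : sum3 (fun i j k => (N * T i j k - (d i j * t k + d i k * t j + d j k *
  t i)) ^+ 2) =
  sum3 (fun i j k => N ^+ 2 * T i j k ^+ 2 + - (2 * N) * (d i j * (T i j k * t k))
   + - (2 * N) * (d i k * (T i j k * t j)) + - (2 * N) * (d j k * (T i j k * t i))
   + d i j * (d i j * (t k * t k)) + d i k * (d i k * (t j * t j)) + d j k * (d j k *
     (t i * t i))
   + 2 * (d i j * (d i k * (t k * t j))) + 2 * (d i j * (d j k * (t k * t i)))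
   + 2 * (d i k * (d j k * (t j * t i)))).
  by apply: eq_sum3 => i j k; ring.
rewrite !sum3D !sum3Z T1 T2 T3 Q1 Q2 Q3 P1 P2 P3.
(* The expanded square is [N^2 |T|^2 - 6 N t2 + 3 n t2 + 6 t2]; with n = N - 2 this is N times the
   difference of the two sides. *)
have -> : n%:R = N - 2 by rewrite NE; ring.
move: (sum3 _) => s E; rewrite -(ler_pM2l N0) -/t2 -/N.
by move: E; rewrite -subr_ge0 => E; rewrite -subr_ge0; apply: le_trans E _;
  rewrite subr0 le_eqVlt; apply/orP; left; apply/eqP; ring.
Qed.

(** * Calculus rules for iterated derivatives *)

Definition smooth (R : realType) (V W : normedModType R) (U : set V) (f : V ->
  W) : Prop :=
  forall k, Ck k U f.

Section Dot.
Context {R : realType} {d : nat}.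
Implicit Types x y : 'rV[R]_d.

Lemma dotE x y : dot x y = \sum_i x 0 i * y 0 i.
Proof. by rewrite /dot mxE; apply: eq_bigr => i _; rewrite mxE. Qed.

Lemma dotC x y : dot x y = dot y x.
Proof. by rewrite !dotE; apply: eq_bigr => i _; rewrite mulrC. Qed.

Lemma dotDl x y z : dot (x + y) z = dot x z + dot y z.
Proof. by rewrite /dot mulmxDl mxE. Qed.

Lemma dotZl a x y : dot (a *: x) y = a * dot x y.
Proof. by rewrite /dot -scalemxAl mxE. Qed.

Lemma dotDr x y z : dot x (y + z) = dot x y + dot x z.
Proof. by rewrite dotC dotDl !(dotC x). Qed.

Lemma dotZr a x y : dot x (a *: y) = a * dot x y.
Proof. by rewrite dotC dotZl dotC. Qed.

Lemma dotNl x y : dot (- x) y = - dot x y.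
Proof. by rewrite -scaleN1r dotZl mulN1r. Qed.

Lemma dotBl x y z : dot (x - y) z = dot x z - dot y z.
Proof. by rewrite dotDl dotNl. Qed.

Lemma dot0l x : dot 0 x = 0.
Proof. by rewrite -(scale0r 0) dotZl mul0r. Qed.

Lemma dot_suml I (s : seq I) (P : pred I) (f : I -> 'rV[R]_d) y :
  dot (\sum_(i <- s | P i) f i) y = \sum_(i <- s | P i) dot (f i) y.
Proof. by apply: (big_morph (fun x => dot x y)) => [u v|]; rewrite ?dotDl ?dot0l. Qed.

Lemma dot_ge0 x : 0 <= dot x x.
Proof. by rewrite dotE sumr_ge0// => i _; rewrite -expr2 sqr_ge0. Qed.

Lemma dot_eq0 x : dot x x = 0 -> x = 0.
Proof.
rewrite dotE => /eqP; rewrite psumr_eq0; last by move=> i _; rewrite -expr2 sqr_ge0.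
move=> /allP x0; apply/rowP => i; rewrite mxE.
by have := x0 i (mem_index_enum _); rewrite /= mulf_eq0 orbb => /eqP.
Qed.

End Dot.

(* Sealed, so that unification never unfolds iterated derivatives. *)
HB.lock Definition pd (R : realType) (V W : normedModType R) (v : V) (f : V ->
  W) (x : V) : W :=
  'D_v f x.

Section SmoothRules.
Context {R : realType} {V : normedModType R} {U : set V} (oU : open U).
Implicit Types (a b : V -> R) (u v w : V).

Lemma pdE (W : normedModType R) (f : V -> W) v x : pd v f x = 'D_v f x.
Proof. by rewrite unlock. Qed.

Lemma pd_fE (W : normedModType R) (f : V -> W) v : pd v f = 'D_v f.
Proof. by apply/funext => x; rewrite pdE. Qed.

Lemma smooth_D (W : normedModType R) (f : V -> W) v : smooth U f -> smooth U (pd v f).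
Proof. by move=> sf k; rewrite pd_fE; have [_ /(_ v)[]] := sf k.+1. Qed.

Lemma smooth_derivable (W : normedModType R) (f : V -> W) v x :
  smooth U f -> U x -> derivable f x v.
Proof. by move=> sf Ux; exact: (Ck_derivable v (sf 1%N) Ux). Qed.

Lemma smooth_eq (W : normedModType R) (f g : V -> W) :
  (forall x, U x -> f x = g x) -> smooth U f -> smooth U g.
Proof. by move=> fg sf k; apply: eq_Ck (sf k). Qed.

Lemma smooth_cst (W : normedModType R) (c : W) : smooth U (fun _ => c).
Proof. by move=> k; exact: Ck_cst. Qed.

Lemma smoothD (W : normedModType R) (f g : V -> W) :
  smooth U f -> smooth U g -> smooth U (fun x => f x + g x).
Proof. by move=> sf sg k; exact: CkD. Qed.

Lemma smoothM a b : smooth U a -> smooth U b -> smooth U (fun x => a x * b x).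
Proof. by move=> sa sb k; exact: CkM. Qed.

Lemma smoothN a : smooth U a -> smooth U (fun x => - a x).
Proof.
move=> sa; apply: smooth_eq (smoothM (smooth_cst (-1 : R)) sa) => x _.
by rewrite mulN1r.
Qed.

Lemma smooth_sum (I : Type) (s : seq I) (a : I -> V -> R) :
  (forall i, smooth U (a i)) -> smooth U (fun x => \sum_(i <- s) a i x).
Proof. by move=> sa k; apply: Ck_sum => // i _; exact: sa. Qed.

Lemma smooth_mxP m n (M : V -> 'M[R]_(m, n)) :
  smooth U M <-> forall i j, smooth U (fun y => M y i j).
Proof.
by split=> [sM i j k|sM k]; [have /Ck_mxP := sM k; apply | apply/Ck_mxP => // i j;
  exact: sM].
Qed.

Lemma smooth_dot d (a b : V -> 'rV[R]_d) :
  smooth U a -> smooth U b -> smooth U (fun x => dot (a x) (b x)).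
Proof.
move=> /smooth_mxP sa /smooth_mxP sb.
apply: smooth_eq (smooth_sum (index_enum 'I_d) (fun i =>
  smoothM (sa 0 i) (sb 0 i))) => x _.
by rewrite dotE.
Qed.

Lemma smooth_scale m n a (M : V -> 'M[R]_(m, n)) :
  smooth U a -> smooth U M -> smooth U (fun x => a x *: M x).
Proof.
move=> sa /smooth_mxP sM; apply/smooth_mxP => i j.
by apply: smooth_eq (smoothM sa (sM i j)) => x _; rewrite mxE.
Qed.

Lemma smooth_vsum m n (I : Type) (s : seq I) (a : I -> V -> 'M[R]_(m, n)) :
  (forall i, smooth U (a i)) -> smooth U (fun x => \sum_(i <- s) a i x).
Proof.
move=> sa; apply/smooth_mxP => i j.
apply: smooth_eq (smooth_sum s (fun l => (iffLR (smooth_mxP (a l)) (sa l)) i j)) => x _.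
by rewrite summxE.
Qed.

Variable (x : V).
Hypothesis Ux : U x.

Lemma pdM v a b : smooth U a -> smooth U b ->
  pd v (fun x => a x * b x) x = pd v a x * b x + a x * pd v b x.
Proof.
move=> sa sb.
rewrite !pdE; have E : 'D_v (fun x => a x * b x) x = _ :=
  deriveM (smooth_derivable sa Ux) (smooth_derivable sb Ux).
by rewrite E addrC; congr (_ + _); exact: mulrC.
Qed.

Lemma pdD v a b : smooth U a -> smooth U b ->
  pd v (fun x => a x + b x) x = pd v a x + pd v b x.
Proof.
by move=> sa sb; rewrite !pdE; exact: deriveD (smooth_derivable sa Ux)
  (smooth_derivable sb Ux).
Qed.

Lemma pdN v a : smooth U a -> pd v (fun x => - a x) x = - pd v a x.
Proof. by move=> sa; rewrite !pdE; exact: deriveN (smooth_derivable sa Ux). Qed.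

Lemma pd_sum v (I : Type) (s : seq I) (a : I -> V -> R) : (forall i, smooth U (a i)) ->
  pd v (fun x => \sum_(i <- s) a i x) x = \sum_(i <- s) pd v (a i) x.
Proof.
move=> sa; elim: s => [|i s IH].
  rewrite big_nil (_ : (fun x => _) = cst 0); first by rewrite pdE derive_cst.
  by apply/funext => y; rewrite big_nil.
rewrite big_cons -IH -pdD//; last exact: smooth_sum.
by congr (pd v _ x); apply/funext => y; rewrite big_cons.
Qed.

Lemma pd_dot d v (a b : V -> 'rV[R]_d) : smooth U a -> smooth U b ->
  pd v (fun x => dot (a x) (b x)) x = dot (pd v a x) (b x) + dot (a x) (pd v b x).
Proof.
move=> sa sb.
have -> : (fun x => dot (a x) (b x)) = (fun x => \sum_i a x 0 i * b x 0 i).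
  by apply/funext => y; rewrite dotE.
have sa' i : smooth U (fun x => a x 0 i) := (iffLR (smooth_mxP a) sa) 0 i.
have sb' i : smooth U (fun x => b x 0 i) := (iffLR (smooth_mxP b) sb) 0 i.
rewrite (@pd_sum v _ _ (fun i x => a x 0 i * b x 0 i)); last by move=> i;
  exact: smoothM.
rewrite !dotE -big_split; apply: eq_bigr => i _ /=.
rewrite (pdM v (sa' i) (sb' i)).
by rewrite !pdE (derive_mxE 0 i (smooth_derivable sa Ux)) (derive_mxE 0 i
  (smooth_derivable sb Ux)).
Qed.

Lemma pd_scale d v a (b : V -> 'rV[R]_d) : smooth U a -> smooth U b ->
  pd v (fun x => a x *: b x) x = pd v a x *: b x + a x *: pd v b x.
Proof.
move=> sa sb; apply/rowP => j.
have sb' : smooth U (fun x => b x 0 j) := (iffLR (smooth_mxP b) sb) 0 j.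
rewrite !mxE !pdE (derive_mxE 0 j (smooth_derivable (smooth_scale sa sb) Ux)).
rewrite (derive_mxE 0 j (smooth_derivable sb Ux)) -!pdE -(pdM v sa sb').
by congr (pd v _ x); apply/funext => y; rewrite mxE.
Qed.

Lemma pd_cst (W : normedModType R) (c : W) v y : pd v (fun _ : V => c) y = 0.
Proof. by rewrite pdE; exact: derive_cst. Qed.

Lemma smooth_schwarz m n (M : V -> 'M[R]_(m, n)) v w : smooth U M ->
  pd v (pd w M) x = pd w (pd v M) x.
Proof. by move=> sM; rewrite !pd_fE; exact: schwarz (sM 2%N). Qed.

Lemma eq_pd (W : normedModType R) (f g : V -> W) v : (forall y, U y -> f y = g y) ->
  pd v f x = pd v g x.
Proof. by move=> fg; rewrite !pdE; exact: eq_derive_on Ux. Qed.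

End SmoothRules.

Section SecondOrder.
Context {R : realType} {V : normedModType R} {U : set V} (oU : open U).
Context (x : V) (Ux : U x).
Implicit Types (a b : V -> R) (u v w : V).

Lemma pd2M v w a b : smooth U a -> smooth U b ->
  pd v (pd w (fun x => a x * b x)) x =
  pd v (pd w a) x * b x + pd w a x * pd v b x + (pd v a x * pd w b x + a x *
    pd v (pd w b) x).
Proof.
move=> sa sb.
rewrite (eq_pd oU Ux v (fun y Uy => pdM Uy w sa sb)).
have swa := smooth_D w sa; have swb := smooth_D w sb.
rewrite (pdD Ux v (smoothM oU swa sb) (smoothM oU sa swb)).
by rewrite (pdM Ux v swa sb) (pdM Ux v sa swb).
Qed.

Lemma pd2_sum v w (I : Type) (s : seq I) (a : I -> V -> R) : (forall i,
  smooth U (a i)) ->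
  pd v (pd w (fun x => \sum_(i <- s) a i x)) x = \sum_(i <- s) pd v (pd w (a i)) x.
Proof.
move=> sa; rewrite (eq_pd oU Ux v (fun y Uy => pd_sum oU Uy w s sa)).
by rewrite (pd_sum oU Ux v s (fun i => smooth_D w (sa i))).
Qed.

Lemma pd2_dot d v w (a b : V -> 'rV[R]_d) : smooth U a -> smooth U b ->
  pd v (pd w (fun x => dot (a x) (b x))) x =
  dot (pd v (pd w a) x) (b x) + dot (pd w a x) (pd v b x)
   + (dot (pd v a x) (pd w b x) + dot (a x) (pd v (pd w b) x)).
Proof.
move=> sa sb.
rewrite (eq_pd oU Ux v (fun y Uy => pd_dot oU Uy w sa sb)).
have swa := smooth_D w sa; have swb := smooth_D w sb.
rewrite (pdD Ux v (smooth_dot oU swa sb) (smooth_dot oU sa swb)).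
by rewrite (pd_dot oU Ux v swa sb) (pd_dot oU Ux v sa swb).
Qed.

End SecondOrder.

(** * Evolution equations at a point with orthonormal coordinate frame *)

Section Evolution.
Context {R : realType} {V : normedModType R} {n d : nat} {U : set V} (oU : open U).
Context (K : R) (e : 'I_n -> V) (tau : V).
Context (F nu : V -> 'rV[R]_d) (G : V -> 'M[R]_n).
Hypothesis sF : smooth U F.
Hypothesis snu : smooth U nu.
Hypothesis sG : smooth U G.

Definition flow_H (x : V) : R := - \sum_k \sum_l G x k l *
  dot (pd (e k) nu x) (pd (e l) F x).
(* [flow_A2] is |d nu|^2, which equals |A|^2 because the differential of the
   Gauss map [nu] is minus the Weingarten map. *)
Definition flow_A2 (x : V) : R := \sum_i \sum_j G x i j *
  dot (pd (e i) nu x) (pd (e j) nu x).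

Definition flow_defect (c : R) (x : V) : R :=
  flow_A2 x + - c * (flow_H x * flow_H x).

(** The orthogonality relations are assumed on all of [U], since they get differentiated up to
    twice. *)
Hypothesis FF : forall x, U x -> dot (F x) (F x) = K^-1.
Hypothesis nunu : forall x, U x -> dot (nu x) (nu x) = 1.
Hypothesis nuF : forall x, U x -> dot (nu x) (F x) = 0.
Hypothesis nuF1 : forall x i, U x -> dot (nu x) (pd (e i) F x) = 0.
Hypothesis Gg : forall x i l, U x ->
  \sum_j G x i j * dot (pd (e j) F x) (pd (e l) F x) = (i == l)%:R.
Hypothesis Ft : forall x, U x -> pd tau F x = flow_H x *: nu x.
(** The remaining hypotheses concern the single point [z], the centre of normal coordinates. There
    [F_k], [nu] and [F] form an orthogonal frame, and [parseval] turns products of derivatives into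
    sums over it. *)
Context (z : V) (Uz : U z).
Hypothesis g_id : forall i j, dot (pd (e i) F z) (pd (e j) F z) = (i == j)%:R.
Hypothesis Gamma0 : forall i j k, dot (pd (e i) (pd (e j) F) z) (pd (e k) F z) = 0.
Hypothesis parseval : forall x y : 'rV[R]_d, dot x y =
  \sum_k dot x (pd (e k) F z) * dot y (pd (e k) F z) + dot x (nu z) * dot y (nu z)
  + K * (dot x (F z) * dot y (F z)).

Let F1 i := pd (e i) F z.
Let F2 i j := pd (e i) (pd (e j) F) z.
Let F3 i j k := pd (e i) (pd (e j) (pd (e k) F)) z.
Let N1 i := pd (e i) nu z.
Let N2 i j := pd (e i) (pd (e j) nu) z.
Let N3 i j k := pd (e i) (pd (e j) (pd (e k) nu)) z.
Let Nt := pd tau nu z.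
Let Nti i := pd (e i) (pd tau nu) z.

Let sDF i : smooth U (pd (e i) F). Proof. exact: smooth_D. Qed.
Let sDnu i : smooth U (pd (e i) nu). Proof. exact: smooth_D. Qed.
Let sGij i j : smooth U (fun x => G x i j). Proof. by move/smooth_mxP : sG; apply. Qed.
Let sP k l : smooth U (fun x => dot (pd (e k) nu x) (pd (e l) F x)). Proof.
  exact: smooth_dot. Qed.
Let sg k l : smooth U (fun x => dot (pd (e k) F x) (pd (e l) F x)). Proof.
  exact: smooth_dot. Qed.
Let sa k l : smooth U (fun x => dot (pd (e k) nu x) (pd (e l) nu x)). Proof.
  exact: smooth_dot. Qed.

Lemma flow_H_smooth : smooth U flow_H.
Proof.
apply: smoothN => //; apply: smooth_sum => // k; apply: smooth_sum => // l.
by apply: smoothM.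
Qed.

Lemma flow_A2_smooth : smooth U flow_A2.
Proof.
apply: smooth_sum => // k; apply: smooth_sum => // l; exact: smoothM.
Qed.

Let F2_sym i j : F2 i j = F2 j i. Proof. exact: (smooth_schwarz oU Uz). Qed.
Let N2_sym i j : N2 i j = N2 j i. Proof. exact: (smooth_schwarz oU Uz). Qed.
Let F3_sym12 i j k : F3 i j k = F3 j i k.
Proof. exact: (smooth_schwarz oU Uz (e i) (e j) (sDF k)). Qed.
Let F3_sym23 i j k : F3 i j k = F3 i k j.
Proof. exact: (eq_pd oU Uz (e i) (fun y Uy => smooth_schwarz oU Uy (e j) (e k) sF)).
  Qed.
Let N3_sym12 i j k : N3 i j k = N3 j i k.
Proof. exact: (smooth_schwarz oU Uz (e i) (e j) (sDnu k)). Qed.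
Let N3_sym23 i j k : N3 i j k = N3 i k j.
Proof. exact: (eq_pd oU Uz (e i) (fun y Uy => smooth_schwarz oU Uy (e j) (e k) snu)).
  Qed.

Let d_zero (a : V -> R) v c : (forall y, U y -> a y = c) -> pd v a z = 0.
Proof. by move=> ac; rewrite (eq_pd oU Uz v ac) pd_cst. Qed.

Let d2_zero (a : V -> R) v w c : (forall y, U y -> a y = c) -> pd v (pd w a) z = 0.
Proof.
move=> ac; apply: d_zero (0 : R) _ => y Uy.
by rewrite (eq_pd oU Uy w ac) pd_cst.
Qed.

Let F2F i j : dot (F2 i j) (F z) = - (i == j)%:R.
Proof.
have := d2_zero (e i) (e j) FF; rewrite (pd2_dot oU Uz (e i) (e j) sF sF) !(dotC (F z)).
rewrite -/(F2 i j) !g_id (eq_sym j i); move: (dot _ _) => u E; lra.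
Qed.

Let N1nu i : dot (N1 i) (nu z) = 0.
Proof.
have := d_zero (e i) nunu; rewrite (pd_dot oU Uz (e i) snu snu) (dotC (nu z)) -/(N1 i).
by move: (dot _ _) => u E; lra.
Qed.

Let N2nu i j : dot (N2 i j) (nu z) = - dot (N1 i) (N1 j).
Proof.
have := d2_zero (e i) (e j) nunu; rewrite (pd2_dot oU Uz (e i) (e j) snu snu) !(dotC
  (nu z)).
rewrite -/(N2 i j) -/(N1 i) -/(N1 j) (dotC (N1 j)); move: (dot _ _) (dot _ _) =>
  u w E; lra.
Qed.

Let N1F_on i y : U y -> dot (pd (e i) nu y) (F y) = 0.
Proof.
move=> Uy; have E : pd (e i) (fun y => dot (nu y) (F y)) y = 0.
  by rewrite (eq_pd oU Uy (e i) nuF) pd_cst.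
by move: E; rewrite (pd_dot oU Uy (e i) snu sF) nuF1// addr0.
Qed.

Let N1F i : dot (N1 i) (F z) = 0. Proof. exact: N1F_on. Qed.

Let N2F i j : dot (N2 i j) (F z) = - dot (N1 j) (F1 i).
Proof.
have := d_zero (e i) (@N1F_on j); rewrite (pd_dot oU Uz (e i) (sDnu j) sF) -/(N2 i j)
  -/(N1 j) -/(F1 i).
by move: (dot _ _) (dot _ _) => u w E; lra.
Qed.

Let h i j : R := dot (F2 i j) (nu z).

Let N1F1_on i j y : U y -> dot (pd (e i) nu y) (pd (e j) F y) =
  - dot (nu y) (pd (e i) (pd (e j) F) y).
Proof.
move=> Uy; have E : pd (e i) (fun y => dot (nu y) (pd (e j) F y)) y = 0.
  by rewrite (eq_pd oU Uy (e i) (fun y Uy => nuF1 j Uy)) pd_cst.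
by move: E; rewrite (pd_dot oU Uy (e i) snu (sDF j)) => /eqP; rewrite addr_eq0 => /eqP.
Qed.

Let N1F1 i j : dot (N1 i) (F1 j) = - h i j.
Proof. by rewrite /N1 /F1 (N1F1_on i j Uz) dotC. Qed.

Let h_sym i j : h i j = h j i. Proof. by rewrite /h F2_sym. Qed.

Let weingarten_sym i j y : U y ->
  dot (pd (e i) nu y) (pd (e j) F y) = dot (pd (e j) nu y) (pd (e i) F y).
Proof. by move=> Uy; rewrite !N1F1_on// (smooth_schwarz oU Uy (e i) (e j) sF). Qed.

Let a i j := \sum_m h i m * h j m.
Let X i j k l := dot (F3 i j k) (F1 l).
Let Y i j k l := dot (N3 i j k) (F1 l).
Let T i j k := dot (N2 i j) (F1 k).
Let dl (i j : 'I_n) : R := (i == j)%:R.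

Let N1N1 i j : dot (N1 i) (N1 j) = a i j.
Proof.
rewrite parseval !N1nu !N1F !mul0r mulr0 !addr0; apply: eq_bigr => m _.
by rewrite !N1F1 mulrNN.
Qed.

Let F2F2 i j k l : dot (F2 i j) (F2 k l) = h i j * h k l + K * (dl i j * dl k l).
Proof.
rewrite parseval big1 ?add0r; last by move=> m _; rewrite !Gamma0 mul0r.
by rewrite !F2F mulrNN.
Qed.

Let N2F2 i j k l : dot (N2 i j) (F2 k l) = - a i j * h k l - K * (h i j * dl k l).
Proof.
rewrite parseval big1 ?add0r; last by move=> m _; rewrite Gamma0 mulr0.
rewrite N2nu N1N1 N2F F2F N1F1 opprK -/(h k l) (h_sym j i) /dl; ring.
Qed.

Let N2N2 i j : dot (N2 i j) (N2 i j) = \sum_m T i j m ^+ 2 + a i j ^+ 2 + K *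
  h i j ^+ 2.
Proof.
by rewrite parseval !N2nu N1N1 !N2F N1F1 opprK (h_sym j i) mulrNN -!expr2.
Qed.

Let N1_dot i (v : 'rV[R]_d) : dot (N1 i) v = - \sum_m h i m * dot v (F1 m).
Proof.
rewrite parseval N1nu N1F !mul0r mulr0 !addr0 -sumrN; apply: eq_bigr => m _.
by rewrite N1F1 mulNr.
Qed.

Let G0 i j : G z i j = dl i j.
Proof.
rewrite /dl -(Gg i j Uz) -(sum_delta (fun k => G z i k)); apply: eq_bigr => k _.
by rewrite g_id mulrC.
Qed.

(** Differentiating [Gg] at [z], where both the metric and its inverse are the identity. *)
Let dG v i l : pd v (fun x => G x i l) z = - pd v (fun x =>
  dot (pd (e i) F x) (pd (e l) F x)) z.
Proof.
have := d_zero v (fun y => @Gg y i l).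
rewrite (pd_sum oU Uz v _ (fun j => smoothM oU (sGij i j) (sg j l))).
under eq_bigr => j _ do rewrite (pdM Uz v (sGij i j) (sg j l)) g_id G0.
rewrite big_split /=.
under eq_bigr => j _ do rewrite mulrC; rewrite sum_delta sum_delta'.
by move=> /eqP; rewrite addr_eq0 => /eqP.
Qed.

Let dg1 v i l : pd (e v) (fun x => dot (pd (e i) F x) (pd (e l) F x)) z = 0.
Proof.
by rewrite (pd_dot oU Uz (e v) (sDF i) (sDF l)) Gamma0 dotC Gamma0 addr0.
Qed.

Let dG1 v i l : pd (e v) (fun x => G x i l) z = 0.
Proof. by rewrite dG dg1 oppr0. Qed.

(** In the second derivative of [Gg] the mixed products of first derivatives vanish at [z] by [dG1],
    so again only minus the derivative of the metric is left. *)
Let d2G v w i l : pd (e v) (pd (e w) (fun x => G x i l)) z =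
  - (X v w i l + X v w l i + (dot (F2 w i) (F2 v l) + dot (F2 v i) (F2 w l))).
Proof.
have := d2_zero (e v) (e w) (fun y => @Gg y i l).
rewrite (pd2_sum oU Uz (e v) (e w) _ (fun j => smoothM oU (sGij i j) (sg j l))).
under eq_bigr => j _ do rewrite (pd2M oU Uz (e v) (e w) (sGij i j) (sg j l)) !dG1
  !mul0r addr0 add0r g_id G0.
rewrite big_split /=.
under eq_bigr => j _ do rewrite mulrC; rewrite sum_delta sum_delta'.
move=> /eqP; rewrite addr_eq0 => /eqP ->.
rewrite (pd2_dot oU Uz (e v) (e w) (sDF i) (sDF l)) (dotC (pd (e i) F z)).
rewrite -/(F3 v w i) -/(F3 v w l) -/(F1 i) -/(F1 l) -/(X v w i l) -/(X v w l i).
by rewrite -/(F2 w i) -/(F2 v l) -/(F2 v i) -/(F2 w l); congr (- _); ring.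
Qed.

Let codazzi2 i m k :
  Y k i k m - a i k * h k m - K * (h i k * dl k m) - a k k * h i m - K * (h k k *
    dl i m)
    - \sum_p h k p * X k i m p =
  Y k i m k - a i m * h k k - K * h i m - a k m * h i k - K * (h k m * dl i k)
    - \sum_p h m p * X k i k p.
Proof.
have E : pd (e k) (pd (e i) (fun y => dot (pd (e k) nu y) (pd (e m) F y))) z =
         pd (e k) (pd (e i) (fun y => dot (pd (e m) nu y) (pd (e k) F y))) z.
  apply: (eq_pd oU Uz) => y Uy; apply: (eq_pd oU Uy) => y' Uy'.
  exact: weingarten_sym.
move: E; rewrite (pd2_dot oU Uz (e k) (e i) (sDnu k) (sDF m)) (pd2_dot oU Uz (e k) (e
  i) (sDnu m) (sDF k)).
rewrite -!/(N1 _) -!/(F1 _) -!/(N2 _ _) -!/(F2 _ _) -!/(N3 _ _ _) -!/(F3 _ _ _).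
rewrite !N2F2 !N1_dot -!/(X _ _ _ _) -!/(Y _ _ _ _).
have -> : dl k k = 1 by rewrite /dl eqxx.
have dlC x y : dl x y = dl y x by rewrite /dl eq_sym.
move=> E; move: E; move: (\sum_m0 _) (\sum_m0 _) => s1 s2 E.
by lra.
Qed.

Let T_sym12 i j k : T i j k = T j i k. Proof. by rewrite /T N2_sym. Qed.

(** The Codazzi equation: at [z], [T i j k] is minus the i-th covariant derivative of [h j k],
    because [F_ik] has no tangential part there. *)
Let T_sym23 i j k : T i j k = T i k j.
Proof.
have := eq_pd oU Uz (e i) (weingarten_sym j k).
rewrite (pd_dot oU Uz (e i) (sDnu j) (sDF k)) (pd_dot oU Uz (e i) (sDnu k) (sDF j)).
rewrite -!/(N1 _) -!/(F1 _) -!/(N2 _ _) -!/(F2 _ _) !N1_dot.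
rewrite (_ : \sum_m _ = 0); last by rewrite big1// => m _; rewrite Gamma0 mulr0.
rewrite (_ : \sum_m _ = 0); last by rewrite big1// => m _; rewrite Gamma0 mulr0.
by rewrite !oppr0 !addr0.
Qed.

Let sGP k l : smooth U (fun x => G x k l * dot (pd (e k) nu x) (pd (e l) F x)).
Proof. exact: smoothM. Qed.
Let sGa k l : smooth U (fun x => G x k l * dot (pd (e k) nu x) (pd (e l) nu x)).
Proof. exact: smoothM. Qed.

Let sGP1 k : smooth U (fun x => \sum_l G x k l * dot (pd (e k) nu x) (pd (e l) F x)).
Proof. by apply: smooth_sum. Qed.
Let sGa1 k : smooth U (fun x => \sum_l G x k l * dot (pd (e k) nu x) (pd (e l) nu x)).
Proof. by apply: smooth_sum. Qed.

Let d_flow_H v : pd v flow_H z = - \sum_k \sum_l (pd v (fun x => G x k l) z *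
  dot (N1 k) (F1 l)
   + dl k l * pd v (fun x => dot (pd (e k) nu x) (pd (e l) F x)) z).
Proof.
rewrite (pdN Uz v (smooth_sum oU _ sGP1)) (pd_sum oU Uz v _ sGP1); congr (- _).
apply: eq_bigr => k _; rewrite (pd_sum oU Uz v _ (sGP k)); apply: eq_bigr => l _.
by rewrite (pdM Uz v (sGij k l) (sP k l)) G0.
Qed.

Let d_flow_A2 v : pd v flow_A2 z = \sum_k \sum_l (pd v (fun x => G x k l) z *
  dot (N1 k) (N1 l)
   + dl k l * pd v (fun x => dot (pd (e k) nu x) (pd (e l) nu x)) z).
Proof.
rewrite (pd_sum oU Uz v _ sGa1).
apply: eq_bigr => k _; rewrite (pd_sum oU Uz v _ (sGa k)); apply: eq_bigr => l _.
by rewrite (pdM Uz v (sGij k l) (sa k l)) G0.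
Qed.

Let d2_flow_A2 v w : pd (e v) (pd (e w) flow_A2) z =
  \sum_k \sum_l (pd (e v) (pd (e w) (fun x => G x k l)) z * dot (N1 k) (N1 l)
   + dl k l * pd (e v) (pd (e w) (fun x => dot (pd (e k) nu x) (pd (e l) nu x))) z).
Proof.
rewrite (pd2_sum oU Uz (e v) (e w) _ sGa1).
apply: eq_bigr => k _; rewrite (pd2_sum oU Uz (e v) (e w) _ (sGa k));
  apply: eq_bigr => l _.
by rewrite (pd2M oU Uz (e v) (e w) (sGij k l) (sa k l)) G0 !dG1 !mul0r addr0 add0r.
Qed.

Let d2_flow_H v w : pd (e v) (pd (e w) flow_H) z =
  - \sum_k \sum_l (pd (e v) (pd (e w) (fun x => G x k l)) z * dot (N1 k) (F1 l)
   + dl k l * pd (e v) (pd (e w) (fun x => dot (pd (e k) nu x) (pd (e l) F x))) z).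
Proof.
have sS := smooth_sum oU (index_enum 'I_n) sGP1.
rewrite (eq_pd oU Uz (e v) (fun y Uy => pdN Uy (e w) sS)).
rewrite (pdN Uz (e v) (smooth_D (e w) sS)) (pd2_sum oU Uz (e v) (e w) _ sGP1);
  congr (- _).
apply: eq_bigr => k _; rewrite (pd2_sum oU Uz (e v) (e w) _ (sGP k));
  apply: eq_bigr => l _.
by rewrite (pd2M oU Uz (e v) (e w) (sGij k l) (sP k l)) G0 !dG1 !mul0r addr0 add0r.
Qed.

Let H2 m i := pd (e m) (pd (e i) flow_H) z.

Let hessian_H m i : H2 m i =
  - (\sum_k \sum_l h k l * (X m i k l + X m i l k + (h i k * h m l + K * (dl i k *
    dl m l))
        + (h m k * h i l + K * (dl m k * dl i l))))
  - (\sum_k (Y m i k k + (- a i k * h m k - K * (h i k * dl m k))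
        + (- a m k * h i k - K * (h m k * dl i k)) - \sum_p h k p * X m i k p)).
Proof.
rewrite /H2 d2_flow_H.
under eq_bigr => k _ do rewrite big_split /=.
rewrite big_split /= opprD; congr (- _ - _).
  apply: eq_bigr => k _; apply: eq_bigr => l _.
  by rewrite d2G !F2F2 N1F1; ring.
apply: eq_bigr => k _; rewrite sum_delta'.
rewrite (pd2_dot oU Uz (e m) (e i) (sDnu k) (sDF k)).
rewrite -!/(N1 _) -!/(F1 _) -!/(N2 _ _) -!/(F2 _ _) -!/(N3 _ _ _) -!/(F3 _ _ _).
rewrite !N2F2 !N1_dot -!/(X _ _ _ _) -!/(Y _ _ _ _).
by move: (\sum_m0 _) => s; ring.
Qed.

Let H := \sum_i h i i.
Let f := \sum_i a i i.
Let c3 := \sum_i \sum_j h i j * a i j.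

Lemma flow_H_at : flow_H z = H.
Proof.
rewrite /flow_H -sumrN; apply: eq_bigr => k _.
under eq_bigr => l _ do rewrite G0.
by rewrite sum_delta' -/(N1 k) -/(F1 k) N1F1 opprK.
Qed.

Lemma flow_A2_at : flow_A2 z = f.
Proof.
apply: eq_bigr => k _.
under eq_bigr => l _ do rewrite G0.
by rewrite sum_delta' -/(N1 k) N1N1.
Qed.

Lemma laplacian_A2 : \sum_k pd (e k) (pd (e k) flow_A2) z =
  2 * sum3 (fun k i m => T k i m ^+ 2) + 2 * (\sum_i \sum_m h i m * H2 i m)
  - 2 * f ^+ 2 - 2 * K * H ^+ 2 + 2 * H * c3 + 2 * n%:R * K * f.
Proof.
rewrite -(simons_contraction (X := X) (Y := Y) h_sym _ _ _ _ codazzi2 hessian_H T);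
  first last.
- by move=> i j k l; rewrite /Y N3_sym23.
- by move=> i j k l; rewrite /Y N3_sym12.
- by move=> i j k l; rewrite /X F3_sym23.
- by move=> i j k l; rewrite /X F3_sym12.
apply: eq_bigr => k _; rewrite d2_flow_A2.
under eq_bigr => i _ do rewrite big_split /=.
rewrite big_split /=; congr (_ + _).
  rewrite -sumrN; apply: eq_bigr => i _; rewrite -sumrN; apply: eq_bigr => j _.
  by rewrite d2G !F2F2 N1N1 -/(a i j) -/(dl k i) -/(dl k j); ring.
apply: eq_bigr => i _; rewrite sum_delta'.
rewrite (pd2_dot oU Uz (e k) (e k) (sDnu i) (sDnu i)).
rewrite -!/(N1 _) -!/(N2 _ _) -!/(N3 _ _ _) (dotC _ (N1 i)) N1_dot N2N2 -!/(Y _ _ _ _).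
by rewrite -/(a k i); move: (\sum_m _) (\sum_m0 _) => s1 s2; ring.
Qed.

Let dtF y i : U y ->
  pd tau (pd (e i) F) y = pd (e i) flow_H y *: nu y + flow_H y *: pd (e i) nu y.
Proof.
move=> Uy; rewrite (smooth_schwarz oU Uy tau (e i) sF) (eq_pd oU Uy (e i) Ft).
by rewrite (pd_scale oU Uy (e i) flow_H_smooth snu).
Qed.

(** The tangential part of the velocity of [nu] is minus the gradient of H. It is proved on all of
    [U] because its derivative, [NtiF1], is needed too. *)
Let NtF1_on m y : U y -> dot (pd tau nu y) (pd (e m) F y) = - pd (e m) flow_H y.
Proof.
move=> Uy; have E : pd tau (fun y => dot (nu y) (pd (e m) F y)) y = 0.
  by rewrite (eq_pd oU Uy tau (fun y Uy => nuF1 m Uy)) pd_cst.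
have E1 : pd (e m) (fun y => dot (nu y) (nu y)) y = 0.
  by rewrite (eq_pd oU Uy (e m) nunu) pd_cst.
move: E E1; rewrite (pd_dot oU Uy tau snu (sDF m)) (pd_dot oU Uy (e m) snu snu) (dtF
  m Uy).
rewrite dotDr !dotZr nunu// (dotC (pd (e m) nu y)).
move: (dot (nu y) _) (dot _ _) (flow_H y) (pd _ flow_H y) => w u p q E E1.
have w0 : w = 0 by lra.
by move: E; rewrite w0; lra.
Qed.

Let Ntnu : dot Nt (nu z) = 0.
Proof.
have := d_zero tau nunu; rewrite (pd_dot oU Uz tau snu snu) (dotC (nu z)) -/Nt.
by move: (dot _ _) => u E; lra.
Qed.

Let NtF : dot Nt (F z) = - H.
Proof.
have := d_zero tau nuF; rewrite (pd_dot oU Uz tau snu sF) Ft// dotZr nunu// flow_H_at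
  -/Nt.
by move: (dot _ _) => u E; lra.
Qed.

Let NtiF1 i m : dot (Nti i) (F1 m) = - H2 i m - K * H * dl i m.
Proof.
have := eq_pd oU Uz (e i) (NtF1_on m).
rewrite (pd_dot oU Uz (e i) (smooth_D tau snu) (sDF m)) (pdN Uz (e i) (smooth_D (e m)
  flow_H_smooth)).
rewrite -/(Nti i) -/(F1 m) -/Nt -/(F2 i m) -/(H2 i m).
have -> : dot Nt (F2 i m) = K * H * dl i m.
  rewrite parseval big1 ?add0r; last by move=> k _; rewrite Gamma0 mulr0.
  by rewrite Ntnu NtF F2F /dl; ring.
by move: (dot _ _) => u E; lra.
Qed.

Let Nt_comm i : pd tau (pd (e i) nu) z = Nti i.
Proof. exact: (smooth_schwarz oU Uz tau (e i) snu). Qed.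

(** The metric evolves by [-2 H h]; passing to the inverse at a point where the metric is the
    identity flips the sign. *)
Let dtG k l : pd tau (fun x => G x k l) z = 2 * H * h k l.
Proof.
rewrite dG (pd_dot oU Uz tau (sDF k) (sDF l)) !(dtF _ Uz) !dotDl dotDr !dotZl !dotZr.
rewrite (dotC _ (nu z)) !nuF1// -!/(F1 _) -!/(N1 _) (dotC (F1 k)) !N1F1 flow_H_at
  (h_sym l k).
by ring.
Qed.

Let hH : \sum_i \sum_m h i m * dl i m = H.
Proof.
apply: eq_bigr => i _; rewrite -(sum_delta' (fun m => h i m)).
by apply: eq_bigr => m _; rewrite mulrC.
Qed.

(** The pairing of h with the Hessian of H and the cubic term [2 H c3] appear identically in the
    time derivative and in [laplacian_A2], and drop out. Half of [4 K H^2] comes from the radial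
    component of the velocity of [nu], the other half from the Laplacian. *)
Lemma evolution_A2 : pd tau flow_A2 z =
  \sum_k pd (e k) (pd (e k) flow_A2) z - 2 * sum3 (fun k i m => T k i m ^+ 2)
  + 2 * f ^+ 2 + 4 * K * H ^+ 2 - 2 * n%:R * K * f.
Proof.
rewrite laplacian_A2 d_flow_A2.
under eq_bigr => k _ do rewrite big_split /=.
rewrite big_split /=.
have -> : \sum_k \sum_l pd tau (fun x => G x k l) z * dot (N1 k) (N1 l) = 2 * H * c3.
  rewrite /c3 mulr_sumr; apply: eq_bigr => k _; rewrite mulr_sumr; apply: eq_bigr =>
    l _.
  by rewrite dtG N1N1; ring.
have -> : \sum_k \sum_l dl k l * pd tau (fun x => dot (pd (e k) nu x) (pd (e l) nu
  x)) z =
    2 * (\sum_i \sum_m h i m * H2 i m) + 2 * K * H * (\sum_i \sum_m h i m * dl i m).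
  clearbody H; rewrite !mulr_sumr -big_split; apply: eq_bigr => k _ /=.
  rewrite sum_delta' (pd_dot oU Uz tau (sDnu k) (sDnu k)) Nt_comm (dotC (Nti k))
    -/(N1 k).
  have -> : dot (N1 k) (Nti k) = \sum_m h k m * (H2 k m + K * H * dl k m).
    by rewrite N1_dot -sumrN; apply: eq_bigr => m _; rewrite NtiF1; ring.
  rewrite !mulr_sumr -!big_split; apply: eq_bigr => m _ /=; ring.
by rewrite hH; ring.
Qed.

(** The inverse metric contributes [2 H f], and the variation [F_t = H nu] gives back [- H f]. *)
Lemma evolution_H : pd tau flow_H z =
  \sum_k pd (e k) (pd (e k) flow_H) z + H * (f + n%:R * K).
Proof.
rewrite d_flow_H.
under eq_bigr => k _ do rewrite big_split /=.
rewrite big_split /=.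
have -> : \sum_k \sum_l pd tau (fun x => G x k l) z * dot (N1 k) (F1 l) = - (2 * H * f).
  rewrite /f mulr_sumr -sumrN; apply: eq_bigr => k _; rewrite mulr_sumr -sumrN;
    apply: eq_bigr => l _.
  by rewrite dtG N1F1; ring.
have -> : \sum_k \sum_l dl k l * pd tau (fun x => dot (pd (e k) nu x) (pd (e l) F x))
  z =
    \sum_k (- H2 k k - K * H + H * a k k).
  apply: eq_bigr => k _; rewrite sum_delta' (pd_dot oU Uz tau (sDnu k) (sDF k)) Nt_comm.
  rewrite -/(F1 k) -/(N1 k) NtiF1 (dtF k Uz) dotDr !dotZr -/(N1 k) N1nu N1N1
    flow_H_at /dl eqxx /=; ring.
rewrite big_split sumrB sumrN sumr_const card_ord -mulr_sumr -/f -/(H2 _ _)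
  -mulr_natl /=.
by rewrite /H2; ring.
Qed.

Lemma gradient_H j : pd (e j) flow_H z = - \sum_k T k k j.
Proof.
rewrite d_flow_H; congr (- _); apply: eq_bigr => k _.
under eq_bigr => l _ do rewrite dG1 mul0r add0r.
rewrite sum_delta' (pd_dot oU Uz (e j) (sDnu k) (sDF k)) -/(N1 k) N1_dot.
rewrite (_ : \sum_m _ = 0); last by rewrite big1// => m _; rewrite Gamma0 mulr0.
by rewrite oppr0 addr0 -/(N2 j k) -/(F1 k) -/(T j k k) T_sym12 T_sym23.
Qed.

Lemma flow_defect_smooth c : smooth U (flow_defect c).
Proof.
apply: smoothD => //; first exact: flow_A2_smooth.
apply: smoothM => //; first exact: smooth_cst.
by apply: smoothM => //; exact: flow_H_smooth.
Qed.

Lemma evolution_pinching (c : R) : 0 <= c -> c * n.+2%:R <= 3 ->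
  pd tau (flow_defect c) z - \sum_k pd (e k) (pd (e k) (flow_defect c)) z <=
  2 * flow_A2 z ^+ 2 + 4 * K * flow_H z ^+ 2 - 2 * n%:R * K * flow_A2 z
  - 2 * c * flow_H z ^+ 2 * (flow_A2 z + n%:R * K).
Proof.
move=> c0 cn; set Q := flow_defect c.
have sA := flow_A2_smooth; have sH := flow_H_smooth.
have sHH : smooth U (fun x => flow_H x * flow_H x) by exact: smoothM.
have sc : smooth U (fun _ : V => - c : R) by exact: smooth_cst.
have scHH := smoothM oU sc sHH.
have dHH v y : U y -> pd v (fun x => - c * (flow_H x * flow_H x)) y = - c * (2 *
  (flow_H y * pd v flow_H y)).
  by move=> Uy; rewrite (pdM Uy v sc sHH) pd_cst (pdM Uy v sH sH); ring.
have dQ v y : U y -> pd v Q y = pd v flow_A2 y - 2 * c * (flow_H y * pd v flow_H y).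
  by move=> Uy; rewrite (pdD Uy v sA scHH) dHH//; ring.
have dQ2 k : pd (e k) (pd (e k) Q) z = pd (e k) (pd (e k) flow_A2) z
    - 2 * c * (pd (e k) flow_H z ^+ 2 + H * pd (e k) (pd (e k) flow_H) z).
  rewrite (eq_pd oU Uz (e k) (fun y Uy => pdD Uy (e k) sA scHH)).
  rewrite (pdD Uz (e k) (smooth_D (e k) sA) (smooth_D (e k) scHH)).
  rewrite (pd2M oU Uz (e k) (e k) sc sHH) !pd_cst.
  rewrite (_ : pd (e k) (pd (e k) (fun=> - c)) z = 0); last first.
    by rewrite (eq_pd oU Uz (e k) (fun y _ => pd_cst (- c : R) (e k) y)) pd_cst.
  by rewrite (pd2M oU Uz (e k) (e k) sH sH) flow_H_at; ring.
rewrite dQ// evolution_A2 evolution_H flow_H_at flow_A2_at.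
clearbody H f.
have -> : \sum_k pd (e k) (pd (e k) Q) z = \sum_k pd (e k) (pd (e k) flow_A2) z
   - 2 * c * \sum_k (\sum_i T i i k) ^+ 2 - 2 * c * H *
     \sum_k pd (e k) (pd (e k) flow_H) z.
  rewrite !mulr_sumr -!sumrB; apply: eq_bigr => k _; rewrite dQ2 gradient_H sqrrN; ring.
have := symmetric_trace_le T_sym12 T_sym23.
have N0 : 0 < n.+2%:R :> R by rewrite ltr0n.
have t0 : 0 <= \sum_j (\sum_k T k k j) ^+ 2 by apply: sumr_ge0 => j _; exact: sqr_ge0.
move: t0; move: (sum3 _) (\sum_j (\sum_k _) ^+ 2) (\sum_k pd _ (pd _ flow_A2) z)
  (\sum_k pd _ (pd _ flow_H) z) => s t p q t0 st.
have h1 : c * t <= s.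
  rewrite -(ler_pM2l N0) mulrA [_ * c]mulrC; apply: le_trans st.
  by rewrite ler_wpM2r.
rewrite -subr_ge0; have -> : 2 * f ^+ 2 + 4 * K * H ^+ 2 - 2 * n%:R * K * f -
  2 * c * H ^+ 2 * (f + n%:R * K) -
  (p - 2 * s + 2 * f ^+ 2 + 4 * K * H ^+ 2 - 2 * n%:R * K * f -
   2 * c * (H * (q + H * (f + n%:R * K))) -
   (p - 2 * c * t - 2 * c * H * q)) = 2 * (s - c * t) by ring.
by rewrite mulr_ge0// subr_ge0.
Qed.

End Evolution.

(** * Linear algebra of tangent frames *)

Section Gram.
Context {R : realType}.

Lemma row_free_mulP m d (A : 'M[R]_(m, d)) :
  (forall v : 'rV_m, v *m A = 0 -> v = 0) -> row_free A.
Proof.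
move=> h; rewrite -kermx_eq0; apply/rowV0P => v /sub_kermxP; exact: h.
Qed.

Lemma dot_mulmx m d (A : 'M[R]_(m, d)) (v : 'rV_m) (w : 'rV_d) :
  dot (v *m A) w = \sum_i v 0 i * dot (row i A) w.
Proof.
rewrite /dot -mulmxA mxE; apply: eq_bigr => i _; congr (_ * _).
by rewrite -row_mul !mxE.
Qed.

Lemma gramE m d (A : 'M[R]_(m, d)) i j : (A *m A^T) i j = dot (row i A) (row j A).
Proof. by rewrite mxE dotE; apply: eq_bigr => k _; rewrite !mxE. Qed.

Lemma gram_unit m d (A : 'M[R]_(m, d)) : row_free A -> A *m A^T \in unitmx.
Proof.
move=> fA; rewrite -row_free_unit; apply: row_free_mulP => v vA.
apply: (row_free_inj fA); rewrite mul0mx; apply: dot_eq0.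
by rewrite /dot trmx_mul mulmxA -(mulmxA v) vA mul0mx mxE.
Qed.

Section Frame.
Context {n : nat} {K : R} (K_gt0 : 0 < K) (E : 'M[R]_(n, n.+2)) (p nu : 'rV[R]_n.+2).
Hypothesis E_free : row_free E.
Hypothesis pp : dot p p = K^-1.
Hypothesis pE : forall i, dot (row i E) p = 0.
Hypothesis nunu : dot nu nu = 1.
Hypothesis pnu : dot p nu = 0.
Hypothesis Enu : forall i, dot (row i E) nu = 0.

Let B : 'M[R]_(n.+2) := col_mx p (col_mx nu E).

(** The position, the normal and the tangent rows form a basis: pairing a linear relation with [p]
    and with [nu] kills their coefficients, and row freeness of [E] kills the others. *)
Let B_unit : B \in unitmx.
Proof.
rewrite -row_free_unit; apply: row_free_mulP => c.
rewrite -[c](@hsubmxK _ 1 1 n.+1) -[X in row_mx _ X](@hsubmxK _ 1 1 n).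
set a := lsubmx _; set b := lsubmx _; set v := rsubmx (rsubmx _).
rewrite /B (@mul_row_col _ 1 1 n.+1) (@mul_row_col _ 1 1 n) => h.
have ap : a *m p = a 0 0 *: p by rewrite {1}[a]mx11_scalar mul_scalar_mx.
have bnu : b *m nu = b 0 0 *: nu by rewrite {1}[b]mx11_scalar mul_scalar_mx.
rewrite ap bnu in h.
have a0 : a 0 0 = 0.
  have := congr1 (fun x => dot x p) h.
  rewrite !dotDl !dotZl dot0l (dotC nu) pnu mulr0 pp dot_mulmx big1 => [|i _];
    last by rewrite pE mulr0.
  by rewrite !addr0 => /eqP; rewrite mulf_eq0 invr_eq0 (gt_eqF K_gt0) orbF => /eqP.
have b0 : b 0 0 = 0.
  have := congr1 (fun x => dot x nu) h.
  rewrite !dotDl !dotZl dot0l pnu nunu mulr0 dot_mulmx big1 => [|i _];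
    last by rewrite Enu mulr0.
  by rewrite add0r addr0 mulr1.
have v0 : v = 0.
  by apply: (row_free_inj E_free); move: h; rewrite a0 b0 !scale0r !add0r mul0mx.
have -> : a = 0 by rewrite [a]mx11_scalar a0 raddf0.
have -> : b = 0 by rewrite [b]mx11_scalar b0 raddf0.
by rewrite v0 row_mx0 row_mx0.
Qed.

Lemma frame_orthogonal_eq0 (w : 'rV[R]_n.+2) :
  dot p w = 0 -> dot nu w = 0 -> (forall i, dot (row i E) w = 0) -> w = 0.
Proof.
move=> pw nuw Ew; apply: trmx_inj; rewrite trmx0.
have Bw : B *m w^T = 0.
  rewrite /B (@mul_col_mx _ 1 n.+1) (@mul_col_mx _ 1 n).
  have -> : p *m w^T = 0 by apply/matrixP => i j; rewrite !ord1; apply: etrans pw _;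
    rewrite mxE.
  have -> : nu *m w^T = 0 by apply/matrixP => i j; rewrite !ord1;
    apply: etrans nuw _; rewrite mxE.
  have -> : E *m w^T = 0.
    by apply/matrixP => i j; rewrite !ord1; apply: etrans (_ : _ = dot (row i E) w) _;
      [rewrite /dot -row_mul [RHS]mxE | rewrite Ew mxE].
  by rewrite col_mx0 col_mx0.
by rewrite -[LHS]mul1mx -(mulVmx B_unit) -mulmxA Bw mulmx0.
Qed.

Let G := invmx (E *m E^T).

Let GE i l : \sum_j G i j * dot (row j E) (row l E) = (i == l)%:R.
Proof.
transitivity ((G *m (E *m E^T)) i l).
  by rewrite [RHS]mxE; apply: eq_bigr => j _; rewrite gramE.
by rewrite mulVmx ?mxE// gram_unit.
Qed.

(** [w] is [x] minus its tangential, normal and radial components; it is orthogonal to the whole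
    frame, hence zero. The weight K compensates for the radius, as [dot p p = K^-1]. *)
Lemma parseval (x y : 'rV[R]_n.+2) : dot x y =
  \sum_k \sum_l G k l * (dot x (row k E) * dot y (row l E)) + dot x nu * dot y nu
  + K * (dot x p * dot y p).
Proof.
pose w := x - (\sum_k \sum_l (G k l * dot x (row k E)) *: row l E) - dot x nu *: nu
   - (K * dot x p) *: p.
have dS v : dot (\sum_k \sum_l (G k l * dot x (row k E)) *: row l E) v =
   \sum_k \sum_l G k l * (dot x (row k E) * dot (row l E) v).
  rewrite dot_suml; apply: eq_bigr => k _; rewrite dot_suml; apply: eq_bigr => l _.
  by rewrite dotZl mulrA.
have w0 : w = 0.
  apply: frame_orthogonal_eq0; rewrite ?[dot _ w]dotC.
  - rewrite /w !dotBl !dotZl (dotC nu) pnu pp dS big1 => [|k _]; last first.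
      by rewrite big1// => l _; rewrite pE !mulr0.
    by field; rewrite gt_eqF.
  - rewrite /w !dotBl !dotZl nunu pnu dS big1 => [|k _]; last first.
      by rewrite big1// => l _; rewrite Enu !mulr0.
    ring.
  - move=> i; rewrite dotC /w !dotBl !dotZl (dotC nu) Enu (dotC p) pE dS.
    rewrite (_ : \sum_k _ = dot x (row i E)); first by ring.
    transitivity (\sum_k dot x (row k E) * (\sum_l G k l * dot (row l E) (row i E))).
      apply: eq_bigr => k _; rewrite mulr_sumr; apply: eq_bigr => l _; ring.
    under eq_bigr => k _ do rewrite GE mulrC.
    exact: sum_delta.
have : dot w y = 0 by rewrite w0 dot0l.
rewrite /w !dotBl !dotZl dS (dotC nu) (dotC p).
under [X in _ - X - _ - _]eq_bigr => k _ do under eq_bigr => l _ do rewrite (dotC _ y).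
by move: (\sum_k _) => s h; lra.
Qed.

End Frame.
End Gram.

Section LinearAlgebra.
Context {R : realType}.

Lemma dot_gt0 d (w : 'rV[R]_d) : w != 0 -> 0 < dot w w.
Proof.
by move=> w0; rewrite lt_neqAle dot_ge0 andbT eq_sym; apply: contra w0 =>
  /eqP/dot_eq0->.
Qed.

Lemma dot_normalize d (w : 'rV[R]_d) : w != 0 ->
  dot ((Num.sqrt (dot w w))^-1 *: w) ((Num.sqrt (dot w w))^-1 *: w) = 1.
Proof.
move=> /dot_gt0 w0; rewrite dotZl dotZr mulrA -expr2 exprVn sqr_sqrtr ?ltW//.
by rewrite mulVf// gt_eqF.
Qed.

(** The 1 + n rows of [B] cannot span a space of dimension n + 2, so some nonzero vector is
    orthogonal to all of them; it is then normalized. *)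
Lemma exists_unit_orthogonal n (E : 'M[R]_(n, n.+2)) (p : 'rV[R]_n.+2) :
  exists nu : 'rV[R]_n.+2, [/\ dot nu nu = 1, dot p nu = 0
    & forall i, dot (row i E) nu = 0].
Proof.
pose B : 'M[R]_(1 + n, n.+2) := col_mx p E.
have : kermx B^T != 0.
  rewrite kermx_eq0 /row_free mxrank_tr; apply/eqP => h.
  by have := rank_leq_row B; rewrite h ltnn.
move=> /rowV0Pn[w /sub_kermxP wB w0].
have Bw : B *m w^T = 0 by rewrite -[LHS]trmxK trmx_mul trmxK wB trmx0.
rewrite /B mul_col_mx in Bw.
have pw : p *m w^T = 0 by have := congr1 usubmx Bw; rewrite col_mxKu => ->;
  apply/matrixP => i j; rewrite !mxE.
have Ew : E *m w^T = 0 by have := congr1 dsubmx Bw; rewrite col_mxKd => ->;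
  apply/matrixP => i j; rewrite !mxE.
exists ((Num.sqrt (dot w w))^-1 *: w); split.
- exact: dot_normalize.
- by rewrite dotZr (_ : dot p w = 0) ?mulr0// /dot pw mxE.
- by move=> i; rewrite dotZr (_ : dot (row i E) w = 0) ?mulr0// /dot -row_mul Ew !mxE.
Qed.

(** Gram-Schmidt from the bottom up: the rows below the top one are orthonormalized to [Q], and [w]
    is the top row minus its projection onto them. Row freeness prevents [w] from vanishing. *)
Lemma orthonormalize n d (E : 'M[R]_(n, d)) : row_free E ->
  exists L : 'M[R]_n, (L *m E) *m (L *m E)^T = 1%:M.
Proof.
elim: n E => [|n IH] E fE.
  by exists 1%:M; apply/matrixP => -[].
pose e0 : 'M[R]_(1, d) := @usubmx _ 1 n d E; pose E1 := @dsubmx _ 1 n d E.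
have EE : E = @col_mx _ 1 n d e0 E1 by rewrite vsubmxK.
have fE1 : row_free E1.
  apply: row_free_mulP => v vE; have := @row_free_inj _ _ _ _ _ fE (@row_mx _ 1 1 n 0
    v) 0.
  rewrite mul0mx EE (@mul_row_col _ 1 1 n) mul0mx add0r => /(_ vE) h.
  by have := congr1 (@rsubmx _ 1 1 n) h; rewrite row_mxKr => ->; apply/matrixP =>
    i j; rewrite !mxE.
have [L1 LL] := IH E1 fE1.
set Q := L1 *m E1 in LL *.
pose w := e0 - e0 *m Q^T *m Q.
have wQ : w *m Q^T = 0 by rewrite /w mulmxBl -(mulmxA _ Q) LL mulmx1 subrr.
have w0 : w != 0.
  apply/eqP => w0; have := @row_free_inj _ _ _ _ _ fE (@row_mx _ 1 1 n 1%:M (- (e0 *m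
    Q^T *m L1))) 0.
  rewrite mul0mx {1}EE (@mul_row_col _ 1 1 n) mul1mx mulNmx -[X in _ - X]mulmxA -/Q
    => /(_ w0) h.
  have := congr1 (fun A : 'M[R]_(1, 1 + n) => lsubmx A 0 0) h.
  by rewrite row_mxKl !mxE eqxx => /eqP; rewrite oner_eq0.
pose s := (Num.sqrt (dot w w))^-1.
pose L : 'M[R]_(1 + n) := block_mx s%:M (- (s *: (e0 *m Q^T *m L1))) 0 L1.
exists L.
have -> : L *m E = @col_mx _ 1 n d (s *: w) Q.
  rewrite {1}EE /L (@mul_block_col _ 1 n 1 n) mul0mx add0r -/Q mul_scalar_mx mulNmx
    -scalemxAl.
  by rewrite -(mulmxA _ L1) -/Q -scalerBr.
rewrite (@tr_col_mx _ 1 n d) (@mul_col_row _ 1 n d 1 n).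
have ww : s *: w *m (s *: w)^T = 1%:M.
  by apply/matrixP => i j; rewrite !ord1; apply: etrans (dot_normalize w0) _;
    rewrite mxE eqxx.
have QC : Q *m (s *: w)^T = 0 by rewrite -[LHS]trmxK trmx_mul trmxK -scalemxAl wQ
  scaler0 trmx0.
by rewrite ww LL QC -scalemxAl wQ scaler0 -(@scalar_mx_block _ 1 n).
Qed.

Lemma invmx_mul n (A B : 'M[R]_n) : A \in unitmx -> B \in unitmx ->
  invmx (A *m B) = invmx B *m invmx A.
Proof.
move=> uA uB; have uAB : A *m B \in unitmx by rewrite unitmx_mul uA.
apply: (can_inj (mulKmx uAB)); rewrite mulmxV// -mulmxA (mulmxA B) mulmxV//.
by rewrite mul1mx mulmxV.
Qed.

(** Once contractions are traces, their invariance under a congruence by [J] is cancellation of [J]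
    against its inverse and cyclicity of the trace. *)
Lemma contraction2E n (A B : 'M[R]_n) : \sum_i \sum_j A i j * B i j = \tr (A *m B^T).
Proof.
by apply: eq_bigr => i _; rewrite mxE; apply: eq_bigr => j _; rewrite mxE.
Qed.

Lemma contraction4E n (G h : 'M[R]_n) :
  \sum_i \sum_j \sum_k \sum_l G i j * G k l * h i k * h j l =
  \tr (h^T *m G *m h *m G^T).
Proof.
transitivity (\sum_k \sum_l \sum_j \sum_i G i j * G k l * h i k * h j l).
  rewrite exchange_big /=.
  under eq_bigr => j _ do rewrite exchange_big /=.
  rewrite exchange_big /=; apply: eq_bigr => k _.
  under eq_bigr => j _ do rewrite exchange_big /=.
  by rewrite exchange_big.
apply: eq_bigr => k _; rewrite mxE; apply: eq_bigr => l _; rewrite !mxE mulr_suml.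
apply: eq_bigr => j _; rewrite !mxE !mulr_suml; apply: eq_bigr => i _.
by rewrite !mxE; ring.
Qed.

Lemma contraction2_congr n (J g h : 'M[R]_n) : J \in unitmx -> g \in unitmx ->
  \sum_i \sum_j invmx (J *m g *m J^T) i j * (J *m h *m J^T) i j =
  \sum_i \sum_j invmx g i j * h i j.
Proof.
move=> uJ ug; have uJt : J^T \in unitmx by rewrite unitmx_tr.
rewrite !contraction2E !trmx_mul trmxK !invmx_mul ?unitmx_mul ?uJ ?ug//.
rewrite -!mulmxA (mulmxA (invmx J) J) mulVmx// mul1mx mxtrace_mulC -!mulmxA.
by rewrite mulmxV// mulmx1.
Qed.

Lemma contraction4_congr n (J g h : 'M[R]_n) : J \in unitmx -> g \in unitmx ->
  \sum_i \sum_j \sum_k \sum_l invmx (J *m g *m J^T) i j * invmx (J *m g *m J^T) k l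
     * (J *m h *m J^T) i k * (J *m h *m J^T) j l =
  \sum_i \sum_j \sum_k \sum_l invmx g i j * invmx g k l * h i k * h j l.
Proof.
move=> uJ ug; have uJt : J^T \in unitmx by rewrite unitmx_tr.
rewrite !contraction4E !invmx_mul ?unitmx_mul ?uJ ?ug//.
rewrite !trmx_mul !trmxK -!mulmxA !trmx_inv trmxK.
rewrite !(mulmxA J^T (invmx J^T)) !(mulmxA (invmx J) J) mulmxV// mulVmx// !mul1mx.
by rewrite mxtrace_mulC -!mulmxA mulVmx// mulmx1.
Qed.

End LinearAlgebra.

(** * Reparametrization invariance *)

Section Composition.
Context {R : realType} {V V' : normedModType R} {I : finType}.
Context {e : I -> V} {c : I -> V -> R} (ec : coordinates e c).
Context {U : set V} {U' : set V'} (oU : open U) (oU' : open U').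
Context (phi : V' -> V) (phiU : forall y, U' y -> U (phi y)).
Hypothesis sphi : forall i, smooth U' (fun y => c i (phi y)).

Lemma smooth_comp m n (F : V -> 'M[R]_(m, n)) :
  smooth U F -> smooth U' (fun y => F (phi y)).
Proof.
move=> /(smooth_mxP oU) sF; apply/(smooth_mxP oU') => i j k.
exact: (Ck_comp ec oU oU' phiU (fun l => sphi l k) (sF i j k)).
Qed.

Lemma pd_comp d (F : V -> 'rV[R]_d) w y : smooth U F -> U' y ->
  pd w (fun y => F (phi y)) y =
  \sum_i pd w (fun y => c i (phi y)) y *: pd (e i) F (phi y).
Proof.
move=> sF Uy; apply/rowP => j.
have sFj : smooth U (fun x => F x 0 j) := (iffLR (smooth_mxP oU F) sF) 0 j.
rewrite pdE (derive_mxE 0 j (smooth_derivable (smooth_comp sF) Uy)).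
have [_ ->] := is_derive_comp ec oU w Uy phiU (fun i => sphi i 1%N) (sFj 1%N).
rewrite summxE; apply: eq_bigr => i _; rewrite mxE !pdE.
by rewrite (derive_mxE 0 j (smooth_derivable sF (phiU Uy))).
Qed.

End Composition.

Section Reparametrization.
Context {R : realType} {n : nat}.
Let e (i : 'I_n) : 'rV[R]_n := delta_mx 0 i.
Context {O W : set 'rV[R]_n} (oO : open O) (oW : open W).
Context (F F' : 'rV[R]_n -> 'rV[R]_n.+2) (phi : 'rV[R]_n -> 'rV[R]_n) (K : R).
Hypothesis sF : smooth O F.
Hypothesis sphi : smooth W phi.
Hypothesis phiO : forall u, W u -> O (phi u).
Hypothesis F'E : forall u, W u -> F' u = F (phi u).

Lemma row_jacobian_pd d (U : set 'rV[R]_n) (f : 'rV[R]_n -> 'rV[R]_d) u i :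
  open U -> smooth U f -> U u -> row i ('J f u) = pd (e i) f u.
Proof. by move=> oU sf Uu; rewrite pdE; exact: row_jacobian Uu (sf 1%N). Qed.

Let sphi0 i : smooth W (fun y => phi y 0 i) := (iffLR (smooth_mxP oW phi) sphi) 0 i.

Let sF' : smooth W F'.
Proof.
apply: smooth_eq (smooth_comp (row_coordinates n) oO oW phiO sphi0 sF) => //.
by move=> u Wu; rewrite F'E.
Qed.

Let pdF' i u : W u -> pd (e i) F' u =
  \sum_a pd (e i) (fun y => phi y 0 a) u *: pd (e a) F (phi u).
Proof.
by move=> Wu; rewrite (eq_pd oW Wu (e i) F'E) (pd_comp (row_coordinates n) oO oW phiO
  sphi0 (e i) sF Wu).
Qed.

Lemma jacobianE i a u : W u -> 'J phi u i a = pd (e i) (fun y => phi y 0 a) u.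
Proof.
move=> Wu; transitivity (row i ('J phi u) 0 a); first by rewrite [RHS]mxE.
by rewrite (row_jacobian_pd i oW sphi Wu) !pdE (derive_mxE 0 a (smooth_derivable sphi
  Wu)).
Qed.

Lemma jacobian_reparam u : W u -> 'J F' u = 'J phi u *m 'J F (phi u).
Proof.
move=> Wu; apply/row_matrixP => i; rewrite row_mul (row_jacobian_pd i oW sF' Wu) pdF'//.
rewrite [RHS]mulmx_sum_row; apply: eq_bigr => a _.
by rewrite [row _ _ 0 a]mxE jacobianE// (row_jacobian_pd a oO sF (phiO Wu)).
Qed.

Lemma second_formE (G : 'rV[R]_n -> 'rV[R]_n.+2) u nu i j : dot (G u) nu = 0 ->
  second_form K G u nu i j = dot (pd (e i) (pd (e j) G) u) nu.
Proof.
move=> Gnu; rewrite mxE /sphere_hessian /sphere_proj dotBl dotZl Gnu mulr0 subr0.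
by rewrite !pd_fE.
Qed.

(** For [w] normal the terms with second derivatives of [phi] vanish, which makes the second
    fundamental form a tensor. For [w] tangent they are the correction with which normal coordinates
    cancel the Christoffel symbols. *)
Lemma dot_pd2_reparam i j (w : 'rV[R]_n.+2) u : W u ->
  dot (pd (e i) (pd (e j) F') u) w =
  \sum_a (pd (e i) (pd (e j) (fun y => phi y 0 a)) u * dot (pd (e a) F (phi u)) w
    + pd (e j) (fun y => phi y 0 a) u *
      \sum_b pd (e i) (fun y => phi y 0 b) u * dot (pd (e b) (pd (e a) F) (phi u)) w).
Proof.
move=> Wu; have sD a : smooth W (fun y => pd (e a) F (phi y)).
  exact: (smooth_comp (row_coordinates n) oO oW phiO sphi0 (smooth_D (e a) sF)).
have sDphi k a : smooth W (pd (e k) (fun y => phi y 0 a)) by exact: smooth_D.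
have sw : smooth W (fun _ : 'rV[R]_n => w) by exact: smooth_cst.
have dot_w v (f : 'rV[R]_n -> 'rV[R]_n.+2) : smooth W f ->
    pd v (fun y => dot (f y) w) u = dot (pd v f u) w.
  by move=> sf; rewrite (pd_dot oW Wu v sf sw) pd_cst (dotC (f u)) dot0l addr0.
rewrite -dot_w; last exact: smooth_D.
have sda a : smooth W (fun y => dot (pd (e a) F (phi y)) w) by exact: smooth_dot.
have E y : W y -> dot (pd (e j) F' y) w =
    \sum_a pd (e j) (fun y => phi y 0 a) y * dot (pd (e a) F (phi y)) w.
  by move=> Wy; rewrite pdF'// dot_suml; apply: eq_bigr => a _; rewrite dotZl.
rewrite (eq_pd oW Wu (e i) E) (pd_sum oW Wu (e i) _ (fun a =>
  smoothM oW (sDphi j a) (sda a))).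
apply: eq_bigr => a _; have sFa := smooth_D (e a) sF.
rewrite (pdM Wu (e i) (sDphi j a) (sda a)) dot_w// (pd_comp (row_coordinates n) oO oW
  phiO sphi0 (e i) sFa Wu).
rewrite dot_suml; congr (_ + _ * _); apply: eq_bigr => b _; exact: dotZl.
Qed.

Section Point.
Context (u : 'rV[R]_n) (Wu : W u) (nu : 'rV[R]_n.+2).
Hypothesis J'_free : row_free ('J F' u).

Let J := 'J phi u.

Lemma jacobian_reparam_unit : J \in unitmx.
Proof.
rewrite -row_free_unit; apply: row_free_mulP => v vJ.
apply: (row_free_inj J'_free).
by rewrite mul0mx (jacobian_reparam Wu) mulmxA vJ mul0mx.
Qed.

Lemma row_free_reparam : row_free ('J F (phi u)).
Proof.
apply: row_free_mulP => v vJ.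
have uJ := jacobian_reparam_unit.
have h : (v *m invmx J) *m 'J F' u = 0.
  by rewrite (jacobian_reparam Wu) -mulmxA (mulmxA (invmx J)) mulVmx// mul1mx.
have : v *m invmx J = 0 by apply: (row_free_inj J'_free); rewrite mul0mx.
by move=> /(congr1 (mulmx^~ J)); rewrite -mulmxA mulVmx// mulmx1 mul0mx.
Qed.

Lemma unit_normal_reparam : unit_normal F' u nu <-> unit_normal F (phi u) nu.
Proof.
have tangent (A : 'M[R]_(n, n.+2)) : (forall i, dot (row i A) nu = 0) <-> A *m nu^T = 0.
  split=> [h|h i]; last by rewrite /dot -row_mul h !mxE.
  apply/matrixP => i j; rewrite !ord1 [RHS]mxE; apply: etrans (h i).
  by rewrite /dot -row_mul [RHS]mxE.
have E := jacobian_reparam Wu.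
split=> -[nn pn h]; split; [exact: nn| |apply/tangent|exact: nn| |apply/tangent].
- by move: pn; rewrite (F'E Wu).
- move/tangent : h; rewrite E -mulmxA => /(congr1 (mulmx (invmx J))).
  by rewrite (mulKmx jacobian_reparam_unit) mulmx0.
- by rewrite (F'E Wu).
- by move/tangent : h => h; rewrite E -mulmxA h mulmx0.
Qed.

Hypothesis nu_normal : unit_normal F (phi u) nu.

Lemma second_form_reparam :
  second_form K F' u nu = J *m second_form K F (phi u) nu *m J^T.
Proof.
have [_ Fnu Jnu] := nu_normal.
apply/matrixP => i j; rewrite second_formE ?F'E// (dot_pd2_reparam i j nu Wu).
rewrite [RHS]mxE; apply: eq_bigr => a _; rewrite [(J *m _) i a]mxE [J^T a j]mxE
  mulr_suml.
rewrite -(row_jacobian_pd a oO sF (phiO Wu)) Jnu mulr0 add0r mulr_sumr /=.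
apply: eq_bigr => b _; rewrite (second_formE _ _ Fnu) !jacobianE//.
by ring.
Qed.

Lemma metric_reparam : metric F' u = J *m metric F (phi u) *m J^T.
Proof. by rewrite /metric (jacobian_reparam Wu) trmx_mul !mulmxA. Qed.

Lemma mean_curvature_reparam :
  mean_curvature K F' u nu = mean_curvature K F (phi u) nu.
Proof.
rewrite /mean_curvature metric_reparam second_form_reparam contraction2_congr//.
  exact: jacobian_reparam_unit.
exact: gram_unit row_free_reparam.
Qed.

Lemma normsq_reparam :
  normsq_second_form K F' u nu = normsq_second_form K F (phi u) nu.
Proof.
rewrite /normsq_second_form metric_reparam second_form_reparam contraction4_congr//.
  exact: jacobian_reparam_unit.
exact: gram_unit row_free_reparam.
Qed.

End Point.

End Reparametrization.

(** * Space-time patches of the flow *)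

Section Slices.
Context {R : realType} {n : nat}.
Let V := ('rV[R]_n * R)%type.
Implicit Types (t : R) (u v : 'rV[R]_n).

Definition slice (W : Type) (F : V -> W) t : 'rV[R]_n -> W := fun u => F (u, t).

Definition space_dir (i : 'I_n) : 'rV[R]_n * R := (delta_mx 0 i, 0).
Definition time_dir : 'rV[R]_n * R := (0, 1).

Lemma slice_nbhs (P : V -> Prop) u t :
  (\forall z \near (u, t), P z) -> \forall v \near u, P (v, t).
Proof.
move=> /nbhs_ballP[r /= r0 rP]; apply/nbhs_ballP; exists r => // v vr.
by apply: rP; split=> //=; exact: ballxx.
Qed.

Lemma slice_open (U : set V) t : open U -> open [set u | U (u, t)].
Proof.
move=> oU; rewrite openE => u /= Uu.
by apply: (@slice_nbhs U); exact: open_near.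
Qed.

Lemma derive_sliceE (W : normedModType R) (F : V -> W) t v u :
  'D_v (slice F t) u = 'D_((v, 0) : V) F (u, t).
Proof.
rewrite /derive; set g1 := fun h => h^-1 *: _; set g2 := fun h => h^-1 *: _.
suff -> : g1 = g2 by [].
apply/funext => h; rewrite /g1 /g2 /slice /=; congr (_ *: (F _ - _)).
by apply: injective_projections => //=; rewrite scaler0 add0r.
Qed.

Lemma derivable_slice (W : normedModType R) (F : V -> W) t v u :
  derivable F (u, t) ((v, 0) : V) -> derivable (slice F t) u v.
Proof.
rewrite /derivable; set g1 := fun h => h^-1 *: _; set g2 := fun h => h^-1 *: _.
suff -> : g1 = g2 by [].
apply/funext => h; rewrite /g1 /g2 /slice /=; congr (_ *: (F _ - _)).
by apply: injective_projections => //=; rewrite scaler0 add0r.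
Qed.

Lemma continuous_slice (W : normedModType R) (F : V -> W) t u :
  {for (u, t), continuous F} -> {for u, continuous (slice F t)}.
Proof. by move=> cF A /cF /slice_nbhs. Qed.

Lemma Ck_slice (W : normedModType R) k (U : set V) (F : V -> W) t :
  Ck k U F -> Ck k [set u | U (u, t)] (slice F t).
Proof.
elim: k F => [|k IH] F [cF DF]; split => //.
- by move=> u Uu; apply: continuous_slice; exact: cF.
- by move=> u Uu; apply: continuous_slice; exact: cF.
move=> v; have [dF CF] := DF (v, 0); split.
  by move=> u Uu; apply: derivable_slice; exact: dF.
have -> : 'D_v (slice F t) = slice ('D_((v, 0) : V) F) t.
  by apply/funext => u; rewrite derive_sliceE.
exact: IH.
Qed.

Lemma smooth_slice (W : normedModType R) (U : set V) (F : V -> W) t :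
  smooth U F -> smooth [set u | U (u, t)] (slice F t).
Proof. by move=> sF k; exact: Ck_slice. Qed.

Lemma pd_slice (W : normedModType R) (F : V -> W) t i :
  pd (delta_mx 0 i) (slice F t) = slice (pd (space_dir i) F) t.
Proof. by apply/funext => u; rewrite pdE derive_sliceE /slice pdE. Qed.

Section Point.
Context (U : set V) (oU : open U) (F : V -> 'rV[R]_n.+2) (K : R).
Hypothesis sF : smooth U F.
Context (z : V) (Uz : U z).

Let Uz' : [set u | U (u, z.2)] z.1. Proof. by case: z Uz. Qed.

Lemma row_jacobian_slice i : row i ('J (slice F z.2) z.1) = pd (space_dir i) F z.
Proof.
rewrite (row_jacobian_pd i (slice_open oU (t:=z.2)) (smooth_slice z.2 sF) Uz').
by rewrite pd_slice /slice; case: z.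
Qed.

Lemma metric_slice i j :
  metric (slice F z.2) z.1 i j = dot (pd (space_dir i) F z) (pd (space_dir j) F z).
Proof. by rewrite /metric gramE !row_jacobian_slice. Qed.

Lemma second_form_slice nu i j : dot (F z) nu = 0 ->
  second_form K (slice F z.2) z.1 nu i j =
  dot (pd (space_dir i) (pd (space_dir j) F) z) nu.
Proof.
move=> Fnu; rewrite second_formE; last by rewrite /slice; case: z Fnu.
by rewrite !pd_slice /slice; case: z.
Qed.

End Point.

End Slices.

Section Patch.
Context {R : realType} {n : nat}.
Let V := ('rV[R]_n * R)%type.
Variable K : R.

(** A piece of the flow over an open set of space-time, with a smooth unit normal. Openness in time
    makes the velocity a two-sided derivative, so time and space derivatives commute. *)
Record mcf_patch (U : set V) (F nu : V -> 'rV[R]_n.+2) : Prop := Patch {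
  patch_open : open U;
  patch_smooth : smooth U F;
  patch_normal_smooth : smooth U nu;
  patch_sphere : forall z, U z -> dot (F z) (F z) = K^-1;
  patch_free : forall z, U z -> row_free ('J (slice F z.2) z.1);
  patch_normal : forall z, U z -> unit_normal (slice F z.2) z.1 (nu z);
  patch_flow : forall z, U z ->
    'D_time_dir F z = mean_curvature K (slice F z.2) z.1 (nu z) *: nu z
}.

Definition patch_H (F nu : V -> 'rV[R]_n.+2) (z : V) : R :=
  mean_curvature K (slice F z.2) z.1 (nu z).

Definition patch_A2 (F nu : V -> 'rV[R]_n.+2) (z : V) : R :=
  normsq_second_form K (slice F z.2) z.1 (nu z).

Definition patch_defect (F nu : V -> 'rV[R]_n.+2) (c : R) (z : V) : R :=
  patch_A2 F nu z - c * patch_H F nu z ^+ 2.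

Definition patch_Ginv (F : V -> 'rV[R]_n.+2) (z : V) : 'M[R]_n :=
  invmx (metric (slice F z.2) z.1).

Section Theory.
Context {U : set V} {F nu : V -> 'rV[R]_n.+2} (P : mcf_patch U F nu) (K_gt0 : 0 < K).
Let e := @space_dir R n.
Let oU := patch_open P.
Let sF := patch_smooth P.
Let snu := patch_normal_smooth P.
Let G := patch_Ginv F.

Lemma patch_metric z : U z -> metric (slice F z.2) z.1 = \matrix_(i,
  j) dot (pd (e i) F z) (pd (e j) F z).
Proof. by move=> Uz; apply/matrixP => i j; rewrite (metric_slice oU sF Uz) mxE. Qed.

Lemma patch_metric_unit z : U z -> metric (slice F z.2) z.1 \in unitmx.
Proof. by move=> Uz; exact: gram_unit (patch_free P Uz). Qed.

Lemma patch_Ginv_smooth : smooth U G.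
Proof.
have sD i : smooth U (pd (e i) F) by exact: smooth_D.
have sg : smooth U (fun z => \matrix_(i, j) dot (pd (e i) F z) (pd (e j) F z) :
  'M[R]_n).
  apply/(smooth_mxP oU) => i j.
  by apply: (smooth_eq oU _ (smooth_dot oU (sD i) (sD j))) => z Uz; rewrite mxE.
move=> k; apply: (eq_Ck oU _ (Ck_invmx oU _ (sg k))) => z Uz.
  by rewrite /G /patch_Ginv patch_metric.
by rewrite -patch_metric// patch_metric_unit.
Qed.

Lemma patch_nuF1 z i : U z -> dot (nu z) (pd (e i) F z) = 0.
Proof.
move=> Uz; rewrite -(row_jacobian_slice oU sF Uz) dotC.
by have [_ _] := patch_normal P Uz; apply.
Qed.

Lemma patch_nuF z : U z -> dot (F z) (nu z) = 0.
Proof. by move=> Uz; have [_ + _] := patch_normal P Uz; rewrite /slice; case: z Uz. Qed.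

Lemma patch_nunu z : U z -> dot (nu z) (nu z) = 1.
Proof. by move=> Uz; have [+ _ _] := patch_normal P Uz. Qed.

Lemma patch_FF1 z i : U z -> dot (pd (e i) F z) (F z) = 0.
Proof.
move=> Uz; have E : pd (e i) (fun z => dot (F z) (F z)) z = 0.
  by rewrite (eq_pd oU Uz (e i) (patch_sphere P)) pd_cst.
move: E; rewrite (pd_dot oU Uz (e i) sF sF) (dotC (F z)).
by move: (dot _ _) => x E; lra.
Qed.

Lemma patch_Gg z i l : U z ->
  \sum_j G z i j * dot (pd (e j) F z) (pd (e l) F z) = (i == l)%:R.
Proof.
move=> Uz; transitivity ((G z *m metric (slice F z.2) z.1) i l).
  by rewrite [RHS]mxE; apply: eq_bigr => j _; rewrite (metric_slice oU sF Uz).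
by rewrite mulVmx ?mxE// patch_metric_unit.
Qed.

Lemma patch_parseval z (x y : 'rV[R]_n.+2) : U z -> dot x y =
  \sum_k \sum_l G z k l * (dot x (pd (e k) F z) * dot y (pd (e l) F z))
  + dot x (nu z) * dot y (nu z) + K * (dot x (F z) * dot y (F z)).
Proof.
move=> Uz; have rJ i := row_jacobian_slice oU sF Uz i.
rewrite (parseval K_gt0 (patch_free P Uz) (patch_sphere P Uz) _ (patch_nunu Uz)
  (patch_nuF Uz)).
- congr (_ + _ + _); apply: eq_bigr => k _; apply: eq_bigr => l _.
  by rewrite !rJ.
- by move=> i; rewrite rJ patch_FF1.
- by move=> i; rewrite rJ dotC patch_nuF1.
Qed.

Lemma patch_second_form z i j : U z ->
  second_form K (slice F z.2) z.1 (nu z) i j = - dot (pd (e i) nu z) (pd (e j) F z).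
Proof.
move=> Uz; rewrite (second_form_slice K i j (patch_nuF Uz)).
have E : pd (e i) (fun y => dot (nu y) (pd (e j) F y)) z = 0.
  by rewrite (eq_pd oU Uz (e i) (fun y Uy => patch_nuF1 j Uy)) pd_cst.
move: E; rewrite (pd_dot oU Uz (e i) snu (smooth_D (e j) sF)) (dotC (nu z)) => /eqP.
by rewrite addrC addr_eq0 => /eqP.
Qed.

Lemma patch_nu1nu z i : U z -> dot (pd (e i) nu z) (nu z) = 0.
Proof.
move=> Uz; have E : pd (e i) (fun z => dot (nu z) (nu z)) z = 0.
  by rewrite (eq_pd oU Uz (e i) patch_nunu) pd_cst.
move: E; rewrite (pd_dot oU Uz (e i) snu snu) (dotC (nu z)).
by move: (dot _ _) => x E; lra.
Qed.

Lemma patch_nu1F z i : U z -> dot (pd (e i) nu z) (F z) = 0.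
Proof.
move=> Uz; have E : pd (e i) (fun z => dot (F z) (nu z)) z = 0.
  by rewrite (eq_pd oU Uz (e i) patch_nuF) pd_cst.
move: E; rewrite (pd_dot oU Uz (e i) sF snu) (dotC (pd (e i) F z)) patch_nuF1// add0r.
by rewrite dotC.
Qed.

Lemma patch_HE z : U z -> patch_H F nu z = flow_H e F nu G z.
Proof.
move=> Uz; rewrite /patch_H /flow_H /mean_curvature -sumrN; apply: eq_bigr => k _.
rewrite -sumrN; apply: eq_bigr => l _.
by rewrite patch_second_form// mulrN.
Qed.

(** The derivatives [nu_i] have no component along [nu] or [F], so [patch_parseval] expands
    [<nu_i, nu_j>] as [g^kl h_ik h_jl]. *)
Lemma patch_A2E z : U z -> patch_A2 F nu z = flow_A2 e nu G z.
Proof.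
move=> Uz; apply: eq_bigr => i _; apply: eq_bigr => j _.
rewrite (patch_parseval _ _ Uz) !patch_nu1nu// !patch_nu1F// !mul0r mulr0 !addr0.
rewrite mulr_sumr; apply: eq_bigr => k _; rewrite mulr_sumr; apply: eq_bigr => l _.
by rewrite !patch_second_form// /G /patch_Ginv; ring.
Qed.

Lemma patch_Ft z : U z -> pd time_dir F z = flow_H e F nu G z *: nu z.
Proof. by move=> Uz; rewrite pdE (patch_flow P Uz) -patch_HE. Qed.

Lemma patch_defectE c z : U z -> patch_defect F nu c z = flow_defect e F nu G c z.
Proof.
move=> Uz; rewrite /patch_defect /flow_defect patch_A2E// patch_HE//.
by move: (flow_A2 _ _ _ _) (flow_H _ _ _ _ _) => x y; ring.
Qed.

Lemma patch_defect_smooth c : smooth U (patch_defect F nu c).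
Proof.
have E z : U z -> flow_defect e F nu G c z = patch_defect F nu c z.
  by move=> Uz; rewrite patch_defectE.
exact: (smooth_eq oU E (flow_defect_smooth oU e sF snu patch_Ginv_smooth c)).
Qed.

Lemma patch_evolution c z : U z -> metric (slice F z.2) z.1 = 1%:M ->
  (forall i j k, dot (pd (e i) (pd (e j) F) z) (pd (e k) F z) = 0) ->
  0 <= c -> c * n.+2%:R <= 3 ->
  pd time_dir (patch_defect F nu c) z - \sum_k pd (e k) (pd (e k) (patch_defect F nu
    c)) z <=
  2 * patch_A2 F nu z ^+ 2 + 4 * K * patch_H F nu z ^+ 2 - 2 * n%:R * K *
    patch_A2 F nu z
  - 2 * c * patch_H F nu z ^+ 2 * (patch_A2 F nu z + n%:R * K).
Proof.
move=> Uz g1 Gam c0 cn.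
have G1 : G z = 1%:M by rewrite /G /patch_Ginv g1 invmx1.
rewrite patch_A2E// patch_HE//.
have E v : pd v (patch_defect F nu c) z = pd v (flow_defect e F nu G c) z.
  by apply: (eq_pd oU Uz) => y Uy; exact: patch_defectE.
have E2 v : pd v (pd v (patch_defect F nu c)) z = pd v (pd v (flow_defect e F nu G
  c)) z.
  by apply: (eq_pd oU Uz) => y Uy; apply: (eq_pd oU Uy) => y' Uy'; exact: patch_defectE.
rewrite E; under eq_bigr => k _ do rewrite E2.
apply: (evolution_pinching oU sF snu patch_Ginv_smooth (patch_sphere P) patch_nunu _
  _ _ patch_Ft Uz _ Gam _ c0 cn).
- by move=> x Ux; rewrite dotC patch_nuF.
- by move=> x i Ux; exact: patch_nuF1.
- by move=> x i l Ux; exact: patch_Gg.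
- by move=> i j; rewrite -(metric_slice oU sF Uz) g1 mxE.
move=> x y; rewrite (patch_parseval x y Uz); congr (_ + _ + _).
apply: eq_bigr => k _; rewrite -(sum_delta' (fun l => dot x (pd (e k) F z) *
  dot y (pd (e l) F z))).
by apply: eq_bigr => l _; rewrite G1 mxE.
Qed.

End Theory.

End Patch.

(** * Linear coordinates as smooth functions; derivative tests at a maximum *)

Section MoreCalculus.
Context {R : realType}.

Lemma coordinate_derive (V : normedModType R) (I : finType) (e : I -> V) c
  (ec : coordinates e c) i v x : is_derive x v (c i) (c i v).
Proof.
have c0 : c i 0 = 0.
  have := coordinates_linear ec i (-1) 0 0.
  by rewrite scaler0 addr0 => h; apply/eqP; move: h; move: (c i 0) => y h; apply/eqP;
    lra.
have E : \forall h \near 0^', h^-1 *: ((c i \o shift x) (h *: v) - c i x) = c i v.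
  near=> h; rewrite /= (coordinates_linear ec) addrK scalerA mulVf ?scale1r//.
  by near: h; exact: nbhs_dnbhs_neq.
have L : (fun h => h^-1 *: ((c i \o shift x) (h *: v) - c i x)) @ 0^' --> c i v.
  by apply: cvg_near_cst.
split; first by apply/cvg_ex; exists (c i v).
exact/cvg_lim.
Unshelve. all: by end_near. Qed.

Lemma coordinate_continuous (V : normedModType R) (I : finType) (e : I -> V) c
  (ec : coordinates e c) i : continuous (c i).
Proof.
move=> x; apply/cvgrPdist_lt => eps eps0; near=> y.
have -> : c i x - c i y = c i (x - y).
  have := coordinates_linear ec i (-1) y x; rewrite scaleN1r [- y + x]addrC => ->.
  by rewrite mulN1r addrC.
apply: le_lt_trans (coordinates_le ec i _) _.
by near: y; exact: near_dist.
Unshelve. all: by end_near. Qed.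

Lemma coordinate_smooth (V : normedModType R) (I : finType) (e : I -> V) c
  (ec : coordinates e c) i (U : set V) : smooth U (c i).
Proof.
case=> [|k]; first by split=> // x _; apply: (coordinate_continuous ec).
split; first by move=> x _; apply: (coordinate_continuous ec).
move=> v; split.
  by move=> x _; exact: (@ex_derive _ _ _ _ _ _ _ (coordinate_derive ec i v x)).
have -> : 'D_v (c i) = cst (c i v).
  by apply/funext => x; rewrite (@derive_val _ _ _ _ _ _ _ (coordinate_derive ec i v
    x)).
exact: Ck_cst.
Qed.

Lemma pd_coordinate (V : normedModType R) (I : finType) (e : I -> V) c
  (ec : coordinates e c) i v x : pd v (c i) x = c i v.
Proof. by rewrite pdE (@derive_val _ _ _ _ _ _ _ (coordinate_derive ec i v x)). Qed.

(** The second difference based at [z - s v] is [f (z + s v) - 2 f z + f (z - s v)], which is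
    nonpositive at a maximum along the line. It is also [s ^+ 2] times a second derivative at a
    nearby point, positive by continuity if the one at [z] were. *)
Lemma second_derivative_test (V : normedModType R) (U : set V) (f : V -> R) z v :
  open U -> U z -> Ck 2 U f ->
  (\forall s \near (0 : R), f (z + s *: v) <= f z) -> 'D_v ('D_v f) z <= 0.
Proof.
move=> oU Uz [cf Df] hmax; rewrite leNgt; apply/negP => A0.
have [dv [_ Dv]] := Df v; have [dvv [cvv _]] := Dv v.
have N : \forall y \near z, U y /\ 0 < 'D_v ('D_v f) y.
  have /cvgrPdist_lt/(_ _ A0) h := cvv z Uz.
  apply: filter_app h; near=> y => h; split; first by near: y; exact: open_near.
  by move: h; move: ('D_v ('D_v f) y) ('D_v ('D_v f) z) => a b; rewrite ltr_norml =>
    /andP[]; lra.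
have [d d0 Pd] := near_square v v N.
move/nbhs_ballP : hmax => [r /= r0 rP].
pose s := Num.min (d / 2) (r / 2).
have s0 : 0 < s by rewrite lt_min !divr_gt0.
have sd : 2 * s <= d by have : s <= d / 2 by [rewrite ge_min lexx]; lra.
have sr : s < r by have : s <= r / 2 by [rewrite ge_min lexx orbT]; lra.
have ns : `|s| = s by rewrite gtr0_norm.
have P a b : `|a| <= `|s| -> `|b| <= `|s| ->
    U (z - s *: v + a *: v + b *: v) /\ 0 < 'D_v ('D_v f) (z - s *: v + a *: v +
      b *: v).
  rewrite ns => ha hb; rewrite -[- (s *: v)]scaleNr -(addrA z) -scalerDl; apply: Pd.
    by apply: le_trans (ler_normD _ _) _; rewrite normrN ns; lra.
  by apply: le_trans hb _; lra.
have [||a [b [ha hb E]]] := @second_difference R V f (z - s *: v) v v s.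
- by move=> a b ha hb; apply: dv; have [] := P a b ha hb.
- by move=> a b ha hb; apply: dvv; have [] := P a b ha hb.
have [_ D0] := P a b ha hb.
move: E; rewrite subrK => E.
have h1 : f (z + s *: v) <= f z.
  by apply: rP; rewrite -ball_normE /ball_/= sub0r normrN ns.
have h2 : f (z - s *: v) <= f z.
  by rewrite -scaleNr; apply: rP; rewrite -ball_normE /ball_/= sub0r normrN normrN ns.
have := mulr_gt0 (exprn_gt0 2 s0) D0; rewrite -E.
by move: (f (z + _)) (f (z - _)) (f z) h1 h2; clear => x y w; lra.
Unshelve. all: by end_near. Qed.

(** A comparison with earlier times already determines the sign, so a maximum at the final time is
    covered. *)
Lemma derive_left_max (g : R -> R) (t dg : R) : is_derive t 1 g dg ->
  (\forall s \near t, s <= t -> g s <= g t) -> 0 <= dg.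
Proof.
move=> [dg1 dg2] hmax; rewrite leNgt; apply/negP => dg0.
have e0 : 0 < - dg by rewrite oppr_gt0.
move: dg1; rewrite /derivable => dg1.
have L : (fun h : R => h^-1 *: ((g \o shift t) (h *: 1) - g t)) @ 0^' --> dg.
  by rewrite -dg2; exact: dg1.
have /cvgrPdist_lt/(_ _ e0)/nbhs_ballP[r /= r0 rP] := L.
move/nbhs_ballP : hmax => [r' /= r'0 rP'].
pose h := - (Num.min r r' / 2).
have m0 : 0 < Num.min r r' by rewrite lt_min r0.
have h0 : h < 0 by rewrite oppr_lt0 divr_gt0.
have nh : `|h| = Num.min r r' / 2 by rewrite normrN gtr0_norm// divr_gt0.
have hr : `|h| < r.
  by rewrite nh; have : Num.min r r' <= r by [rewrite ge_min lexx]; lra.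
have hr' : `|h| < r'.
  by rewrite nh; have : Num.min r r' <= r' by [rewrite ge_min lexx orbT]; lra.
have := rP h; rewrite -ball_normE /ball_/= sub0r normrN => /(_ hr (negbT (lt_eqF h0))).
have : g (h + t) <= g t.
  apply: rP'; last by rewrite gerDr ltW.
  by rewrite -ball_normE /ball_/= opprD addrCA subrr addr0 normrN.
rewrite [h *: 1]mulr1 => gh; rewrite ltr_norml => /andP[+ _].
have : 0 <= h^-1 *: (g (h + t) - g t).
  by rewrite nmulr_rge0 ?invr_lt0// subr_le0.
by move: (h^-1 *: _) => q; lra.
Qed.

End MoreCalculus.

(** * Time-independent changes of coordinates in a patch *)

Section PatchReparam.
Context {R : realType} {n : nat} (K : R).
Let V := ('rV[R]_n * R)%type.
Context (U : set V) (F nu : V -> 'rV[R]_n.+2) (P : mcf_patch K U F nu).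
Context (phi : 'rV[R]_n -> 'rV[R]_n) (sphi : smooth [set: 'rV[R]_n] phi).

Definition reparam (z : V) : V := (phi z.1, z.2).

(** [phi] is only required to be smooth, so the new patch is cut down to the points where its
    jacobian is invertible; elsewhere the composition might not be an immersion. *)
Definition reparam_domain : set V :=
  [set z | 'J phi z.1 \in unitmx] `&` (reparam @^-1` U).

Let sphi_ij i : smooth [set: 'rV[R]_n] (fun u => phi u 0 i).
Proof. by move/(smooth_mxP openT) : sphi; apply. Qed.

Let ec := @row_real_coordinates R n.
Let rc := @row_coordinates R n.

Let reparam_smooth i : smooth [set: V]
  (fun z => if i is Some j then (reparam z).1 0 j else (reparam z).2).
Proof.
case: i => [j|]; last exact: (coordinate_smooth ec None).
have s1 k : smooth [set: V] (fun z : V => z.1 0 k) by exact: (coordinate_smooth ec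
  (Some k)).
have sphi' : smooth [set: V] (fun z : V => phi z.1).
  exact: (smooth_comp rc openT openT (fun _ _ => I) s1 sphi).
exact: (iffLR (smooth_mxP openT _) sphi' 0 j).
Qed.

Lemma reparam_continuous : continuous reparam.
Proof.
by move=> z; apply: (continuous_coordinates ec) => i; have [] :=
  reparam_smooth i 0%N; apply.
Qed.

Let det_continuous : continuous (fun u => \det ('J phi u)).
Proof.
move=> u; have sJ : smooth [set: 'rV[R]_n]
    (fun u => \matrix_(i, j) pd (delta_mx 0 i) (fun u => phi u 0 j) u : 'M[R]_n).
  apply/(smooth_mxP openT) => i j.
  by apply: (smooth_eq openT _ (smooth_D (delta_mx 0 i) (sphi_ij j))) => v _;
    rewrite mxE.
have JE v : 'J phi v = \matrix_(i, j) pd (delta_mx 0 i) (fun u => phi u 0 j) v.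
  apply/matrixP => i j; rewrite [RHS]mxE; transitivity (row i ('J phi v) 0 j);
    first by rewrite [RHS]mxE.
  rewrite (row_jacobian_pd i openT sphi I) !pdE.
  by rewrite (derive_mxE 0 j (smooth_derivable sphi I)).
have -> : (fun u => \det ('J phi u)) = (fun u => \det (\matrix_(i,
  j) pd (delta_mx 0 i) (fun u => phi u 0 j) u)).
  by apply/funext => v; rewrite JE.
by have [cd _] := Ck_det openT (sJ 0%N); exact: cd.
Qed.

Lemma reparam_domain_open : open reparam_domain.
Proof.
apply: openI; last first.
  by apply: open_comp (patch_open P) => z _; exact: reparam_continuous.
have [D DE] : exists D : 'rV[R]_n -> R, D = (fun u => \det ('J phi u)).
  by exists (fun u => \det ('J phi u)).
have uE u : ('J phi u \in unitmx) = (D u != 0) by rewrite unitmxE unitfE DE.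
have cD : continuous D by rewrite DE; exact: det_continuous.
clear DE; rewrite openE => z /= Jz; rewrite uE in Jz.
have cfst : {for z, continuous (fst : V -> 'rV[R]_n)} by exact: cvg_fst.
have cDz := @continuous_comp _ _ _ (fst : V -> 'rV[R]_n) D z cfst (cD z.1).
have e0 : 0 < `|D z.1| by rewrite normr_gt0.
have /cvgrPdist_lt/(_ _ e0) h := cDz.
apply: filter_app h; near=> y => h; rewrite /= uE; apply/eqP => y0.
by move: h; rewrite /= y0 subr0 ltxx.
Unshelve. all: by end_near. Qed.

Let slices z (Uz : reparam_domain z) :
  [/\ open [set u | U (u, z.2)], open [set u | reparam_domain (u, z.2)],
      smooth [set u | U (u, z.2)] (slice F z.2) &
      smooth [set u | reparam_domain (u, z.2)] phi].
Proof.
split.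
- exact: (slice_open (patch_open P)).
- exact: (slice_open reparam_domain_open).
- exact: (smooth_slice z.2 (patch_smooth P)).
- by move=> k; apply: Ck_subset (sphi k) => u _.
Qed.

Let F' := fun z => F (reparam z).
Let nu' := fun z => nu (reparam z).

Let phiU t u : [set u | reparam_domain (u, t)] u -> [set u | U (u, t)] (phi u).
Proof. by case. Qed.

Let F'E t u : [set u | reparam_domain (u, t)] u -> slice F' t u = slice F t (phi u).
Proof. by []. Qed.

Let point z : reparam_domain z -> [set u | reparam_domain (u, z.2)] z.1.
Proof. by case: z. Qed.

Lemma reparam_jacobian z : reparam_domain z ->
  'J (slice F' z.2) z.1 = 'J phi z.1 *m 'J (slice F z.2) (phi z.1).
Proof.
move=> Uz; have [oO oW sF sp] := slices Uz.
exact: (jacobian_reparam oO oW sF sp (@phiU z.2) (@F'E z.2) (point Uz)).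
Qed.

Lemma reparam_free z : reparam_domain z -> row_free ('J (slice F' z.2) z.1).
Proof.
move=> Uz; rewrite (reparam_jacobian Uz); case: (Uz) => Ju /(patch_free P) fF.
apply: row_free_mulP => v; rewrite mulmxA => vJ.
have : v *m 'J phi z.1 = 0 by apply: (row_free_inj fF); rewrite mul0mx.
by move=> /(congr1 (mulmx^~ (invmx ('J phi z.1))));
  rewrite -mulmxA mulmxV// mulmx1 mul0mx.
Qed.

Let nu_normal z : reparam_domain z -> unit_normal (slice F z.2) (phi z.1) (nu' z).
Proof. by case=> _ /(patch_normal P). Qed.

Lemma reparam_H z : reparam_domain z -> patch_H K F' nu' z = patch_H K F nu (reparam z).
Proof.
move=> Uz; have [oO oW sF sp] := slices Uz.
exact: (mean_curvature_reparam oO oW K sF sp (@phiU z.2) (@F'E z.2) (point Uz)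
  (reparam_free Uz) (nu_normal Uz)).
Qed.

Lemma reparam_A2 z : reparam_domain z -> patch_A2 K F' nu' z =
  patch_A2 K F nu (reparam z).
Proof.
move=> Uz; have [oO oW sF sp] := slices Uz.
exact: (normsq_reparam oO oW K sF sp (@phiU z.2) (@F'E z.2) (point Uz)
  (reparam_free Uz) (nu_normal Uz)).
Qed.

Lemma reparam_time z : 'D_time_dir F' z = 'D_time_dir F (reparam z).
Proof.
rewrite /derive; set g1 := fun h => h^-1 *: _; set g2 := fun h => h^-1 *: _.
suff -> : g1 = g2 by [].
apply/funext => h; rewrite /g1 /g2 /F' /=; congr (_ *: (F _ - _)).
by rewrite /reparam; apply: injective_projections => //=; rewrite scaler0 !add0r.
Qed.

Let map_smooth d (f : V -> 'rV[R]_d) : smooth U f -> smooth reparam_domain (fun z =>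
  f (reparam z)).
Proof.
move=> sf; apply: (smooth_comp ec (patch_open P) reparam_domain_open _ _ sf).
  by move=> z [].
by move=> i k; apply: Ck_subset (reparam_smooth i k) => z _.
Qed.

Lemma patch_reparam : mcf_patch K reparam_domain F' nu'.
Proof.
split.
- exact: reparam_domain_open.
- exact: map_smooth (patch_smooth P).
- exact: map_smooth (patch_normal_smooth P).
- by move=> z [_ Uz]; exact: (patch_sphere P Uz).
- exact: reparam_free.
- move=> z Uz; have [oO oW sF sp] := slices Uz.
  by apply/(unit_normal_reparam oO oW sF sp (@phiU z.2) (@F'E z.2) (point Uz) (nu' z)
    (reparam_free Uz)); exact: nu_normal.
- move=> z Uz; rewrite reparam_time (patch_flow P Uz.2).
  exact: (congr1 (fun a => a *: nu (reparam z)) (esym (reparam_H Uz))).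
Qed.

End PatchReparam.

(** * Normal coordinates *)

Section QuadraticMap.
Context {R : realType} {n : nat}.
Variables (u0 : 'rV[R]_n) (L : 'M[R]_n) (q : 'I_n -> 'I_n -> 'rV[R]_n).
Let e (i : 'I_n) : 'rV[R]_n := delta_mx 0 i.
Let rc := @row_coordinates R n.

(** The 2-jet at 0 is prescribed: [L] is the differential and, thanks to the factor [2^-1], a
    symmetric [q] is the second derivative. *)
Definition quadratic_map (v : 'rV[R]_n) : 'rV[R]_n :=
  u0 + v *m L + 2^-1 *: \sum_i \sum_j (v 0 i * v 0 j) *: q i j.

Let x (i : 'I_n) (v : 'rV[R]_n) : R := v 0 i.
Let sx i : smooth [set: 'rV[R]_n] (x i). Proof. exact: (coordinate_smooth rc). Qed.
Let pdx k i v : pd (e k) (x i) v = (k == i)%:R.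
Proof. by rewrite (pd_coordinate rc) mxE eqxx eq_sym. Qed.

Let A a (v : 'rV[R]_n) : R := \sum_i x i v * L i a.
Let C a (v : 'rV[R]_n) : R := \sum_i \sum_j (x i v * x j v) * q i j 0 a.

Let quadratic_mapE a : (fun v => quadratic_map v 0 a) =
  (fun v => (u0 0 a + A a v) + 2^-1 * C a v).
Proof.
apply/funext => v; rewrite !mxE; congr (_ + _ + _ * _).
rewrite summxE; apply: eq_bigr => i _; rewrite summxE; apply: eq_bigr => j _.
by rewrite mxE.
Qed.

Let sc (c : R) : smooth [set: 'rV[R]_n] (fun _ => c). Proof. exact: smooth_cst. Qed.
Let sxc i (c : R) : smooth [set: 'rV[R]_n] (fun v => x i v * c).
Proof. exact: (smoothM openT (sx i) (sc c)). Qed.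
Let sA a : smooth [set: 'rV[R]_n] (A a).
Proof. exact: (smooth_sum openT _ (fun i => sxc i (L i a))). Qed.
Let sxx i j : smooth [set: 'rV[R]_n] (fun v => x i v * x j v).
Proof. exact: (smoothM openT (sx i) (sx j)). Qed.
Let sxxq i j (c : R) : smooth [set: 'rV[R]_n] (fun v => x i v * x j v * c).
Proof. exact: (smoothM openT (sxx i j) (sc c)). Qed.
Let sC1 i a : smooth [set: 'rV[R]_n] (fun v => \sum_j (x i v * x j v) * q i j 0 a).
Proof. exact: (smooth_sum openT _ (fun j => sxxq i j (q i j 0 a))). Qed.
Let sC a : smooth [set: 'rV[R]_n] (C a).
Proof. exact: (smooth_sum openT _ (fun i => sC1 i a)). Qed.

Lemma quadratic_map_smooth : smooth [set: 'rV[R]_n] quadratic_map.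
Proof.
apply/(smooth_mxP openT) => i a; rewrite ord1 quadratic_mapE.
exact: (smoothD openT (smoothD openT (sc (u0 0 a)) (sA a)) (smoothM openT (sc 2^-1)
  (sC a))).
Qed.

Lemma quadratic_map0 : quadratic_map 0 = u0.
Proof.
rewrite /quadratic_map mul0mx addr0 big1 ?scaler0 ?addr0// => i _.
by rewrite big1// => j _; rewrite mxE mul0r scale0r.
Qed.

Let s1 a := smoothD openT (sc (u0 0 a)) (sA a).
Let s2 a := smoothM openT (sc 2^-1) (sC a).

Lemma pd_quadratic_map k a : pd (e k) (fun v => quadratic_map v 0 a) 0 = L k a.
Proof.
rewrite quadratic_mapE (pdD I (e k) (s1 a) (s2 a)) (pdD I (e k) (sc (u0 0 a)) (sA a)).
rewrite (pdM I (e k) (sc 2^-1) (sC a)) !pd_cst mul0r !add0r.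
rewrite (pd_sum openT I (e k) _ (fun i => sxc i (L i a))).
rewrite (pd_sum openT I (e k) _ (fun i => sC1 i a)).
rewrite [X in _ + _ * X]big1 => [|i _]; last first.
  rewrite (pd_sum openT I (e k) _ (fun j => sxxq i j (q i j 0 a))) big1// => j _.
  rewrite (pdM I (e k) (sxx i j) (sc (q i j 0 a))) (pdM I (e k) (sx i) (sx j)) pd_cst.
  by rewrite /x !mxE; ring.
rewrite mulr0 addr0 -(sum_delta' (fun i => L i a)); apply: eq_bigr => i _.
by rewrite (pdM I (e k) (sx i) (sc (L i a))) pdx pd_cst mulr0 addr0.
Qed.

Let pd2_cst l k (c : R) : pd (e l) (pd (e k) (fun _ : 'rV[R]_n => c)) 0 = 0.
Proof. by rewrite (eq_pd openT I (e l) (fun y _ => pd_cst c (e k) y)) pd_cst. Qed.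

Let pd2D l k (a b : 'rV[R]_n -> R) : smooth [set: 'rV[R]_n] a ->
  smooth [set: 'rV[R]_n] b ->
  pd (e l) (pd (e k) (fun v => a v + b v)) 0 = pd (e l) (pd (e k) a) 0 +
    pd (e l) (pd (e k) b) 0.
Proof.
move=> sa sb; rewrite (eq_pd openT I (e l) (fun y _ => pdD (x := y) I (e k) sa sb)).
by rewrite (pdD I (e l) (smooth_D (e k) sa) (smooth_D (e k) sb)).
Qed.

Let pd2x l k i : pd (e l) (pd (e k) (x i)) 0 = 0.
Proof. by rewrite (eq_pd openT I (e l) (fun y _ => pdx k i y)) pd_cst. Qed.

Lemma pd2_quadratic_map l k a : (forall i j, q i j = q j i) ->
  pd (e l) (pd (e k) (fun v => quadratic_map v 0 a)) 0 = q l k 0 a.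
Proof.
move=> qsym; rewrite quadratic_mapE (pd2D l k (s1 a) (s2 a)) (pd2D l k (sc (u0 0 a))
  (sA a)).
rewrite (pd2M openT I (e l) (e k) (sc 2^-1) (sC a)) !pd2_cst !pd_cst !mul0r !add0r.
rewrite (pd2_sum openT I (e l) (e k) _ (fun i => sxc i (L i a))) big1 => [|i _];
  last first.
  by rewrite (pd2M openT I (e l) (e k) (sx i) (sc (L i a))) pd2x pd2_cst !pd_cst
    !mulr0 mul0r !addr0.
rewrite add0r (pd2_sum openT I (e l) (e k) _ (fun i => sC1 i a)).
have T i j : pd (e l) (pd (e k) (fun v => x i v * x j v * q i j 0 a)) 0 =
   (k == i)%:R * ((l == j)%:R * q i j 0 a) + (l == i)%:R * ((k == j)%:R * q i j 0 a).
  rewrite (pd2M openT I (e l) (e k) (sxx i j) (sc (q i j 0 a))) pd2_cst !pd_cst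
    !mulr0 !addr0.
  rewrite (pd2M openT I (e l) (e k) (sx i) (sx j)) !pd2x !pdx; ring.
under eq_bigr => i _.
  rewrite (pd2_sum openT I (e l) (e k) _ (fun j => sxxq i j (q i j 0 a))).
  under eq_bigr => j _ do rewrite T.
  rewrite big_split -!mulr_sumr !sum_delta' /=.
  over.
rewrite big_split /= !sum_delta' (qsym k l); move: (q l k 0 a) => y.
by field.
Qed.

End QuadraticMap.

(** * Maximum principle in a patch *)

Section NormalCoordinates.
Context {R : realType} {n : nat}.
Let e (i : 'I_n) : 'rV[R]_n := delta_mx 0 i.

Lemma normal_coordinates (O : set 'rV[R]_n) (f : 'rV[R]_n -> 'rV[R]_n.+2) u0 :
  open O -> smooth O f -> O u0 -> row_free ('J f u0) ->
  exists phi : 'rV[R]_n -> 'rV[R]_n,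
    [/\ smooth [set: 'rV[R]_n] phi, phi 0 = u0, 'J phi 0 \in unitmx,
       metric (fun v => f (phi v)) 0 = 1%:M
     & forall i j k, dot (pd (e i) (pd (e j) (fun v => f (phi v))) 0)
         (pd (e k) (fun v => f (phi v)) 0) = 0].
Proof.
move=> oO sf Ou0 fE.
(* [L] makes the metric the identity, [q] kills the Christoffel symbols. *)
have [L LE] := orthonormalize fE.
set E' := L *m 'J f u0 in LE.
have uL : L \in unitmx.
  by move: LE; rewrite /E' -mulmxA => /mulmx1_unit[].
pose S i j : 'rV[R]_n.+2 := \sum_a \sum_b (L i b * L j a) *: pd (e b) (pd (e a) f) u0.
(* [S i j] is the second derivative of the composition with the linear part of the map. The
   quadratic part adds [q i j *m 'J f u0 = - S i j *m E'^T *m E'], minus the orthogonal projection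
   of [S i j] onto the tangent space, as the rows of [E'] are orthonormal. Only the normal part is
   left. *)
pose q i j : 'rV[R]_n := - (S i j *m E'^T *m L).
have Ssym i j : S i j = S j i.
  rewrite /S exchange_big; apply: eq_bigr => b _; apply: eq_bigr => a _.
  by rewrite mulrC (smooth_schwarz oO Ou0 (e b) (e a) sf).
have qsym i j : q i j = q j i by rewrite /q Ssym.
pose phi := quadratic_map u0 L q.
have sphi : smooth [set: 'rV[R]_n] phi by exact: quadratic_map_smooth.
have phi0 : phi 0 = u0 by exact: quadratic_map0.
pose W := phi @^-1` O.
have cphi : continuous phi by move=> v; have [+ _] := sphi 0%N; apply.
have oW : open W by apply: open_comp oO => v _; exact: cphi.
have sphiW : smooth W phi by move=> k; apply: Ck_subset (sphi k) => v _.
have W0 : W 0 by rewrite /W /= phi0.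
have phiO v : W v -> O (phi v) by [].
pose f' := fun v => f (phi v).
have f'E v : W v -> f' v = f (phi v) by [].
have JE : 'J phi 0 = L.
  by apply/matrixP => i a; rewrite (jacobianE oW sphiW i a W0) pd_quadratic_map.
have Jf' : 'J f' 0 = E'.
  by rewrite (jacobian_reparam oO oW sf sphiW phiO f'E W0) JE phi0.
have sf' : smooth W f'.
  have sphi_i i : smooth W (fun v => phi v 0 i) by move/(smooth_mxP oW) : sphiW; apply.
  exact: (smooth_comp (row_coordinates n) oO oW phiO sphi_i sf).
exists phi; split => //.
- by rewrite JE.
- by rewrite /metric -/f' Jf'.
move=> i j k; rewrite -/f' -(row_jacobian_pd k oW sf' W0) Jf'.
rewrite (dot_pd2_reparam oO oW sf sphiW phiO f'E i j (row k E') W0) phi0.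
rewrite big_split /=.
have -> : \sum_a pd (e i) (pd (e j) (fun y => phi y 0 a)) 0 *
  dot (pd (e a) f u0) (row k E') =
    dot (q i j *m 'J f u0) (row k E').
  rewrite dot_mulmx; apply: eq_bigr => a _.
  by rewrite pd2_quadratic_map// (row_jacobian_pd a oO sf Ou0).
have -> : \sum_a pd (e j) (fun y => phi y 0 a) 0 *
    (\sum_b pd (e i) (fun y => phi y 0 b) 0 * dot (pd (e b) (pd (e a) f) u0) (row k
      E')) =
    dot (S i j) (row k E').
  rewrite /S dot_suml; apply: eq_bigr => a _; rewrite dot_suml mulr_sumr.
  by apply: eq_bigr => b _; rewrite !pd_quadratic_map dotZl; ring.
have -> : q i j *m 'J f u0 = - (S i j *m E'^T *m E').
  by rewrite /q mulNmx -(mulmxA _ L).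
rewrite dotNl dot_mulmx; apply/eqP; rewrite addrC subr_eq0; apply/eqP.
transitivity ((S i j *m E'^T) 0 k).
  by rewrite mxE dotE; apply: eq_bigr => l _; rewrite !mxE.
rewrite -[LHS](sum_delta (fun l => (S i j *m E'^T) 0 l)); apply: eq_bigr => l _.
by rewrite -gramE LE [1%:M _ _]mxE mulrC.
Qed.

End NormalCoordinates.

Section PatchMax.
Context {R : realType} {n : nat} (K : R) (K_gt0 : 0 < K).
Let V := ('rV[R]_n * R)%type.
Let e := @space_dir R n.

Lemma time_nbhs (Q : V -> Prop) (u : 'rV[R]_n) (t : R) :
  (\forall z \near (u, t), Q z) -> \forall s \near t, Q (u, s).
Proof.
move=> /nbhs_ballP[r /= r0 rQ]; apply/nbhs_ballP; exists r => // v vr.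
by apply: rQ; split=> //=; exact: ballxx.
Qed.

(** In normal coordinates at [z] the Laplacian of the defect is nonpositive by the maximum over the
    time slice, so the evolution inequality bounds its time derivative by the reaction terms. The
    maximum of the exponentially weighted function over earlier times bounds that derivative below
    by [l] times the defect minus [b]. *)
Lemma patch_max (U : set V) (F nu : V -> 'rV[R]_n.+2) (P : mcf_patch K U F nu)
    (z : V) (Uz : U z) (c b l : R) : 0 <= c -> c * n.+2%:R <= 3 ->
  (\forall y \near z, y.2 <= z.2 ->
     expR (- l * y.2) * (patch_defect K F nu c y - b) <=
     expR (- l * z.2) * (patch_defect K F nu c z - b)) ->
  l * (patch_defect K F nu c z - b) <=
  2 * patch_A2 K F nu z ^+ 2 + 4 * K * patch_H K F nu z ^+ 2 - 2 * n%:R * K *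
    patch_A2 K F nu z
  - 2 * c * patch_H K F nu z ^+ 2 * (patch_A2 K F nu z + n%:R * K).
Proof.
move=> c0 cn hmax.
have Uz' : [set u | U (u, z.2)] z.1 by case: z Uz {hmax}.
have [phi [sphi phi0 Jphi g1 Gam]] := normal_coordinates (slice_open (patch_open P))
  (smooth_slice z.2 (patch_smooth P)) Uz' (patch_free P Uz).
have P' := patch_reparam P sphi.
set F' := (fun _ => F _) in P'; set nu' := (fun _ => nu _) in P'.
set U' := reparam_domain U phi in P'.
pose z' : V := (0, z.2).
have rz : reparam phi z' = z by rewrite /reparam /z' /= phi0;
  case: z {Uz hmax Uz' phi0 g1 Gam z'}.
have Uz1 : U' z' by split; [exact: Jphi | rewrite /= rz].
have oU' := patch_open P'.
have D'E y : U' y -> patch_defect K F' nu' c y = patch_defect K F nu c (reparam phi y).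
  by move=> Uy; rewrite /patch_defect (reparam_A2 P sphi Uy) (reparam_H P sphi Uy).
have hmax' : \forall y \near z', y.2 <= z.2 ->
     expR (- l * y.2) * (patch_defect K F' nu' c y - b) <=
     expR (- l * z.2) * (patch_defect K F' nu' c z' - b).
  have cr : reparam phi @ z' --> z by rewrite -rz; exact: (reparam_continuous sphi).
  have {}hmax : \forall y \near z', y.2 <= z.2 ->
     expR (- l * y.2) * (patch_defect K F nu c (reparam phi y) - b) <=
     expR (- l * z.2) * (patch_defect K F nu c z - b) by exact: cr _ hmax.
  apply: filter_app hmax; apply: filter_app (open_near oU' Uz1); near=> y => Uy hy y2.
  by rewrite (D'E _ Uy) (D'E _ Uz1) rz; exact: hy y2.
have sD := patch_defect_smooth P' K_gt0 c.
have ev : pd time_dir (patch_defect K F' nu' c) z' <=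
    2 * patch_A2 K F nu z ^+ 2 + 4 * K * patch_H K F nu z ^+ 2 - 2 * n%:R * K *
      patch_A2 K F nu z
    - 2 * c * patch_H K F nu z ^+ 2 * (patch_A2 K F nu z + n%:R * K).
  have Gam' i j k : dot (pd (e i) (pd (e j) F') z') (pd (e k) F' z') = 0.
    have := Gam i j k; rewrite -[fun v => _]/(slice F' z.2) !pd_slice.
    by apply.
  have := patch_evolution P' K_gt0 Uz1 g1 Gam' c0 cn.
  rewrite (reparam_A2 P sphi Uz1) (reparam_H P sphi Uz1) rz.
  apply: le_trans; rewrite lerDl oppr_ge0; apply: sumr_le0 => k _.
  rewrite !pd_fE; apply: (second_derivative_test oU' Uz1 (sD 2%N)).
  have [d d0 Pd] := near_square (e k) (e k) hmax'.
  apply: filter_app (near_dist (0 : R) d0); near=> s; rewrite sub0r normrN => sd.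
  have := Pd s 0 (ltW sd); rewrite normr0 scale0r addr0 => /(_ (ltW d0)).
  have E2 : (z' + s *: e k).2 = z.2 by rewrite /= scaler0 addr0.
  by rewrite E2 => /(_ (lexx _)); rewrite ler_pM2l ?expR_gt0// lerD2r.
apply: le_trans ev; rewrite pdE.
pose o : V := (0, 0).
have oE s : o + s *: time_dir = (0, s) :> V.
  by apply: injective_projections => /=; rewrite ?scaler0 ?addr0// add0r [_ *: _]mulr1.
set f := patch_defect K F' nu' c in sD hmax' *.
have df : derivable f (o + z.2 *: time_dir) time_dir.
  by rewrite oE; exact: smooth_derivable sD Uz1.
have D1 := is_derive_line df; rewrite oE -/z' in D1.
have D2 : is_derive z.2 1 (fun s : R => - l * s) (- l).
  have D := is_deriveZ (- l) (is_derive_id z.2 (1 : R)).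
  by apply: (is_derive_eq D); rewrite [_ *: _]mulr1.
have D3 := is_derive1_comp (is_derive_expR (- l * z.2)) D2.
have D4 := is_deriveM D3 (is_deriveB D1 (is_derive_cst b z.2 (1 : R))).
have key : 0 <= expR (- l * z.2) * ('D_time_dir f z' - 0) +
    (f (o + z.2 *: time_dir) - b) * (expR (- l * z.2) * - l).
  apply: (derive_left_max D4).
  apply: filter_app (time_nbhs hmax'); near=> s => hs st.
  change (expR (- l * s) * (f (o + s *: time_dir) - b) <=
    expR (- l * z.2) * (f (o + z.2 *: time_dir) - b)).
  by rewrite !oE; exact: hs st.
rewrite oE -/z' subr0 in key.
have E0 := expR_gt0 (- l * z.2).
rewrite -rz -(D'E _ Uz1) -/f; move: key E0.
move: (expR _) (f z') ('D_time_dir f z') => w y p; clear => key E0.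
rewrite -(ler_pM2l E0) -subr_ge0; apply: le_trans key _.
by rewrite le_eqVlt; apply/orP; left; apply/eqP; ring.
Unshelve. all: by end_near. Qed.
End PatchMax.

(** * Charts of the manifold *)

Section UnitNormals.
Context {R : realType} {n : nat} (K : R) (K_gt0 : 0 < K).
Context (f : 'rV[R]_n -> 'rV[R]_n.+2) (u : 'rV[R]_n).
Hypothesis ff : dot (f u) (f u) = K^-1.
Hypothesis Jf : forall i, dot (row i ('J f u)) (f u) = 0.
Hypothesis J_free : row_free ('J f u).

Lemma unit_normal_unique nu nu' : unit_normal f u nu -> unit_normal f u nu' ->
  exists2 a : R, a ^+ 2 = 1 & nu' = a *: nu.
Proof.
move=> [nn fn Jn] [nn' fn' Jn']; exists (dot nu' nu); last first.
  apply/eqP; rewrite -subr_eq0; apply/eqP.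
  apply: (frame_orthogonal_eq0 K_gt0 J_free ff Jf nn fn Jn).
  - by rewrite dotC dotBl dotZl !(dotC _ (f u)) fn fn' mulr0 subr0.
  - by rewrite dotC dotBl dotZl nn mulr1 subrr.
  - by move=> i; rewrite dotC dotBl dotZl !(dotC _ (row _ _)) Jn Jn' mulr0 subr0.
have := parseval K_gt0 J_free ff Jf nn fn Jn nu' nu'.
rewrite nn' (dotC nu' (f u)) fn' !mulr0 addr0 big1 ?add0r ?expr2//.
by move=> k _; rewrite big1// => l _; rewrite !(dotC nu') Jn' mul0r mulr0.
Qed.

Lemma second_form_scale a nu : second_form K f u (a *: nu) = a *: second_form K f u nu.
Proof. by apply/matrixP => i j; rewrite !mxE dotZr. Qed.

Lemma mean_curvature_sqr nu nu' : unit_normal f u nu -> unit_normal f u nu' ->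
  mean_curvature K f u nu' ^+ 2 = mean_curvature K f u nu ^+ 2.
Proof.
move=> h h'; have [a a2 ->] := unit_normal_unique h h'.
have -> : mean_curvature K f u (a *: nu) = a * mean_curvature K f u nu.
  rewrite /mean_curvature second_form_scale mulr_sumr; apply: eq_bigr => i _.
  by rewrite mulr_sumr; apply: eq_bigr => j _; rewrite [X in _ * X = _]mxE mulrCA.
by rewrite exprMn a2 mul1r.
Qed.

Lemma normsq_unique nu nu' : unit_normal f u nu -> unit_normal f u nu' ->
  normsq_second_form K f u nu' = normsq_second_form K f u nu.
Proof.
move=> h h'; have [a a2 ->] := unit_normal_unique h h'.
rewrite /normsq_second_form second_form_scale.
do 4!(apply: eq_bigr => ? _); rewrite [X in _ * X * _ = _]mxE [X in _ * X = _]mxE.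
move: a2 (second_form K f u nu) => a2 h0.
by rewrite -[RHS]mul1r -a2; ring.
Qed.

End UnitNormals.

Section Flow.
Context {R : realType} {n : nat} {K : R} {M : topologicalType}.
Context {atlas : set (chart R n M)} {T : \bar R} {X : M -> R -> 'rV[R]_n.+2}.
Context (mf : smooth_manifold atlas) (flow : mean_curvature_flow K atlas T X) (K_gt0
  : 0 < K).
Let V := ('rV[R]_n * R)%type.

Lemma open_within_continuous (A B : topologicalType) (D : set A) (f : A -> B) x :
  open D -> {within D, continuous f} -> D x -> {for x, continuous f}.
Proof.
move=> oD /subspace_continuousP cf Dx; have := cf x Dx.
rewrite within_interior//; exact: open_near.
Qed.

(** At a fixed time the space-time extension from [mcf_smooth] agrees with the flow on an open set
    of coordinates, so slices are genuinely smooth even at time 0. *)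
Lemma chart_slice_smooth c t u : atlas c -> times T t -> (coord c @` dom c) u ->
  exists O, [/\ open O, O u, O `<=` coord c @` dom c & smooth O (in_chart X c t)].
Proof.
move=> ac Tt cu; have [|U [g [oU Uu sg gE]]] := mcf_smooth flow ac (x := (u, t)).
  by split.
pose O := [set v | U (v, t)] `&` (coord c @` dom c).
have oO : open O by apply: openI; [exact: slice_open | exact: image_open].
exists O; split => //; first by move=> v [].
apply: (smooth_eq oO (f := slice g t)).
  by move=> v [Uv cv]; exact: (gE (v, t)).
by move=> k; apply: Ck_subset (smooth_slice t sg k) => v [].
Qed.

(** Continuity of [param c] makes the coordinate image of the overlap a neighbourhood ([nD]); inside
    it, the smooth extension supplied by [atlas_smooth] is the transition map itself. *)
Lemma transition c c' p : atlas c -> atlas c' -> dom c p -> dom c' p ->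
  exists W (phi : 'rV[R]_n -> 'rV[R]_n), [/\ open W, W (coord c p), smooth W phi,
    phi (coord c p) = coord c' p &
    forall v, W v -> exists q, [/\ dom c q, dom c' q, v = coord c q & phi v =
      coord c' q]].
Proof.
move=> ac ac' cp c'p.
pose D := coord c @` (dom c `&` dom c').
have Du : D (coord c p) by exists p.
have [U [g [oU Uu sg gE]]] := atlas_smooth mf ac ac' Du.
have nD : nbhs (coord c p) D.
  have ci : (coord c @` dom c) (coord c p) by exists p.
  have cpar := open_within_continuous (@image_open _ _ _ c) (@param_continuous _ _ _
    c) ci.
  have n1 : nbhs (coord c p) (param c @^-1` dom c').
    by apply: cpar; rewrite coordK//; apply: open_near => //; exact: dom_open.
  have n2 : nbhs (coord c p) (coord c @` dom c) by exact: (open_near (@image_open _ _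
    _ c) ci).
  apply: filterS2 n1 n2 => v /= dv [q cq qv]; exists q => //; split=> //.
  by rewrite -(coordK cq) qv.
pose W := interior (D `&` U).
have W0 : W (coord c p) by exact: (filterI nD (open_near oU Uu)).
have sub : W `<=` D `&` U by exact: interior_subset.
exists W, g; split => //.
- exact: open_interior.
- by move=> k; apply: Ck_subset (sg k) => v /sub[].
- by rewrite gE//= coordK.
- move=> v /sub[[q [cq c'q] <-] Uq]; exists q; split=> //.
  by rewrite gE//=; [rewrite coordK | exists q].
Qed.

Lemma chart_reparam c c' p t nu : atlas c -> atlas c' -> dom c p -> dom c' p ->
  times T t ->
  unit_normal (in_chart X c t) (coord c p) nu ->
  [/\ unit_normal (in_chart X c' t) (coord c' p) nu,
    normsq_second_form K (in_chart X c t) (coord c p) nu =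
    normsq_second_form K (in_chart X c' t) (coord c' p) nu &
    mean_curvature K (in_chart X c t) (coord c p) nu =
    mean_curvature K (in_chart X c' t) (coord c' p) nu].
Proof.
move=> ac ac' cp c'p Tt cnu.
have [W0 [phi [oW0 W0u sphi0 phiu WE]]] := transition ac ac' cp c'p.
have [|O [oO Ou Oc sO]] := chart_slice_smooth ac' Tt (u := coord c' p).
  by exists p.
pose W := interior (W0 `&` phi @^-1` O).
have sub : W `<=` W0 `&` phi @^-1` O by exact: interior_subset.
have Wu : W (coord c p).
  apply: (filterI (open_near oW0 W0u)).
  have [+ _] := sphi0 0%N; move=> /(_ _ W0u); apply.
  by rewrite phiu; exact: (open_near oO Ou).
have oW : open W by exact: open_interior.
have sphi : smooth W phi by move=> k; apply: Ck_subset (sphi0 k) => v /sub[].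
have phiO v : W v -> O (phi v) by move=> /sub[].
have FE v : W v -> in_chart X c t v = in_chart X c' t (phi v).
  move=> /sub[/WE[q [cq c'q -> ->]] _].
  by rewrite /in_chart !coordK.
have Jfree := mcf_immersion flow ac cp Tt.
have c'nu := (iffLR (unit_normal_reparam oO oW sO sphi phiO FE Wu nu Jfree) cnu).
have E1 := normsq_reparam oO oW K sO sphi phiO FE Wu Jfree c'nu.
have E2 := mean_curvature_reparam oO oW K sO sphi phiO FE Wu Jfree c'nu.
by rewrite phiu in c'nu E1 E2; split.
Qed.

Lemma tangent_position c p t i : atlas c -> dom c p -> times T t ->
  dot (row i ('J (in_chart X c t) (coord c p))) (in_chart X c t (coord c p)) = 0.
Proof.
move=> ac cp Tt; have [|O [oO Ou Oc sO]] := chart_slice_smooth ac Tt (u := coord c p).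
  by exists p.
rewrite (row_jacobian_pd i oO sO Ou).
have FF v : O v -> dot (in_chart X c t v) (in_chart X c t v) = K^-1.
  by move=> /Oc[q cq <-]; rewrite /in_chart coordK//; exact: (mcf_sphere flow q Tt).
have E : pd (delta_mx 0 i) (fun v => dot (in_chart X c t v) (in_chart X c t v))
  (coord c p) = 0.
  by rewrite (eq_pd oO Ou _ FF) pd_cst.
move: E; rewrite (pd_dot oO Ou _ sO sO) (dotC (in_chart X c t (coord c p))).
by move: (dot _ _) => y E; lra.
Qed.

Lemma chart_position c p t : dom c p -> times T t ->
  dot (in_chart X c t (coord c p)) (in_chart X c t (coord c p)) = K^-1.
Proof. by move=> cp Tt; rewrite /in_chart coordK//; exact: (mcf_sphere flow p Tt). Qed.

(** This makes |A|^2 and H^2 functions on M x [0, T). H is determined only up to sign, hence the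
    square. *)
Lemma chart_independent c c' p t nu nu' : atlas c -> atlas c' -> dom c p -> dom c' p ->
  times T t ->
  unit_normal (in_chart X c t) (coord c p) nu ->
  unit_normal (in_chart X c' t) (coord c' p) nu' ->
  normsq_second_form K (in_chart X c t) (coord c p) nu =
    normsq_second_form K (in_chart X c' t) (coord c' p) nu' /\
  mean_curvature K (in_chart X c t) (coord c p) nu ^+ 2 =
    mean_curvature K (in_chart X c' t) (coord c' p) nu' ^+ 2.
Proof.
move=> ac ac' cp c'p Tt h h'.
have [c'nu -> ->] := chart_reparam ac ac' cp c'p Tt h.
have ff := chart_position c'p Tt.
have Jf i := tangent_position i ac' c'p Tt.
have Jfree := mcf_immersion flow ac' c'p Tt.
split; first by rewrite (normsq_unique K_gt0 ff Jf Jfree c'nu h').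
by rewrite (mean_curvature_sqr K_gt0 ff Jf Jfree c'nu h').
Qed.

Lemma unit_normal_exists c p t : exists nu, unit_normal (in_chart X c t) (coord c p) nu.
Proof.
have [nu [h1 h2 h3]] := exists_unit_orthogonal ('J (in_chart X c t) (coord c p))
  (in_chart X c t (coord c p)).
by exists nu.
Qed.

End Flow.

Lemma open_setI_preimage (A B : topologicalType) (U : set A) (D : set B) (f : A -> B) :
  open U -> (forall x, U x -> {for x, continuous f}) -> open D ->
  open (U `&` f @^-1` D).
Proof.
move=> oU cf oD; rewrite openE => x [Ux Dfx].
by apply: (filterI (open_near oU Ux)); apply: (cf x Ux); exact: (open_near oD Dfx).
Qed.

(** * Curvatures of smooth extensions and a local unit normal, up to time 0 *)

Section FormSmooth.
Context {R : realType} {n : nat} (K : R).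
Let V := ('rV[R]_n * R)%type.
Let e := @space_dir R n.
Context (U : set V) (oU : open U) (g nu : V -> 'rV[R]_n.+2).
Hypothesis sg : smooth U g.
Hypothesis snu : smooth U nu.

Definition slice_gram (z : V) : 'M[R]_n := \matrix_(i,
  j) dot (pd (e i) g z) (pd (e j) g z).

Lemma slice_gram_smooth : smooth U slice_gram.
Proof.
apply/(smooth_mxP oU) => i j.
have E z : U z -> dot (pd (e i) g z) (pd (e j) g z) = slice_gram z i j by rewrite mxE.
exact: (smooth_eq oU E (smooth_dot oU (smooth_D (e i) sg) (smooth_D (e j) sg))).
Qed.

Lemma metric_slice_gram z : U z -> metric (slice g z.2) z.1 = slice_gram z.
Proof. by move=> Uz; apply/matrixP => i j; rewrite (metric_slice oU sg Uz) mxE. Qed.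

Hypothesis gram_inv : forall z, U z -> slice_gram z \in unitmx.

Let h i j (z : V) : R := second_form K (slice g z.2) z.1 (nu z) i j.
Let G i j (z : V) : R := invmx (metric (slice g z.2) z.1) i j.

(** The projection term with [<g, nu>] is kept: an extension [g] need not lie on the sphere at times
    before 0, nor be orthogonal to [nu] there. *)
Let sh i j : smooth U (h i j).
Proof.
have sD2 : smooth U (pd (e i) (pd (e j) g)) by do 2!apply: smooth_D.
have E z : U z -> dot (pd (e i) (pd (e j) g) z) (nu z)
    + - K * (dot (pd (e i) (pd (e j) g) z) (g z) * dot (g z) (nu z)) = h i j z.
  move=> Uz; rewrite /h mxE /sphere_hessian /sphere_proj dotBl dotZl.
  rewrite -pd_fE pd_slice -pdE pd_slice /slice; case: z Uz => u t _ /=.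
  ring.
have sK : smooth U (fun _ : V => - K : R) by exact: smooth_cst.
exact: (smooth_eq oU E (smoothD oU (smooth_dot oU sD2 snu)
  (smoothM oU sK (smoothM oU (smooth_dot oU sD2 sg) (smooth_dot oU sg snu))))).
Qed.

Lemma inv_slice_gram_smooth : smooth U (fun z => invmx (slice_gram z)).
Proof. by move=> k; apply: Ck_invmx => //; exact: slice_gram_smooth. Qed.

Let sG i j : smooth U (G i j).
Proof.
have E z : U z -> invmx (slice_gram z) i j = G i j z by move=> Uz;
  rewrite /G metric_slice_gram.
by apply: (smooth_eq oU E); move/(smooth_mxP oU) : inv_slice_gram_smooth; apply.
Qed.

Lemma patch_H_smooth : smooth U (patch_H K g nu).
Proof.
exact: (smooth_sum oU _ (fun i => smooth_sum oU _ (fun j =>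
  smoothM oU (sG i j) (sh i j)))).
Qed.

Lemma patch_A2_smooth : smooth U (patch_A2 K g nu).
Proof.
exact: (smooth_sum oU _ (fun i => smooth_sum oU _ (fun j => smooth_sum oU _ (fun k =>
  smooth_sum oU _ (fun l => smoothM oU (smoothM oU (smoothM oU (sG i j) (sG k l)) (sh
    i k)) (sh j l)))))).
Qed.

End FormSmooth.

Section LocalNormal.
Context {R : realType} {n : nat} {K : R} {M : topologicalType}.
Context {atlas : set (chart R n M)} {T : \bar R} {X : M -> R -> 'rV[R]_n.+2}.
Context (flow : mean_curvature_flow K atlas T X) (K_gt0 : 0 < K).
Let V := ('rV[R]_n * R)%type.
Let e := @space_dir R n.

(** At time t the flow and its extension agree on an open set of coordinates, so the
    reparametrization lemmas with [phi] the identity transfer all geometric quantities. *)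
Lemma germ c p t (U : set V) (g : V -> 'rV[R]_n.+2) nu :
  atlas c -> dom c p -> times T t -> open U -> U (coord c p, t) -> smooth U g ->
  (forall z, ((coord c @` dom c) `*` times T) z -> U z -> g z = in_chart X c z.2 z.1) ->
  [/\ row_free ('J (slice g t) (coord c p)),
    unit_normal (in_chart X c t) (coord c p) nu <->
      unit_normal (slice g t) (coord c p) nu &
    unit_normal (slice g t) (coord c p) nu ->
    normsq_second_form K (in_chart X c t) (coord c p) nu =
      normsq_second_form K (slice g t) (coord c p) nu /\
    mean_curvature K (in_chart X c t) (coord c p) nu =
      mean_curvature K (slice g t) (coord c p) nu].
Proof.
move=> ac cp Tt oU Uz sg gE.
pose O := [set v | U (v, t)]; have oO : open O by exact: slice_open.
have sO : smooth O (slice g t) by exact: smooth_slice.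
pose W := O `&` (coord c @` dom c).
have oW : open W by apply: openI => //; exact: image_open.
have Wu : W (coord c p) by split=> //; exists p.
have sid : smooth W (id : 'rV[R]_n -> 'rV[R]_n).
  by apply/(smooth_mxP oW) => i j; rewrite ord1; exact: (coordinate_smooth
    (row_coordinates n)).
have idO v : W v -> O (id v) by case.
have FE v : W v -> in_chart X c t v = slice g t (id v).
  by move=> [Uv cv]; rewrite /slice gE.
have Jfree := mcf_immersion flow ac cp Tt.
split.
- exact: (row_free_reparam oO oW sO sid idO FE Wu Jfree).
- exact: (unit_normal_reparam oO oW sO sid idO FE Wu nu Jfree).
- move=> h; split.
    exact: (normsq_reparam oO oW K sO sid idO FE Wu Jfree h).
  exact: (mean_curvature_reparam oO oW K sO sid idO FE Wu Jfree h).
Qed.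

(** A unit normal at the base point is projected, at nearby points, onto the complement of the
    position and the tangent space, and normalized. The domain is restricted to where the Gram
    matrix is invertible and the projection is nonzero. The time t0 = 0 is allowed, so the geometric
    claims are made only at times of the flow. *)
Lemma local_normal c p0 t0 : atlas c -> dom c p0 -> times T t0 ->
  exists (U : set V) (g nu : V -> 'rV[R]_n.+2),
  [/\ open U, U (coord c p0, t0), smooth U g, smooth U nu &
    (forall z, U z -> slice_gram g z \in unitmx) /\
    forall p t, dom c p -> times T t -> U (coord c p, t) ->
      [/\ g (coord c p, t) = X p t,
          row_free ('J (slice g t) (coord c p)),
          unit_normal (slice g t) (coord c p) (nu (coord c p, t)),
          unit_normal (in_chart X c t) (coord c p) (nu (coord c p, t)) &
        normsq_second_form K (in_chart X c t) (coord c p) (nu (coord c p, t)) =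
          patch_A2 K g nu (coord c p, t) /\
        mean_curvature K (in_chart X c t) (coord c p) (nu (coord c p, t)) =
          patch_H K g nu (coord c p, t)]].
Proof.
move=> ac cp0 Tt0.
have [|U0 [g [oU0 U0z sg gE]]] := mcf_smooth flow ac (x := (coord c p0, t0)).
  by split=> //=; exists p0.
set z0 : V := (coord c p0, t0) in U0z *.
have gX p t : dom c p -> times T t -> U0 (coord c p, t) -> g (coord c p, t) = X p t.
  by move=> cp Tt Uz; rewrite gE//=; [rewrite /in_chart coordK | split=> //; exists p].
have germ0 p t nu (cp : dom c p) (Tt : times T t) (Uz : U0 (coord c p, t)) :=
  germ nu ac cp Tt oU0 Uz sg gE.
have rowJ z i : U0 z -> row i ('J (slice g z.2) z.1) = pd (e i) g z.
  by move=> Uz; exact: (row_jacobian_slice oU0 sg Uz).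
(* Squaring turns the nonvanishing of the determinant into positivity, an open condition. *)
have sdet : smooth U0 (fun z => \det (slice_gram g z) ^+ 2).
  move=> k; have sd := Ck_det oU0 (slice_gram_smooth oU0 sg k).
  by apply: (eq_Ck oU0 _ (CkM oU0 sd sd)) => z _; rewrite expr2.
have pos_open : open [set x : R | 0 < x] by exact: open_gt.
pose U1 := U0 `&` (fun z => \det (slice_gram g z) ^+ 2) @^-1` [set x : R | 0 < x].
have oU1 : open U1.
  apply: open_setI_preimage => //.
  by move=> z Uz; have [+ _] := sdet 0%N; apply.
have U1E z : U1 z <-> U0 z /\ slice_gram g z \in unitmx.
  rewrite /U1 /= unitmxE unitfE; split=> -[Uz h]; split=> //.
    by apply/eqP => d0; move: h; rewrite /= d0 expr0n ltxx.
  by rewrite /= lt_neqAle eq_sym sqrf_eq0 h sqr_ge0.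
have U1S p t : dom c p -> times T t -> U0 (coord c p, t) -> U1 (coord c p, t).
  move=> cp Tt Uz; apply/U1E; split=> //; rewrite -(metric_slice_gram oU0 sg Uz).
  by have [fr _ _] := germ0 p t 0 cp Tt Uz; exact: gram_unit.
have sub1 z : U1 z -> U0 z by case.
have sg1 : smooth U1 g by move=> k; apply: Ck_subset (sg k) => z [].
have sG := inv_slice_gram_smooth oU1 sg1 (fun z Uz => (iffLR (U1E z) Uz).2).
have [nu0 nu0n] := @unit_normal_exists R n M X c p0 t0.
have nu0n' : unit_normal (slice g t0) (coord c p0) nu0.
  by have [_ [h _] _] := germ0 p0 t0 nu0 cp0 Tt0 U0z; exact: h.
(* By [parseval], this is [nu0] minus its tangential and radial components. At the base point it is
   [nu0] itself, so it stays nonzero nearby. *)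
pose eta (z : V) := nu0 + ((\sum_k \sum_l (- (invmx (slice_gram g z) k l *
  dot nu0 (pd (e k) g z))) *: pd (e l) g z)
   + (- K * dot nu0 (g z)) *: g z).
have sD k : smooth U1 (pd (e k) g) by exact: smooth_D.
have sn0 : smooth U1 (fun _ : V => nu0) by exact: smooth_cst.
have seta : smooth U1 eta.
  apply: (smoothD oU1 sn0); apply: (smoothD oU1).
    apply: (smooth_vsum oU1) => k; apply: (smooth_vsum oU1) => l.
    apply: (smooth_scale oU1 _ (sD l)); apply: (smoothN oU1).
    apply: (smoothM oU1 _ (smooth_dot oU1 sn0 (sD k))).
    exact: (iffLR (smooth_mxP oU1 _) sG k l).
  apply: (smooth_scale oU1 _ sg1).
  have sK : smooth U1 (fun _ : V => - K : R) by exact: smooth_cst.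
  exact: (smoothM oU1 sK (smooth_dot oU1 sn0 sg1)).
have see : smooth U1 (fun z => dot (eta z) (eta z)) by exact: (smooth_dot oU1 seta
  seta).
pose U2 := U1 `&` (fun z => dot (eta z) (eta z)) @^-1` [set x : R | 0 < x].
have oU2 : open U2.
  apply: open_setI_preimage => //.
  by move=> z Uz; have [+ _] := see 0%N; apply.
have sub2 z : U2 z -> U1 z by case.
have eta_orth p t : dom c p -> times T t -> U0 (coord c p, t) ->
    dot (X p t) (eta (coord c p, t)) = 0 /\
    forall i, dot (pd (e i) g (coord c p, t)) (eta (coord c p, t)) = 0.
  move=> cp Tt Uz.
  have gg : dot (g (coord c p, t)) (g (coord c p, t)) = K^-1.
    by rewrite gX//; exact: (mcf_sphere flow p Tt).
  (* The sphere relation for [g] is known only at times of the flow, so it is differentiated within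
     the slice at time t. *)
  have pg i : dot (pd (e i) g (coord c p, t)) (g (coord c p, t)) = 0.
    have oW : open ([set v | U0 (v, t)] `&` (coord c @` dom c)).
      by apply: openI; [exact: slice_open | exact: image_open].
    have Wu : ([set v | U0 (v, t)] `&` (coord c @` dom c)) (coord c p) by split=> //;
      exists p.
    have sW : smooth ([set v | U0 (v, t)] `&` (coord c @` dom c)) (slice g t).
      by move=> k; apply: Ck_subset (smooth_slice t sg k) => v [].
    have E0 : pd (delta_mx 0 i) (fun v => dot (slice g t v) (slice g t v)) (coord c
      p) = 0.
      rewrite (@eq_pd _ _ _ oW _ Wu _ _ (fun _ => K^-1)) ?pd_cst// => v [Uv [q cq qv]].
      by rewrite -qv /slice gX ?qv//; exact: (mcf_sphere flow q Tt).
    move: E0; rewrite (pd_dot oW Wu _ sW sW) pd_slice /slice (dotC (g _)).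
    by move: (dot _ _) => y E0; lra.
  have un := (iffLR (U1E _) (U1S _ _ cp Tt Uz)).2.
  have dS w : dot (eta (coord c p, t)) w = dot nu0 w
     - \sum_k \sum_l invmx (slice_gram g (coord c p, t)) k l *
       (dot nu0 (pd (e k) g (coord c p, t)) * dot (pd (e l) g (coord c p, t)) w)
     - K * dot nu0 (g (coord c p, t)) * dot (g (coord c p, t)) w.
    rewrite /eta !dotDl dotZl dot_suml addrA; congr (_ + _ + _); last by rewrite !mulNr.
    rewrite -sumrN; apply: eq_bigr => k _; rewrite dot_suml -sumrN; apply: eq_bigr =>
      l _.
    by rewrite dotZl; ring.
  split=> [|i].
    rewrite -(gX p t cp Tt Uz) dotC dS gg big1 => [|k _]; last first.
      by rewrite big1// => l _; rewrite pg !mulr0.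
    by rewrite subr0 mulrAC mulfV ?gt_eqF// mul1r subrr.
  rewrite dotC dS (dotC (g _)) pg mulr0 subr0.
  rewrite (_ : \sum_k _ = dot nu0 (pd (e i) g (coord c p, t))) ?subrr//.
  transitivity (\sum_k (k == i)%:R * dot nu0 (pd (e k) g (coord c p, t)));
    last exact: sum_delta.
  apply: eq_bigr => k _.
  have -> : (k == i)%:R = \sum_l invmx (slice_gram g (coord c p, t)) k l *
    slice_gram g (coord c p, t) l i.
    by have := mulVmx un; move/matrixP/(_ k i); rewrite !mxE => <-.
  rewrite mulr_suml; apply: eq_bigr => l _; rewrite [slice_gram _ _ l i]mxE; ring.
have U1z : U1 z0 by exact: U1S.
have [nn0 fn0 Jn0] := nu0n'.
have eta0 : eta z0 = nu0.
  rewrite /eta big1 => [|k _].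
    by rewrite (dotC nu0) [dot _ nu0]fn0 mulr0 scale0r !addr0.
  rewrite big1// => l _; rewrite (dotC nu0).
  have := Jn0 k; rewrite (rowJ z0 k U0z) => ->.
  by rewrite mulr0 oppr0 scale0r.
have U2z : U2 z0 by split=> //=; rewrite eta0 nn0.
pose nu z := (Num.sqrt (dot (eta z) (eta z)))^-1 *: eta z.
have snu : smooth U2 nu.
  have eta2 : smooth U2 eta by move=> k; apply: Ck_subset (seta k) => z [].
  apply: (smooth_scale oU2 _ eta2) => k.
  apply: CkV => //; first by move=> z [_ z0']; rewrite gt_eqF// sqrtr_gt0.
  apply: Ck_sqrt => //; first by move=> z [].
  by apply: Ck_subset (see k) => z [].
exists U2, g, nu; split; [exact: oU2|exact: U2z| |exact: snu|].
  by move=> k; apply: Ck_subset (sg k) => z [[]].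
split; first by move=> z [/U1E[]].
move=> p t cp Tt U2p; have Uz := sub1 _ (sub2 _ U2p).
have [fr nE qE] := germ0 p t (nu (coord c p, t)) cp Tt Uz.
have [Xeta geta] := eta_orth p t cp Tt Uz.
have nuN : unit_normal (slice g t) (coord c p) (nu (coord c p, t)).
  split.
  - apply: dot_normalize; apply/eqP => e0; have := U2p.2.
    by rewrite /= e0 dot0l ltxx.
  - by rewrite /slice (gX p t cp Tt Uz) /nu dotZr Xeta mulr0.
  - by move=> i; rewrite (rowJ (coord c p, t) i Uz) /nu dotZr geta mulr0.
split; [exact: (gX p t cp Tt Uz)|exact: fr|exact: nuN|exact: (iffRL nE nuN)|exact:
  (qE nuN)].
Qed.

End LocalNormal.

(** * Patches of the flow at positive times *)

Section InteriorPatch.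
Context {R : realType} {n : nat} {K : R} {M : topologicalType}.
Context {atlas : set (chart R n M)} {T : \bar R} {X : M -> R -> 'rV[R]_n.+2}.
Context (flow : mean_curvature_flow K atlas T X) (K_gt0 : 0 < K).
Let V := ('rV[R]_n * R)%type.

Lemma times_near (t : R) : 0 < t -> (t%:E < T)%E -> \forall s \near t, times T s.
Proof.
move=> t0 tT.
have o : open [set s : R | 0 < s] by exact: open_gt.
have n1 : \forall s \near t, 0 < s by exact: (open_near o t0).
have o' : open [set s : R | (s%:E < T)%E] by exact: open_ereal_lt.
have n2 : \forall s \near t, (s%:E < T)%E by exact: (open_near o' tT).
by near=> s; split; [apply/ltW; near: s | near: s].
Unshelve. all: by end_near. Qed.

(** For 0 < t < T every time close to t belongs to the flow, so the limit restricted to [times T] is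
    the full limit of difference quotients of [g]. *)
Lemma velocity_derive c p t nu (U : set V) (g : V -> 'rV[R]_n.+2) :
  atlas c -> dom c p -> 0 < t -> (t%:E < T)%E -> open U -> U (coord c p, t) ->
  (forall s, times T s -> U (coord c p, s) -> g (coord c p, s) = X p s) ->
  unit_normal (in_chart X c t) (coord c p) nu ->
  'D_time_dir g (coord c p, t) = mean_curvature K (in_chart X c t) (coord c p) nu *: nu.
Proof.
move=> ac cp t0 tT oU Uz gX cnu.
have Tt : times T t by split=> //; exact: ltW.
have vel := mcf_velocity flow ac cp Tt cnu.
rewrite /derive; apply: cvg_lim => //.
have shift_cvg : (fun h : R => h + t) @ 0^' --> within (times T) t^'.
  move=> A; rewrite /within/= => hA.
  have {}hA : \forall s \near t, s != t -> times T s -> A s by exact: hA.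
  have hT := times_near t0 tT.
  have H : \forall s \near t, s != t -> A s.
    by apply: filter_app hA; apply: filter_app hT => /=; near=> s => Ts h st; exact: h.
  move/nbhs_ballP : H => [r /= r0 rH].
  apply/nbhs_ballP; exists r => //= h hr h0; apply: rH.
    by move: hr; rewrite -!ball_normE /ball_/= sub0r normrN opprD addrCA subrr addr0
      normrN.
  by rewrite -subr_eq0 addrK.
have lim := cvg_comp _ _ shift_cvg vel.
apply: cvg_trans lim; apply: near_eq_cvg.
have nT : \forall h \near (0 : R), times T (h + t) /\ U (coord c p, h + t).
  have H : \forall s \near t, times T s /\ U (coord c p, s).
    have h1 := times_near t0 tT; have h2 := @time_nbhs R n U (coord c p) t (open_near
      oU Uz).
    by apply: filter_app h1; apply: filter_app h2; near=> s => ? ?.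
  move/nbhs_ballP : H => [r /= r0 rH].
  apply/nbhs_ballP; exists r => //= h hr; apply: rH.
  by move: hr; rewrite -!ball_normE /ball_/= sub0r normrN opprD addrCA subrr addr0
    normrN.
have nT' : \forall h \near 0^', times T (h + t) /\ U (coord c p, h +
  t) by exact: cvg_within nT.
apply: filter_app nT'; near=> h => -[Th Uh] /=.
rewrite addrK -(gX _ Th Uh) -(gX _ Tt Uz); congr (_ *: (g _ - _)).
by apply: injective_projections => /=; rewrite ?scaler0 ?add0r// [h *: 1]mulr1.
Unshelve. all: by end_near. Qed.

(** Restricting the neighbourhood of [local_normal] to chart coordinates and times in (0, T) makes
    every one of its points a point of the flow, so its pointwise conclusions hold on an open
    set. *)
Lemma interior_patch c p0 t0 : atlas c -> dom c p0 -> 0 < t0 -> (t0%:E < T)%E ->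
  exists (U : set V) (g nu : V -> 'rV[R]_n.+2),
  [/\ mcf_patch K U g nu, U (coord c p0, t0) &
    forall z, U z -> exists p, [/\ dom c p, times T z.2, z = (coord c p, z.2),
      unit_normal (in_chart X c z.2) (coord c p) (nu z) &
      normsq_second_form K (in_chart X c z.2) (coord c p) (nu z) = patch_A2 K g nu z /\
      mean_curvature K (in_chart X c z.2) (coord c p) (nu z) = patch_H K g nu z]].
Proof.
move=> ac cp0 t0gt t0T.
have Tt0 : times T t0 by split=> //; exact: ltW.
have [U [g [nu [oU Uz sg snu [_ loc]]]]] := local_normal flow K_gt0 ac cp0 Tt0.
pose Ix : set V := fst @^-1` (coord c @` dom c).
pose It : set V := snd @^-1` ([set s : R | 0 < s] `&` [set s : R | (s%:E < T)%E]).
have oIx : open Ix by apply: open_comp; [move=> z _;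
  exact: cvg_fst | exact: image_open].
have oIt : open It.
  apply: open_comp; first by move=> z _; exact: cvg_snd.
  apply: openI; [exact: open_gt | exact: open_ereal_lt].
pose U' := U `&` (Ix `&` It).
have oU' : open U' by apply: openI => //; exact: openI.
have sub z : U' z -> U z by case.
have U'E z : U' z -> exists p, [/\ dom c p, times T z.2, z = (coord c p, z.2),
  0 < z.2 & (z.2%:E < T)%E].
  case: z => v t [_ [[p cp pv] [s0 sT]]]; rewrite /= in pv s0 sT; exists p;
    rewrite pv; split => //.
  by split=> //; exact: ltW.
exists U', g, nu; split.
- split.
  + exact: oU'.
  + by move=> k; apply: Ck_subset (sg k).
  + by move=> k; apply: Ck_subset (snu k).
  + move=> z Uz'; have [p [cp Tz zE _ _]] := U'E z Uz'.
    have Uz0 := sub _ Uz'; rewrite zE in Uz0 *.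
    have [-> _ _ _ _] := loc p z.2 cp Tz Uz0; exact: (mcf_sphere flow p Tz).
  + move=> z Uz'; have [p [cp Tz zE _ _]] := U'E z Uz'.
    have Uz0 := sub _ Uz'; rewrite zE in Uz0 *.
    by have [_ fr _ _ _] := loc p z.2 cp Tz Uz0; exact: fr.
  + move=> z Uz'; have [p [cp Tz zE _ _]] := U'E z Uz'.
    have Uz0 := sub _ Uz'; rewrite zE in Uz0 *.
    by have [_ _ nn _ _] := loc p z.2 cp Tz Uz0; exact: nn.
  + move=> z Uz'; have [p [cp Tz zE z0 zT]] := U'E z Uz'.
    have Uz0 := sub _ Uz'; rewrite zE in Uz0 *.
    have [_ _ _ nn [_ HE]] := loc p z.2 cp Tz Uz0.
    have gX s : times T s -> U (coord c p, s) -> g (coord c p, s) = X p s.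
      by move=> Ts Us; have [h _ _ _ _] := loc p s cp Ts Us; exact: h.
    by rewrite (velocity_derive ac cp z0 zT oU Uz0 gX nn) HE.
- split; first exact: Uz.
  by split; [exists p0 | split].
- move=> z Uz'; have [p [cp Tz zE _ _]] := U'E z Uz'.
  have Uz0 := sub _ Uz'; rewrite zE in Uz0.
  have [_ _ _ nn eqs] := loc p z.2 cp Tz Uz0.
  by exists p; rewrite zE; split.
Qed.

End InteriorPatch.

(** * Preservation of pinching *)

Section Continuity.
Context {R : realType} {n : nat} {M : topologicalType}.
Let V := ('rV[R]_n * R)%type.

Lemma chart_map_continuous (c : chart R n M) (y : M * R) : dom c y.1 ->
  {for y, continuous (fun y : M * R => (coord c y.1, y.2) : V)}.
Proof.
move=> cy; have cc := open_within_continuous (@dom_open _ _ _ c) (@coord_continuous _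
  _ _ c) cy.
have c1 : (fun y : M * R => coord c y.1) @ y --> coord c y.1.
  by apply: (@continuous_comp _ _ _ (fst : M * R -> M) (coord c) y) => //;
    exact: cvg_fst.
have c2 : (fun y : M * R => y.2) @ y --> y.2 by exact: cvg_snd.
exact: (cvg_pair c1 c2).
Qed.

(** Continuity relative to [D], in particular at time 0, where [psi] also involves times outside the
    flow. *)
Lemma within_chart_cvg (D : set (M * R)) (f : M * R -> R) (psi : V -> R)
    (c : chart R n M) (U : set V) (y : M * R) :
  dom c y.1 -> D y -> open U -> U (coord c y.1, y.2) ->
  {for (coord c y.1, y.2), continuous psi} ->
  (forall y', dom c y'.1 -> D y' -> U (coord c y'.1, y'.2) ->
     f y' = psi (coord c y'.1, y'.2)) ->
  f @ within D (nbhs y) --> f y.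
Proof.
move=> cy Dy oU Uy cpsi fE.
have cm := chart_map_continuous cy.
have cU : \forall y' \near y, U (coord c y'.1, y'.2) by apply: cm;
  exact: (open_near oU Uy).
have cd : \forall y' \near y, dom c y'.1.
  have cf : (fst : M * R -> M) @ y --> y.1 by exact: cvg_fst.
  by apply: cf; exact: (open_near (@dom_open _ _ _ c) cy).
have lim : (fun y' : M * R => psi (coord c y'.1, y'.2)) @ within D (nbhs y) --> f y.
  rewrite (fE y cy Dy Uy); apply: cvg_within_filter.
  exact: (@continuous_comp _ _ _ (fun y : M * R => (coord c y.1,
    y.2) : V) psi y cm cpsi).
apply: cvg_trans lim; apply: near_eq_cvg; rewrite /within/=.
apply: filter_app cU; apply: filter_app cd; near=> y' => dy' Uy' Dy'.
by rewrite fE.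
Unshelve. all: by end_near. Qed.

End Continuity.

Section Arithmetic.
Context {R : realType}.

(* [A] is |A|^2, [B] is H^2 and [mu] is m - alpha. *)
Lemma pinching_reaction (n K mu A B a b l : R) :
  0 < K -> 0 < mu -> 2 * mu < n -> a = (n - mu)^-1 -> b = 2 * mu * K ->
  2 * (A + n * K) <= l -> 0 < A - a * B - b ->
  2 * A ^+ 2 + 4 * K * B - 2 * n * K * A - 2 * a * B * (A + n * K) < l * (A - a *
    B - b).
Proof.
move=> K0 mu0 mun aE bE hl y0.
have w0 : 0 < n - mu by lra.
have BE : B = (n - mu) * (A - b - (A - a * B - b)).
  by rewrite aE; field; rewrite gt_eqF.
have : 2 * (A + n * K) * (A - a * B - b) <= l * (A - a *
  B - b) by rewrite ler_wpM2r// ltW.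
(* With y = A - a B - b, both a B = A - b - y and B = (n - mu)(A - b - y) are substituted. The terms
   linear in A then have coefficient 2 b - 4 n K + 4 K (n - mu), which vanishes for b = 2 mu K; the
   constant left is 2 b n K - 4 K (n - mu) b = - 4 K^2 mu (n - 2 mu). *)
have -> : 2 * A ^+ 2 + 4 * K * B - 2 * n * K * A - 2 * a * B * (A + n * K) =
   2 * (A + n * K) * (A - a * B - b) - (4 * K * (n - mu) * (A - a * B - b)
     + 4 * K ^+ 2 * mu * (n - 2 * mu)).
  have E : a * B = A - b - (A - a * B - b) by ring.
  move: BE; move: (A - a * B - b) E => y E BE.
  rewrite -[2 * a * B]mulrA E BE bE; ring.
have p1 : 0 < 4 * K * (n - mu) * (A - a * B - b) by rewrite !mulr_gt0.
have p2 : 0 < 4 * K ^+ 2 * mu * (n - 2 * mu).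
  by rewrite !mulr_gt0// ?exprn_gt0// subr_gt0.
by move: (_ * (n - mu) * _) p1 => p p1; move: (_ * (n - 2 * mu)) p2 => q p2; lra.
Qed.

End Arithmetic.

Theorem theorem2p1 (R : realType) (n m : nat) (K alpha : R)
    (M : topologicalType) (atlas : set (chart R n M)) (T : \bar R)
    (X : M -> R -> 'rV[R]_n.+2)
    (n_ge2 : (2 <= n)%N) (K_gt0 : 0 < K)
    (m_range : (1 <= m <= n)%N) (alpha_range : 0 < alpha < 1)
    (M_manifold : smooth_manifold atlas) (M_compact : compact [set: M])
    (T_gt0 : (0 < T)%E)
    (X_mcf : mean_curvature_flow K atlas T X)
    (X_pinched0 : forall p : M, pinched m K alpha atlas X p 0)
    (m_small : m%:R < alpha + Num.min (n%:R / 2) (2 * (n%:R - 1) / 3)) :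
  forall (t : R) (p : M), 0 <= t -> (t%:E < T)%E ->
    pinched m K alpha atlas X p t.
Proof.
move=> t1 p t1_ge0 t1T c0 nu0 ac0 cp0 nu0n; rewrite leNgt; apply/negP => viol.
have [/andP[m1 _] /andP[al0 al1]] := (m_range, alpha_range).
pose mu : R := m%:R - alpha.
have m1R : 1 <= m%:R :> R by rewrite ler1n.
have mu0 : 0 < mu by rewrite /mu; lra.
have [mu1 mu2] : mu < n%:R / 2 /\ mu < 2 * (n%:R - 1) / 3.
  by move: m_small; rewrite -ltrBlDl lt_min => /andP[].
pose w : R := n%:R - mu.
have wE : n%:R - m%:R + alpha = w by rewrite /w /mu; ring.
have w0 : 0 < w by rewrite /w; lra.
pose a := w^-1; pose b := 2 * mu * K.
have a0 : 0 <= a by rewrite invr_ge0 ltW.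
have an : a * n.+2%:R <= 3.
  by rewrite /a mulrC ler_pdivrMr// -addn2 natrD /w; lra.
have exch q : exists c, atlas c /\ dom c q.
  by have [c ac cq] := atlas_cover M_manifold q; exists c.
have [ch chP] := choice exch.
(* Charts and normals are chosen pointwise, with no continuity; by [indep] the resulting [A2] and
   [H2] do not depend on the choice at times of the flow. *)
have [N NP] := choice (fun y : M * R => @unit_normal_exists R n M X (ch y.1) y.1 y.2).
pose A2 y := normsq_second_form K (in_chart X (ch y.1) y.2) (coord (ch y.1) y.1) (N y).
pose H2 y := mean_curvature K (in_chart X (ch y.1) y.2) (coord (ch y.1) y.1) (N y) ^+ 2.
have indep c q t nu : atlas c -> dom c q -> times T t ->
    unit_normal (in_chart X c t) (coord c q) nu ->
    normsq_second_form K (in_chart X c t) (coord c q) nu = A2 (q, t) /\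
    mean_curvature K (in_chart X c t) (coord c q) nu ^+ 2 = H2 (q, t).
  move=> ac cq Tt cnu; have [acq dcq] := chP q.
  exact: (chart_independent M_manifold X_mcf K_gt0 ac acq cq dcq Tt cnu (NP (q, t))).
pose D : set (M * R) := [set: M] `*` `[0, t1].
have DT y : D y -> times T y.2.
  move=> [_]; rewrite /= in_itv/= => /andP[y0 y1]; split=> //.
  by apply: le_lt_trans t1T; rewrite lee_fin.
(* Continuity of [A2] and [H2] on [D] is read off from the smooth local normal near each point,
   despite the arbitrary choices. *)
have local y : D y -> exists (U : set ('rV[R]_n * R)) (fA fH : 'rV[R]_n * R -> R),
    [/\ open U, U (coord (ch y.1) y.1, y.2),
      {for (coord (ch y.1) y.1, y.2), continuous fA},
      {for (coord (ch y.1) y.1, y.2), continuous fH} &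
      forall y', dom (ch y.1) y'.1 -> D y' -> U (coord (ch y.1) y'.1, y'.2) ->
        A2 y' = fA (coord (ch y.1) y'.1, y'.2) /\ H2 y' = fH (coord (ch y.1) y'.1,
          y'.2) ^+ 2].
  move=> Dy; have [acy dcy] := chP y.1.
  have [U [g [nu [oU Uy sg snu [gu loc]]]]] := local_normal X_mcf K_gt0 acy dcy (DT y
    Dy).
  exists U, (patch_A2 K g nu), (patch_H K g nu); split.
  - exact: oU.
  - exact: Uy.
  - by have [+ _] := patch_A2_smooth K oU sg snu gu 0%N; exact.
  - by have [+ _] := patch_H_smooth K oU sg snu gu 0%N; exact.
  move=> [q t] /= cq Dq Uq; have [_ _ _ nn [<- <-]] := loc q t cq (DT _ Dq) Uq.
  by have [-> ->] := indep _ q t _ acy cq (DT _ Dq) nn.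
have cD : compact D by apply: compact_setX => //; exact: segment_compact.
have D1 : D (p, t1) by split=> //=; rewrite in_itv/= t1_ge0 lexx.
have D0 : D !=set0 by exists (p, t1).
have cA : {within D, continuous A2}.
  apply/subspace_continuousP => y Dy; have [U [fA [fH [oU Uy cfA _ loc]]]] :=
    local y Dy.
  apply: (within_chart_cvg (chP y.1).2 Dy oU Uy cfA) => y' cy' Dy' Uy'.
  exact: (loc y' cy' Dy' Uy').1.
have [yA _ hA] := compact_EVT_max D0 cD cA.
(* Twice the maximum over [D] of |A|^2 + n K, so that 2 (|A|^2 + n K) Q <= l Q wherever Q > 0. *)
pose l := 2 * (A2 yA + n%:R * K).
pose Q y := A2 y - a * H2 y - b.
pose f y := expR (- l * y.2) * Q y.
have cf : {within D, continuous f}.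
  apply/subspace_continuousP => y Dy; have [U [fA [fH [oU Uy cfA cfH loc]]]] :=
    local y Dy.
  pose psi (z : 'rV[R]_n * R) := expR (- l * z.2) * (fA z - a * (fH z * fH z) - b).
  have cpsi : {for (coord (ch y.1) y.1, y.2), continuous psi}.
    apply: continuousM.
      apply: (continuous_comp (f := fun z : 'rV[R]_n * R => - l * z.2)).
        by apply: continuousM; [exact: cst_continuous | exact: cvg_snd].
      exact: continuous_expR.
    apply: continuousB; last exact: cst_continuous.
    apply: continuousB => //; apply: continuousM; first exact: cst_continuous.
    exact: continuousM.
  apply: (within_chart_cvg (chP y.1).2 Dy oU Uy cpsi) => y' cy' Dy' Uy'.
  have [EA EH] := loc y' cy' Dy' Uy'; transitivity (f y') => //.
  by rewrite /f /Q EA EH /psi expr2.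
have [[q s] Dq hf] := compact_EVT_max D0 cD cf.
have {}Dq : D (q, s) by rewrite inE in Dq.
have Qviol : 0 < Q (p, t1).
  have [EA EH] := indep c0 p t1 nu0 ac0 cp0 (DT _ D1) nu0n.
  move: viol; rewrite EA EH wE -/a -/mu -/b /Q => h.
  by rewrite -addrA -opprD subr_gt0.
have Qq : 0 < Q (q, s).
  have : 0 < f (q, s).
    by apply: lt_le_trans (hf (p, t1) _); rewrite ?inE//;
      rewrite /f mulr_gt0// expR_gt0.
  by rewrite /f pmulr_rgt0// expR_gt0.
have Ts := DT _ Dq.
have [acq dcq] := chP q.
have s0 : 0 < s.
  have [_ /=] := Dq; rewrite in_itv/= => /andP[s_ge0 _].
  rewrite lt_neqAle s_ge0 andbT; apply/eqP => s0; rewrite -{}s0 in Qq Ts *.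
  have := X_pinched0 q (ch q) (N (q, 0)) acq dcq (NP (q, 0)).
  rewrite wE -/a -/mu -/b -[normsq_second_form _ _ _ _]/(A2 (q, 0)) -[_ ^+ 2]/(H2 (q,
    0)).
  by move: Qq; rewrite /Q; lra.
have [U [g [nu [P Uz loc]]]] := interior_patch X_mcf K_gt0 acq dcq s0 Ts.2.
have locE z : U z -> exists q', [/\ dom (ch q) q', times T z.2, z = (coord (ch q) q',
  z.2),
    A2 (q', z.2) = patch_A2 K g nu z & H2 (q', z.2) = patch_H K g nu z ^+ 2].
  move=> /loc[q' [cq' Tz zE nn [EA EH]]]; exists q'; split=> //.
    by rewrite -EA; have [-> _] := indep _ q' z.2 _ acq cq' Tz nn.
  by rewrite -EH; have [_ ->] := indep _ q' z.2 _ acq cq' Tz nn.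
set z0 := (coord (ch q) q, s) in Uz *.
have z0E : A2 (q, s) = patch_A2 K g nu z0 /\ H2 (q, s) = patch_H K g nu z0 ^+ 2.
  have [q' [cq' _ [qq'] EA EH]] := locE z0 Uz.
  suff -> : q = q' by [].
  by rewrite -(coordK dcq) qq' coordK.
have QE z q' : A2 (q', z.2) = patch_A2 K g nu z -> H2 (q', z.2) =
  patch_H K g nu z ^+ 2 ->
    Q (q', z.2) = patch_defect K g nu a z - b.
  by move=> EA EH; rewrite /Q EA EH.
have := @patch_max R n K K_gt0 U g nu P z0 Uz a b l a0 an.
have hmax : \forall y \near z0, y.2 <= z0.2 ->
    expR (- l * y.2) * (patch_defect K g nu a y - b) <=
    expR (- l * z0.2) * (patch_defect K g nu a z0 - b).
  apply: filter_app (open_near (patch_open P) Uz); near=> y => Uy ys.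
  have [q' [cq' [y0 yT] _ EA EH]] := locE y Uy.
  rewrite -(QE y q' EA EH) -(QE z0 q z0E.1 z0E.2); apply: (hf (q', y.2)).
  rewrite inE; split=> //=; rewrite in_itv/= y0/=; apply: le_trans ys _.
  by have [_ /=] := Dq; rewrite in_itv/= => /andP[].
move=> /(_ hmax); rewrite -(QE z0 q z0E.1 z0E.2) -z0E.1 -z0E.2.
(* [patch_max] has bounded l Q by the reaction terms at the maximum; since Q > 0 there,
   [pinching_reaction] gives the strict opposite inequality. *)
rewrite leNgt => /negP; apply; rewrite /Q.
apply: (@pinching_reaction R n%:R K mu) => //; first by lra.
  by rewrite /l ler_pM2l// lerD2r; apply: hA; rewrite inE.
Unshelve. all: by end_near. Qed.
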